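(* Let $\mathcal{C}$ be either $\mathcal{C}_{HS}$ or $\mathcal{C}_P$. Let $G_1$ and $G_2$ be finitely generated $\mathcal{C}$-stable groups, let $H$ be a finite group and let $i_j\colon H\to G_j$ $(j=1,2)$ be injective homomorphisms such that $i_j(H)$ is normal in $G_j$ for $j=1,2$. Then the amalgamated free product $G_1*_HG_2$ is $\mathcal{C}$-stable.
   Context: $\mathcal{C}_{HS}$ is the class of groups $\mathrm{Aut}(X)$, where $X$ is a finite-dimensional Hilbert space and $\mathrm{Aut}(X)$ is its unitary group, with the metric $d(A_1,A_2)=\|A_1-A_2\|_{HS}$, $\|A\|_{HS}=\mathrm{Tr}(A^*A)^{1/2}$, $\mathrm{Tr}$ the normalized trace. $\mathcal{C}_P$ is the class of groups $\mathrm{Aut}(X)$, where $X$ is a finite set and $\mathrm{Aut}(X)$ is its symmetric group, with the normalized Hamming metric $d(\sigma_1,\sigma_2)=\frac{1}{|X|}\#\{x\in X:\sigma_1(x)\neq\sigma_2(x)\}$. A group $G$ is $\mathcal{C}$-stable if for any sequence of maps $\varphi_n\colon G\to\mathrm{Aut}(X_n)\in\mathcal{C}$ with $d(\varphi_n(g)\varphi_n(h),\varphi_n(gh))\to0$ as $n\to\infty$ for all $g,h\in G$, there is a sequence of homomorphisms $\psi_n\colon G\to\mathrm{Aut}(X_n)$ with $d(\varphi_n(g),\psi_n(g))\to0$ for all $g\in G$. $G_1*_HG_2:=(G_1*G_2)/\langle\langle i_1(h)i_2(h)^{-1}: h\in H\rangle\rangle$. *)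

(* Defs.v *)
From HB Require Import structures.
From mathcomp Require Import all_boot all_order all_algebra all_fingroup.
From mathcomp Require Import spectral generic_quotient complex.
From mathcomp Require Import boolp classical_sets reals.
From mathcomp Require Import topology normedtype sequences.

Set Implicit Arguments.
Unset Strict Implicit.
Unset Printing Implicit Defensive.

Import Order.TTheory GRing.Theory Num.Theory.
Import numFieldNormedType.Exports.
Local Open Scope classical_set_scope.
Local Open Scope ring_scope.

Section Subgroups.
Local Open Scope group_scope.
Variable G : groupType.

Definition is_subgroup (A : set G) : Prop :=
  A 1 /\ (forall x y, A x -> A y -> A (x * y^-1)).

Definition is_normal_subgroup (A : set G) : Prop :=
  is_subgroup A /\ (forall x g, A x -> A (x ^ g)).

Definition normal_closure (S : set G) : set G := smallest is_normal_subgroup S.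

Definition finitely_generated : Prop :=
  exists s : seq G, smallest is_subgroup [set` s] = [set: G].

Lemma normal_closure_normal S : is_normal_subgroup (normal_closure S).
Proof.
split; first split.
- by move=> A [[[]]].
- move=> x y Nx Ny A HA; case: (HA) => -[[_ As] _] _.
  by apply: As; [exact: Nx | exact: Ny].
by move=> x g Nx A HA; case: (HA) => -[_ An] _; apply: An; exact: Nx.
Qed.

End Subgroups.

Section QuotientByNormalClosure.
Local Open Scope group_scope.
Local Open Scope quotient_scope.
Variables (G : groupType) (S : set G).

Let N := normal_closure S.

Let N1 : N 1. Proof. by case: (normal_closure_normal S) => -[]. Qed.
Let NV x : N x -> N x^-1.
Proof.
case: (normal_closure_normal S) => -[_ h] _ Nx.
by have := h _ _ N1 Nx; rewrite mul1g.
Qed.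
Let NM x y : N x -> N y -> N (x * y).
Proof.
case: (normal_closure_normal S) => -[_ h] _ Nx Ny.
by have := h _ _ Nx (NV Ny); rewrite invgK.
Qed.
Let NJ x g : N x -> N (x ^ g).
Proof. by case: (normal_closure_normal S) => _; apply. Qed.

Definition coset_eq (x y : G) : bool := `[< normal_closure S (x^-1 * y) >].

Lemma coset_eq_refl : reflexive coset_eq.
Proof. by move=> x; apply/asboolP; rewrite mulVg. Qed.

Lemma coset_eq_sym : symmetric coset_eq.
Proof.
by move=> x y; apply/asboolP/asboolP => /NV; rewrite invgM invgK.
Qed.

Lemma coset_eq_trans : transitive coset_eq.
Proof.
move=> y x z /asboolP xy /asboolP yz; apply/asboolP.
by have := NM xy yz; rewrite -mulgA mulKVg.
Qed.

Canonical coset_equiv :=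
  EquivRel coset_eq coset_eq_refl coset_eq_sym coset_eq_trans.

(* G / <<S>>, with <<S>> the normal closure of S. *)
Definition quotient_group : Type := {eq_quot coset_equiv}.
HB.instance Definition _ := Choice.on quotient_group.

Definition quotient_proj (x : G) : quotient_group := \pi_{eq_quot coset_equiv} x.
Definition quotient_repr (u : quotient_group) : G :=
  repr (u : {eq_quot coset_equiv}).

Definition quotient_mul (u v : quotient_group) : quotient_group :=
  quotient_proj (quotient_repr u * quotient_repr v).
Definition quotient_inv (u : quotient_group) : quotient_group :=
  quotient_proj (quotient_repr u)^-1.

Lemma quotient_reprK u : quotient_proj (quotient_repr u) = u.
Proof. exact: reprK. Qed.

Lemma quotient_projP x y :
  quotient_proj x = quotient_proj y <-> normal_closure S (x^-1 * y).
Proof.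
rewrite /quotient_proj; split; first by move/eqmodP/asboolP.
by move=> h; apply/eqmodP/asboolP.
Qed.

Lemma quotient_projM x y :
  quotient_mul (quotient_proj x) (quotient_proj y) = quotient_proj (x * y).
Proof.
set u := quotient_proj x; set v := quotient_proj y; apply/quotient_projP.
set a := quotient_repr u; set b := quotient_repr v.
have ax : N (a^-1 * x) by apply/quotient_projP; rewrite quotient_reprK.
have By : N (b^-1 * y) by apply/quotient_projP; rewrite quotient_reprK.
have := NM (NJ b ax) By.
by rewrite /conjg invgM -!mulgA mulKVg.
Qed.

Lemma quotient_projV x :
  quotient_inv (quotient_proj x) = quotient_proj x^-1.
Proof.
set u := quotient_proj x; apply/quotient_projP; rewrite invgK.
set a := quotient_repr u.
have ax : N (a^-1 * x) by apply/quotient_projP; rewrite quotient_reprK.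
have := NJ a^-1 (NV ax).
by rewrite /conjg invgM !invgK -!mulgA mulgV mulg1.
Qed.

Lemma quotient_mulA : associative quotient_mul.
Proof.
move=> u v w; rewrite -(quotient_reprK u) -(quotient_reprK v).
by rewrite -(quotient_reprK w) !quotient_projM mulgA.
Qed.
Lemma quotient_mul1g : left_id (quotient_proj 1) quotient_mul.
Proof.
by move=> u; rewrite -(quotient_reprK u) quotient_projM mul1g.
Qed.
Lemma quotient_mulg1 : right_id (quotient_proj 1) quotient_mul.
Proof.
by move=> u; rewrite -(quotient_reprK u) quotient_projM mulg1.
Qed.
Lemma quotient_mulVg : left_inverse (quotient_proj 1) quotient_inv quotient_mul.
Proof.
by move=> u; rewrite -(quotient_reprK u) quotient_projV quotient_projM mulVg.
Qed.
Lemma quotient_mulgV : right_inverse (quotient_proj 1) quotient_inv quotient_mul.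
Proof.
by move=> u; rewrite -(quotient_reprK u) quotient_projV quotient_projM mulgV.
Qed.

HB.instance Definition _ := isGroup.Build quotient_group
  quotient_mulA quotient_mul1g quotient_mulg1 quotient_mulVg quotient_mulgV.

End QuotientByNormalClosure.

Section FreeProduct.
Local Open Scope group_scope.
Local Open Scope quotient_scope.
Variables G1 G2 : groupType.

(* Words over the disjoint union of G1 and G2, modulo the congruence generated
   by the multiplication tables of G1 and G2. *)
Inductive word_eqv : seq (G1 + G2)%type -> seq (G1 + G2)%type -> Prop :=
| word_refl s : word_eqv s s
| word_sym s t : word_eqv s t -> word_eqv t s
| word_trans s t u : word_eqv s t -> word_eqv t u -> word_eqv s u
| word_cat s s' t t' :
    word_eqv s s' -> word_eqv t t' -> word_eqv (s ++ t) (s' ++ t')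
| word_1l : word_eqv [:: inl 1] [::]
| word_1r : word_eqv [:: inr 1] [::]
| word_Ml (a b : G1) : word_eqv [:: inl a; inl b] [:: inl (a * b)]
| word_Mr (a b : G2) : word_eqv [:: inr a; inr b] [:: inr (a * b)].

Definition word_eq (s t : seq (G1 + G2)%type) : bool := `[< word_eqv s t >].

Lemma word_eq_refl : reflexive word_eq.
Proof. by move=> s; apply/asboolP; exact: word_refl. Qed.
Lemma word_eq_sym : symmetric word_eq.
Proof. by move=> s t; apply/asboolP/asboolP; exact: word_sym. Qed.
Lemma word_eq_trans : transitive word_eq.
Proof.
move=> t s u /asboolP st /asboolP tu; apply/asboolP.
exact: word_trans st tu.
Qed.

Canonical word_equiv := EquivRel word_eq word_eq_refl word_eq_sym word_eq_trans.

Definition free_product : Type := {eq_quot word_equiv}.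
HB.instance Definition _ := Choice.on free_product.

Definition fp_word (s : seq (G1 + G2)%type) : free_product :=
  \pi_{eq_quot word_equiv} s.
Definition fp_repr (u : free_product) : seq (G1 + G2)%type :=
  repr (u : {eq_quot word_equiv}).

Definition letter_inv (x : (G1 + G2)%type) : (G1 + G2)%type :=
  match x with inl a => inl a^-1 | inr b => inr b^-1 end.
Definition word_inv (s : seq (G1 + G2)%type) := rev (map letter_inv s).

Definition fp_mul (u v : free_product) : free_product :=
  fp_word (fp_repr u ++ fp_repr v).
Definition fp_inv (u : free_product) : free_product :=
  fp_word (word_inv (fp_repr u)).

Lemma fp_reprK u : fp_word (fp_repr u) = u.
Proof. exact: reprK. Qed.

Lemma fp_wordP s t : fp_word s = fp_word t <-> word_eqv s t.
Proof.
rewrite /fp_word; split; first by move/eqmodP/asboolP.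
by move=> h; apply/eqmodP/asboolP.
Qed.

Lemma fp_wordM s t : fp_mul (fp_word s) (fp_word t) = fp_word (s ++ t).
Proof. by apply/fp_wordP; apply: word_cat; apply/fp_wordP; exact: fp_reprK. Qed.

Lemma word_invV s : word_eqv (word_inv s ++ s) [::].
Proof.
elim: s => [|x s IH]; first exact: word_refl.
rewrite /word_inv /= rev_cons -cats1 -catA.
apply: word_trans IH; apply: word_cat; first exact: word_refl.
apply: (@word_trans _ ([::] ++ s)); last exact: word_refl.
rewrite -[x :: s]/([:: x] ++ s) catA; apply: word_cat; last exact: word_refl.
case: x => a /=.
- by apply: word_trans (word_Ml _ _) _; rewrite mulVg; exact: word_1l.
- by apply: word_trans (word_Mr _ _) _; rewrite mulVg; exact: word_1r.
Qed.

Lemma word_invK : involutive word_inv.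
Proof.
move=> s; rewrite /word_inv map_rev revK -map_comp -[RHS]map_id.
by apply: eq_map => -[] a /=; rewrite invgK.
Qed.

Lemma fp_mulA : associative fp_mul.
Proof.
move=> u v w; rewrite -(fp_reprK u) -(fp_reprK v) -(fp_reprK w).
by rewrite !fp_wordM catA.
Qed.
Lemma fp_mul1g : left_id (fp_word [::]) fp_mul.
Proof. by move=> u; rewrite -(fp_reprK u) fp_wordM. Qed.
Lemma fp_mulg1 : right_id (fp_word [::]) fp_mul.
Proof. by move=> u; rewrite -(fp_reprK u) fp_wordM cats0. Qed.
Lemma fp_mulVg : left_inverse (fp_word [::]) fp_inv fp_mul.
Proof.
move=> u; rewrite -{2}(fp_reprK u) /fp_inv fp_wordM.
by apply/fp_wordP; exact: word_invV.
Qed.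
Lemma fp_mulgV : right_inverse (fp_word [::]) fp_inv fp_mul.
Proof.
move=> u; rewrite -{1}(fp_reprK u) /fp_inv fp_wordM.
by apply/fp_wordP; rewrite -{1}(word_invK (fp_repr u)); exact: word_invV.
Qed.

HB.instance Definition _ := isGroup.Build free_product
  fp_mulA fp_mul1g fp_mulg1 fp_mulVg fp_mulgV.

Definition fp_inl (a : G1) : free_product := fp_word [:: inl a].
Definition fp_inr (b : G2) : free_product := fp_word [:: inr b].

End FreeProduct.

Definition amalgam (G1 G2 H : groupType) (i1 : H -> G1) (i2 : H -> G2) :
    groupType :=
  @quotient_group (free_product G1 G2)
    [set x | exists h : H, x = (fp_inl G2 (i1 h) * (fp_inr G1 (i2 h))^-1)%g].

(* The metric axioms are not part of the record: it only serves to state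
   stability uniformly, and is instantiated with [HS_class] and [P_class]. *)
Record metric_class (R : realType) := MetricClass {
  mc_obj : Type;
  mc_Aut : mc_obj -> groupType;
  mc_dist : forall X : mc_obj, mc_Aut X -> mc_Aut X -> R
}.

Definition stable (R : realType) (C : metric_class R) (G : groupType) : Prop :=
  forall (X : nat -> mc_obj C) (phi : forall n, G -> mc_Aut (X n)),
    (forall g h : G,
      mc_dist (phi n g * phi n h)%g (phi n (g * h)%g) @[n --> \oo] --> (0 : R)) ->
    exists psi : forall n, {multiplicative G -> mc_Aut (X n)},
      forall g : G, mc_dist (phi n g) (psi n g) @[n --> \oo] --> (0 : R).

Section UnitaryGroup.
Local Open Scope sesquilinear_scope.
Variables (R : realType) (n : nat).

Definition unitary_group : Type := {A : 'M[R[i]]_n.+1 | A \is unitarymx}.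
HB.instance Definition _ := Choice.on unitary_group.

Lemma unitary1 : (1%:M : 'M[R[i]]_n.+1) \is unitarymx.
Proof. by apply/unitarymxP; rewrite trmx1 map_mx1 mulmx1. Qed.

Definition ug_one : unitary_group := exist _ 1%:M unitary1.
Definition ug_mul (A B : unitary_group) : unitary_group :=
  exist _ (val A *m val B) (mul_unitarymx (valP A) (valP B)).
Definition ug_inv (A : unitary_group) : unitary_group :=
  exist _ ((val A)^t*) (etrans (trmxC_unitary (val A)) (valP A)).

Lemma ug_mulA : associative ug_mul.
Proof. by move=> A B D; apply: val_inj; rewrite /= mulmxA. Qed.
Lemma ug_mul1g : left_id ug_one ug_mul.
Proof. by move=> A; apply: val_inj; rewrite /= mul1mx. Qed.
Lemma ug_mulg1 : right_id ug_one ug_mul.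
Proof. by move=> A; apply: val_inj; rewrite /= mulmx1. Qed.
Lemma ug_mulgV : right_inverse ug_one ug_inv ug_mul.
Proof. by move=> A; apply: val_inj; exact/unitarymxP/(valP A). Qed.
Lemma ug_mulVg : left_inverse ug_one ug_inv ug_mul.
Proof. by move=> A; apply/val_inj/mulmx1C/unitarymxP/(valP A). Qed.

HB.instance Definition _ := isGroup.Build unitary_group
  ug_mulA ug_mul1g ug_mulg1 ug_mulVg ug_mulgV.

Definition normalized_trace (A : 'M[R[i]]_n.+1) : R[i] := \tr A / n.+1%:R.

(* The normalized trace of A^* A is real and nonnegative, so taking its real
   part only transports it from R[i] to R. *)
Definition hs_norm (A : 'M[R[i]]_n.+1) : R :=
  Num.sqrt (complex.Re (normalized_trace (A^t* *m A))).

Definition hs_dist (A B : unitary_group) : R := hs_norm (val A - val B).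

End UnitaryGroup.

(* Hilbert spaces of finite dimension n.+1 are taken to be C^(n.+1), so that
   Aut(X) is the group of unitary matrices; dimension 0, where the normalized
   trace is undefined, is left out. *)
Definition HS_class (R : realType) : metric_class R :=
  @MetricClass R nat (fun n => unitary_group R n) (fun n => @hs_dist R n).

Definition hamming_dist (R : realType) (X : finType) (s t : {perm X}) : R :=
  #|[set x | s x != t x]%SET|%:R / #|X|%:R.

(* The library's product on {perm X} is (s * t) x = t (s x), the opposite of
   composition; inversion is a Hamming isometry from one group onto the other,
   so stability does not depend on the convention. *)
Definition P_class (R : realType) : metric_class R :=
  @MetricClass R {X : finType | (0 < #|X|)%N} (fun X => {perm sval X})
    (fun X => @hamming_dist R (sval X)).

(* Main.v *)
Require Import Defs.
From HB Require Import structures.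
From mathcomp Require Import all_boot all_order all_algebra all_fingroup.
From mathcomp Require Import pgroup mxrepresentation spectral complex.
From mathcomp Require Import boolp classical_sets reals.
From mathcomp Require Import topology normedtype sequences.
From mathcomp Require Import ring lra zify.

(* By stability of the two factors, an almost homomorphism of the amalgam yields homomorphisms
   [psi_j] of [G_j] that nearly agree on [H].  A representation of [H] (a unitary one, or an
   action on a finite set) is determined by the multiplicities of finitely many types, irreducible
   characters or point stabilizers; since [H] is normal, [G_j] permutes the types, the multiplicity
   is constant on orbits, and the representation splits along orbits.  The multiplicities of
   [psi_1] and [psi_2] differ by [o(N)]; if they are equal, the two restrictions to [H] are
   conjugate by an element close to 1, and we are done.

   To equalize them, round the multiplicity of every nontrivial type down to a common multiple of
   a fixed [d], letting [G_j] act trivially on what is cut off.  For one orbit [O] of types, cut a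
   block of type [O] down to a size slightly below its target, [d]-divisible size: the result is
   an almost homomorphism, hence close to a homomorphism by stability of [G_j].  Its small part of
   types outside [O] is replaced by copies of a fixed representation of type [O] and size [d] and
   by one representation of type [O] and bounded size that corrects the residue modulo [d]. *)

Set Implicit Arguments.
Unset Strict Implicit.
Unset Printing Implicit Defensive.

Import Order.TTheory GRing.Theory Num.Theory.
Import numFieldNormedType.Exports.
Local Open Scope ring_scope.

(** * Homomorphisms and the abstract model *)

(** Stability returns a homomorphism of the same size but says nothing about its multiplicities, and
    these cannot be repaired freely: a representation of [H] of type [O], even with constant
    multiplicities on [O], need not extend to [G_j]. What is known of the sizes of representations
    of [G_j] of type [O] is that they form an additive semigroup. Fix [d > 0] in it. Every size [s]
    then has a partner [r] in the semigroup, bounded independently of [s], such that [d] divides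
    [s + r]. If the target is a multiple of [d], the missing size is [r] plus a multiple of [d],
    hence is realized. Room for [r] is the reason for cutting slightly below the target. One modulus
    must serve all orbits and both groups, whence products. The trivial type is never prescribed: it
    absorbs what is cut off, and its multiplicity follows from the total size. Finite generation
    reduces closeness on a factor to finitely many elements, which a single [delta] can control. *)

Definition is_hom (G K : groupType) (f : G -> K) := {morph f : x y / (x * y)%g}.

Section Hom.
Variables (G K : groupType) (f : G -> K) (fM : is_hom f).
Local Open Scope group_scope.

Lemma hom1 : f 1 = 1.
Proof. by apply: (mulIg (f 1)); rewrite -fM !mul1g. Qed.

Lemma homV x : f x^-1 = (f x)^-1.
Proof. by apply: (mulIg (f x)); rewrite -fM !mulVg hom1. Qed.

Lemma homJ x y : f (x ^ y) = f x ^ f y.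
Proof. by rewrite !conjgE !fM homV. Qed.

End Hom.

Lemma hom_comp (G K L : groupType) (f : G -> K) (g : K -> L) :
  is_hom f -> is_hom g -> is_hom (fun x => g (f x)).
Proof. by move=> fM gM x y /=; rewrite fM gM. Qed.

Lemma hom_const1 (G K : groupType) : is_hom (fun _ : G => 1%g : K).
Proof. by move=> x y; rewrite mulg1. Qed.

Lemma hom_conj (G K : groupType) (f : G -> K) w :
  is_hom f -> is_hom (fun x => f x ^ w)%g.
Proof. by move=> fM x y /=; rewrite fM conjMg. Qed.

Section NormalEmbedding.
Variables (H : finGroupType) (G : groupType) (i : H -> G).

Definition conj_by (g : G) (a : H -> H) := forall h, i (a h) = (i h ^ g)%g.

(** Normality is encoded by the bare map [a]; the two lemmas below show that it is an injective
    endomorphism of [H]. *)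
Definition normal_embedding :=
  [/\ is_hom i, injective i & forall g, exists a, conj_by g a].

Hypothesis iN : normal_embedding.

Lemma conj_by_hom g a : conj_by g a -> is_hom a.
Proof.
case: iN => iM iI _ ga x y; apply: iI.
by rewrite iM !ga iM conjMg.
Qed.

Lemma conj_by_inj g a : conj_by g a -> injective a.
Proof.
case: iN => iM iI _ ga x y axy; apply/iI/(@conjg_inj _ g).
by rewrite -!ga axy.
Qed.

End NormalEmbedding.

(* A common abstraction of the unitary groups [U(n)] with the squared Frobenius
   distance and of the symmetric groups [Sym(n)] with the Hamming distance,
   neither of them normalized; the square costs the factor 2 in [D_tri].  [cnt r T] is
   the dimension of the [T]-isotypic part of [r : H -> U n], resp. the number of points
   with stabilizer [T]. *)
Record rep_model (R : realType) (H : finGroupType) := RepModel {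
  U :> nat -> groupType;
  D : forall n, U n -> U n -> R;
  bsum : forall m n, U m -> U n -> U (m + n)%N;
  Kb : R;
  Kb_gt0 : 0 < Kb;
  D_ge0 : forall n (A B : U n), 0 <= D A B;
  D_id : forall n (A : U n), D A A = 0;
  D_sym : forall n (A B : U n), D A B = D B A;
  D_tri : forall n (B A C : U n), D A C <= 2 * (D A B + D B C);
  D_mull : forall n (A B C : U n), D (C * A)%g (C * B)%g = D A B;
  D_mulr : forall n (A B C : U n), D (A * C)%g (B * C)%g = D A B;
  D_le : forall n (A B : U n), D A B <= Kb * n%:R;
  bsumM : forall m n (A A' : U m) (B B' : U n),
    bsum (A * A')%g (B * B')%g = (bsum A B * bsum A' B')%g;
  D_bsum : forall m n (A A' : U m) (B B' : U n),
    D (bsum A B) (bsum A' B') = D A A' + D B B';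
  trim : forall k m (A : U (k + m)%N),
    exists A' : U m, D A (bsum 1%g A') <= Kb * k%:R;
  htype : finType;
  cnt : forall n, (H -> U n) -> htype -> nat;
  cnt_sum : forall n (r : H -> U n), is_hom r -> (\sum_T cnt r T = n)%N;
  cnt_bsum : forall m n (r : H -> U m) (r' : H -> U n), is_hom r -> is_hom r' ->
    forall T, cnt (fun h => bsum (r h) (r' h)) T = (cnt r T + cnt r' T)%N;
  cnt_conj : forall n (r : H -> U n) w, is_hom r ->
    forall T, cnt (fun h => r h ^ w)%g T = cnt r T;
  twist : (H -> H) -> htype -> htype;
  cnt_twist : forall n (r : H -> U n) a, is_hom r -> is_hom a -> injective a ->
    forall T, cnt (fun h => r (a h)) T = cnt r (twist a T);
  cnt_cont : forall eps : R, 0 < eps -> exists2 delta : R, 0 < delta &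
    forall n (r r' : H -> U n), is_hom r -> is_hom r' ->
      (forall h, D (r h) (r' h) <= delta * n%:R) ->
    forall T, (cnt r T)%:R <= (cnt r' T)%:R + eps * n%:R :> R;
  near_conj : forall eps : R, 0 < eps -> exists2 delta : R, 0 < delta &
    forall n (r r' : H -> U n), is_hom r -> is_hom r' ->
      (forall h, D (r h) (r' h) <= delta * n%:R) ->
      (forall T, cnt r T = cnt r' T) ->
    exists2 w : U n, (forall h, r' h = r h ^ w)%g & D w 1%g <= eps * n%:R;
  split_rep : forall (G : groupType) (i : H -> G) (O : {set htype}) n (psi : G -> U n),
    normal_embedding i -> is_hom psi ->
    (forall g a T, conj_by i g a -> T \in O -> twist a T \in O) ->
    exists a b (e : (a + b)%N = n) (w : U n) (psia : G -> U a) (psib : G -> U b),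
      [/\ is_hom psia, is_hom psib,
          forall g, psi g = (ecast n (U n) e (bsum (psia g) (psib g)) ^ w)%g,
          forall T, T \notin O -> cnt (fun h => psia (i h)) T = 0 &
          forall T, T \in O -> cnt (fun h => psib (i h)) T = 0]
}.
Arguments D_tri {R H r n} : rename.
Arguments cnt {R H r n} : rename.

(** * Choice of small constants; residues in additive semigroups *)

Section Generalities.

(** Gathers the linear smallness conditions of an estimate, so that [delta] is chosen once for all
    of them. *)
Lemma small_delta (R : realType) (s : seq (R * R)) : all (fun x => 0 < x.2) s ->
  exists2 d, 0 < d & all (fun x => x.1 * d <= x.2) s.
Proof.
elim: s => [_|[a b] s IHs /= /andP[b0 sP]]; first by exists 1.
have [d d0 dP] := IHs sP.
have a1 : 0 < `|a| + 1 by rewrite ltr_wpDl.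
exists (Num.min d (b / (`|a| + 1))); first by rewrite lt_min d0 divr_gt0.
set e := Num.min _ _; have e0 : 0 < e by rewrite lt_min d0 divr_gt0.
apply/andP; split.
  have: e <= b / (`|a| + 1) by rewrite ge_min lexx orbT.
  rewrite ler_pdivlMr // => h; apply: le_trans h; rewrite mulrC ler_pM2l //.
  by apply: le_trans (ler_norm _) _; rewrite lerDl.
have ed : e <= d by rewrite ge_min lexx.
apply/allP => x xs; have [x0|x0] := leP 0 x.1.
  exact: le_trans (ler_wpM2l x0 ed) (allP dP _ xs).
apply/ltW/(lt_le_trans _ (ltW (allP sP x xs))).
by rewrite nmulr_rlt0.
Qed.

Lemma fin_delta (R : realType) (I : finType) (P : I -> R -> Prop) :
  (forall i d d', 0 < d' -> d' <= d -> P i d -> P i d') ->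
  (forall i, exists2 d, 0 < d & P i d) ->
  exists2 d, 0 < d & forall i, P i d.
Proof.
move=> Pmon Pex.
suff [d d0 dP] : exists2 d, 0 < d & forall i, i \in enum I -> P i d.
  by exists d => // i; apply: dP; rewrite mem_enum.
elim: (enum I) => [|i s [d d0 dP]]; first by exists 1.
have [d' d'0 d'P] := Pex i; exists (Num.min d d'); first by rewrite lt_min d0.
have m0 : 0 < Num.min d d' by rewrite lt_min d0.
move=> j; rewrite in_cons => /predU1P[->|js].
  by apply: Pmon d'P; rewrite // ge_min lexx orbT.
by apply: Pmon (dP _ js); rewrite // ge_min lexx.
Qed.

(* In a residue class mod [d] met by [S], all elements have a common inverse
   [(d - 1) s], and [d] such inverses suffice. *)
Lemma semigroup_residue (S : nat -> Prop) d : (0 < d)%N -> S 0%N ->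
  (forall a b, S a -> S b -> S (a + b)%N) ->
  exists C, forall s, S s -> exists r, [/\ S r, (r <= C)%N & (d %| s + r)%N].
Proof.
move=> d0 S0 SD.
have SM a n : S a -> S (n * a)%N.
  by move=> Sa; elim: n => // n IHn; rewrite mulSn; apply: SD.
pose P j r := forall s, S s -> (s = j %[mod d])%N -> S r /\ (d %| s + r)%N.
have [f fP] : exists f : nat -> nat, forall j, P j (f j).
  suff/choice [f fP] : forall j, exists r, P j r by exists f.
  move=> j; have [[s [Ss sj]]|no] := pselect (exists s, S s /\ (s = j %[mod d])%N).
    exists (d.-1 * s)%N => s' Ss' s'j; split; first exact: SM.
    rewrite /dvdn -modnDml s'j -sj modnDml -mulSn prednK //.
    by rewrite modnMr.
  by exists 0%N => s Ss sj; case: no; exists s.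
exists (\max_(j < d) f j) => s Ss; exists (f (s %% d)%N).
have [//|Sf df] := fP (s %% d)%N s Ss; first by rewrite modn_mod.
split=> //; exact: (@leq_bigmax _ (fun j : 'I_d => f j) (Ordinal (ltn_pmod s d0))).
Qed.

End Generalities.

(** * Uniform stability, the trivial type, and orbits of types in the model *)

Section Model.
Variables (R : realType) (H : finGroupType) (M : rep_model R H).
Local Notation U := (U M).
Local Notation Kb := (Kb M).
Local Notation htype := (htype M).
Local Notation p := #|htype|.

Lemma bsum11 m n : bsum (1%g : U m) (1%g : U n) = 1%g.
Proof.
by apply: (@mulgI _ (bsum (1%g : U m) (1%g : U n))); rewrite -bsumM !mulg1.
Qed.

Lemma hom_bsum (G : groupType) m n (r : G -> U m) (r' : G -> U n) :
  is_hom r -> is_hom r' -> is_hom (fun g => bsum (r g) (r' g)).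
Proof. by move=> rM r'M x y; rewrite rM r'M bsumM. Qed.

Lemma D_mul2 n (A A' B B' : U n) : D (A * B)%g (A' * B')%g <= 2 * (D A A' + D B B').
Proof. by apply: le_trans (D_tri (A' * B)%g _ _) _; rewrite D_mulr D_mull. Qed.

Lemma D_conj n (A B w : U n) : D (A ^ w)%g (B ^ w)%g = D A B.
Proof. by rewrite !conjgE D_mull D_mulr. Qed.

Lemma D_conjr n (A w : U n) : D A (A ^ w)%g <= 4 * D w 1%g.
Proof.
rewrite -(@D_mull _ _ _ _ _ _ w) conjgE mulVKg.
apply: le_trans (D_tri (1 * A)%g _ _) _; rewrite D_mulr mul1g.
have -> : D A (A * w)%g = D w 1%g by rewrite -{1}(mulg1 A) D_mull D_sym.
lra.
Qed.

(** Stability for the unnormalized distance: the bound [eps * N k] replaces division by the size.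
    Size 0, absent from the classes of the statement, is excluded. *)
Definition stableU (G : groupType) := forall (N : nat -> nat) (phi : forall k, G -> U (N k)),
  (forall k, (0 < N k)%N) ->
  (forall g h eps, 0 < eps -> exists K, forall k, (K <= k)%N ->
    D (phi k g * phi k h)%g (phi k (g * h)%g) <= eps * (N k)%:R) ->
  exists2 psi : forall k, G -> U (N k), forall k, is_hom (psi k) &
    forall g eps, 0 < eps -> exists K, forall k, (K <= k)%N ->
    D (phi k g) (psi k g) <= eps * (N k)%:R.

Lemma eventually_seq (G : eqType) (s : seq G) (P : G -> nat -> Prop) :
  (forall g, exists K, forall k, (K <= k)%N -> P g k) ->
  exists K, forall k, (K <= k)%N -> forall g, g \in s -> P g k.
Proof.
move=> sP; elim: s => [|g s [K KP]]; first by exists 0%N.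
have [K' K'P] := sP g; exists (maxn K K') => k; rewrite geq_max => /andP[Kk K'k] h.
by rewrite in_cons => /predU1P[->|hs]; [exact: K'P | exact: KP].
Qed.

(** Counterexamples for [delta = 1/(k+1)] would together form a sequence contradicting stability.
    One [delta] serves all sizes, at the price of controlling only a finite list. *)
Lemma stableU_uniform (G : groupType) (s : seq G) eps : stableU G -> 0 < eps ->
  exists2 delta : R, 0 < delta & forall n (phi : G -> U n), (0 < n)%N ->
    (forall g h, D (phi g * phi h)%g (phi (g * h)%g) <= delta * n%:R) ->
  exists2 psi : G -> U n, is_hom psi &
    forall g, g \in s -> D (phi g) (psi g) <= eps * n%:R.
Proof.
move=> stG eps0; apply: contrapT => no.
pose bad (delta : R) (x : {n & G -> U n}) := [/\ (0 < tag x)%N,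
  (forall g h, D (tagged x g * tagged x h)%g (tagged x (g * h)%g) <= delta * (tag x)%:R) &
  ~ exists2 psi : G -> U (tag x), is_hom psi &
    forall g, g \in s -> D (tagged x g) (psi g) <= eps * (tag x)%:R].
have /choice[x xP] : forall k : nat, exists x, bad (k.+1%:R^-1) x.
  move=> k; apply: contrapT => nox; apply: no.
  exists k.+1%:R^-1; [by rewrite invr_gt0 ltr0n|move=> n phi n0 phiM].
  by apply: contrapT => nopsi; apply: nox; exists (existT _ n phi).
have [||psi psiM psiP] := @stG (fun k => tag (x k)) (fun k => tagged (x k)).
- by move=> k; case: (xP k).
- move=> g h e e0; exists (Num.truncn e^-1) => k Kk.
  have [n0 xM _] := xP k; apply: le_trans (xM g h) _.
  rewrite ler_pM2r ?ltr0n// invf_ple ?posrE ?ltr0n//.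
  by apply: ltW; rewrite (lt_le_trans (truncnS_gt _)) ?ler_nat.
have [K KP] := eventually_seq s (fun g => psiP g eps eps0).
have [_ _ []] := xP K; exists (psi K) => // g gs; exact: KP gs.
Qed.

Definition triv n : H -> U n := fun _ => 1%g.
Arguments triv : clear implicits.

Lemma trivM n : is_hom (triv n). Proof. exact: hom_const1. Qed.

(** The model does not name the trivial type. In size 1 the multiplicities sum to 1, which singles
    out one type; additivity carries it to every size. *)
Lemma triv_type : exists T0, forall n, cnt (triv n) T0 = n.
Proof.
have [T0 T01] : exists T0, cnt (triv 1) T0 = 1%N.
  apply: contrapT => no; have /eqP := cnt_sum (trivM 1).
  have [[T T1]|T1] := pselect (exists T, (1 < cnt (triv 1) T)%N); last first.
    rewrite big1 // => T _.
    have T1T : ~ (1 < cnt (triv 1) T)%N by move=> h; apply: T1; exists T.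
    have : cnt (triv 1) T <> 1%N by move=> h; apply: no; exists T.
    move: T1T.
    by case: (cnt _ T) => [|[|k]] // _ [].
  by rewrite (bigD1 T) //= => /eqP; lia.
exists T0; elim=> [|n IHn].
  by have /eqP := cnt_sum (trivM 0); rewrite (bigD1 T0) //= addn_eq0 => /andP[/eqP].
transitivity (cnt (fun h => bsum (triv 1 h) (triv n h)) T0).
  by congr cnt; apply/funext => h; rewrite /triv bsum11.
by rewrite cnt_bsum ?T01 ?IHn //; exact: trivM.
Qed.

Definition T0 := projT1 (cid triv_type).

Lemma cnt_triv n T : cnt (triv n) T = (n * (T == T0))%N.
Proof.
have T0n : cnt (triv n) T0 = n := projT2 (cid triv_type) n.
have [->|TT0] := eqVneq T T0; first by rewrite T0n muln1.
rewrite muln0; have /eqP := cnt_sum (trivM n).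
rewrite (bigD1 T0) //= T0n => /eqP; rewrite -[RHS]addn0 => /addnI/eqP.
by rewrite sum_nat_eq0 => /forallP/(_ T)/implyP/(_ TT0)/eqP.
Qed.

Lemma cnt_ecast n m (e : n = m) (G : Type) (f : H -> G) (r : G -> U n) T :
  cnt (fun h => ecast k (U k) e (r (f h))) T = cnt (fun h => r (f h)) T.
Proof. by case: m / e. Qed.

Section Group.
Variables (G : groupType) (i : H -> G).
Hypotheses (iN : normal_embedding i).
Let iM : is_hom i. Proof. by case: iN. Qed.

(** Symmetrized by hand, since the model has no law for inverting [twist]. The orbits are the
    connected components. *)
Definition rel_type (T T' : htype) : bool :=
  `[< exists g a, conj_by i g a /\ (T' = twist a T \/ T = twist a T') >].

Lemma rel_type_sym : symmetric rel_type.
Proof.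
by move=> T T'; apply/asboolP/asboolP => -[g [a [ga]]] => /or_comm ?; exists g, a.
Qed.

(** Twisting the restriction to [H] by conjugation with [g] amounts to conjugating it by [psi g],
    which preserves multiplicities. *)
Lemma cnt_rel n (psi : G -> U n) T T' : is_hom psi -> rel_type T T' ->
  cnt (fun h => psi (i h)) T = cnt (fun h => psi (i h)) T'.
Proof.
move=> psiM /asboolP[g [a [ga TT']]]; have riM := hom_comp iM psiM.
have cntg S : cnt (fun h => psi (i h)) S = cnt (fun h => psi (i h)) (twist a S).
  rewrite -(cnt_twist riM (conj_by_hom iN ga) (conj_by_inj iN ga)).
  rewrite -(cnt_conj (psi g) riM); congr cnt; apply/funext => h.
  by rewrite ga homJ.
by case: TT' => ->; rewrite -cntg.
Qed.

Lemma cnt_connect n (psi : G -> U n) T T' : is_hom psi -> connect rel_type T T' ->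
  cnt (fun h => psi (i h)) T = cnt (fun h => psi (i h)) T'.
Proof.
move=> psiM /connectP[s]; elim: s T => [|S s IHs] T /=; first by move=> _ ->.
by move=> /andP[/(cnt_rel psiM) -> /IHs]; exact.
Qed.

Lemma split_closed (O : {set htype}) n (psi : G -> U n) :
  is_hom psi -> fingraph.closed rel_type (mem O) ->
  exists a b (e : (a + b)%N = n) (w : U n) (psia : G -> U a) (psib : G -> U b),
    [/\ is_hom psia, is_hom psib,
        forall g, psi g = (ecast n (U n) e (bsum (psia g) (psib g)) ^ w)%g,
        forall T, cnt (fun h => psia (i h)) T =
          if T \in O then cnt (fun h => psi (i h)) T else 0%N &
        forall T, cnt (fun h => psib (i h)) T =
          if T \in O then 0%N else cnt (fun h => psi (i h)) T].
Proof.
move=> psiM Ocl.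
have Otw g a T : conj_by i g a -> T \in O -> twist a T \in O.
  move=> ga TO; rewrite -[_ \in _](Ocl T) //; apply/asboolP.
  by exists g, a; split; [|left].
have [a [b [e [w [psia [psib [psiaM psibM psiE a0 b0]]]]]]] := split_rep iN psiM Otw.
exists a, b, e, w, psia, psib.
have cntE T : cnt (fun h => psi (i h)) T =
    (cnt (fun h => psia (i h)) T + cnt (fun h => psib (i h)) T)%N.
  rewrite -cnt_bsum; try exact: hom_comp.
  have sM : is_hom (fun h => ecast n (U n) e (bsum (psia (i h)) (psib (i h)))).
    by case: n / e {w psi psiM psiE} => x y; rewrite iM psiaM psibM bsumM.
  rewrite -(cnt_ecast e i (fun g => bsum (psia g) (psib g))) -(cnt_conj w sM).
  by congr cnt; apply/funext => h; rewrite psiE.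
split=> // T; case: ifPn => TO.
- by rewrite cntE (b0 _ TO) addn0.
- exact: a0.
- exact: b0.
- by rewrite cntE (a0 _ TO).
Qed.

End Group.
End Model.

(** * Prescribing the multiplicity of one orbit of types *)

Section OneOrbit.
Variables (R : realType) (H : finGroupType) (M : rep_model R H).
Local Notation U := (U M).
Local Notation Kb := (Kb M).
Local Notation htype := (htype M).
Local Notation p := #|htype|.
Local Notation T0 := (T0 M).
Variables (G : groupType) (i : H -> G) (O : {set htype}).
Hypotheses (iN : normal_embedding i).
Hypotheses (Ocl : fingraph.closed (@rel_type _ _ M _ i) (mem O)) (T0O : T0 \notin O).
Let iM : is_hom i. Proof. by case: iN. Qed.
Local Notation ci psi T := (cnt (fun h => psi (i h)) T).

Definition mass n (psi : G -> U n) := (\sum_(T in O) ci psi T)%N.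

Definition only n (psi : G -> U n) := is_hom psi /\ forall T, T \notin O -> ci psi T = 0%N.

Lemma mass_compl n (psi : G -> U n) : is_hom psi ->
  (mass psi + \sum_(T | T \notin O) ci psi T = n)%N.
Proof.
move=> psiM; rewrite -[RHS](cnt_sum (hom_comp iM psiM)).
by rewrite [RHS](bigID (mem O)).
Qed.

Lemma mass_only n (psi : G -> U n) : only psi -> mass psi = n.
Proof.
by case=> psiM psiO; rewrite -[RHS](mass_compl psiM) [X in (_ + X)%N]big1 ?addn0.
Qed.

Lemma mass_bsum m n (psi : G -> U m) (psi' : G -> U n) : is_hom psi -> is_hom psi' ->
  mass (fun g => bsum (psi g) (psi' g)) = (mass psi + mass psi')%N.
Proof.
move=> psiM psi'M; rewrite /mass -big_split; apply: eq_bigr => T _.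
by rewrite cnt_bsum //; exact: hom_comp.
Qed.

Lemma mass_triv n : mass (fun _ : G => 1%g : U n) = 0%N.
Proof.
rewrite /mass big1 // => T TO; rewrite (cnt_triv n T).
by rewrite (negPf (memPn T0O _ TO)) muln0.
Qed.

(** The additive semigroup to which [semigroup_residue] is applied. *)
Definition occurs n := exists psi : G -> U n, only psi.

Lemma occurs0 : occurs 0.
Proof.
exists (fun=> 1%g); split; first exact: hom_const1.
by move=> T _; rewrite (cnt_triv 0 T).
Qed.

Lemma occursD m n : occurs m -> occurs n -> occurs (m + n).
Proof.
move=> [psi [psiM psiO]] [psi' [psi'M psi'O]].
exists (fun g => bsum (psi g) (psi' g)); split; first exact: hom_bsum.
by move=> T TO; rewrite cnt_bsum ?psiO ?psi'O //; exact: hom_comp.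
Qed.

Lemma occursM k n : occurs n -> occurs (k * n).
Proof.
by move=> n_occ; elim: k => [|k IHk]; [exact: occurs0 | rewrite mulSn; exact: occursD].
Qed.

(** The part of [psi] of type [O] splits off as a representation of [G]. *)
Lemma occurs_mass n (psi : G -> U n) : is_hom psi -> occurs (mass psi).
Proof.
move=> psiM; have [a [b [_ [_ [psia [_ [psiaM _ _ psiaE _]]]]]]] := split_closed iN psiM Ocl.
have psiaO : only psia by split=> // T TO; rewrite psiaE (negPf TO).
suff -> : mass psi = a by exists psia.
by rewrite -(mass_only psiaO); apply: eq_bigr => T TO; rewrite psiaE TO.
Qed.

Lemma occurs_pad f n : occurs f -> (f <= n)%N -> exists psi : G -> U n,
  [/\ is_hom psi, forall T, T \notin O -> T != T0 -> ci psi T = 0%N & mass psi = f].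
Proof.
move=> [psi [psiM psiO]] /subnKC <-; exists (fun g => bsum (psi g) 1%g).
have tM := @hom_const1 G (U (n - f)%N); split; first exact: hom_bsum.
  move=> T TO TT0; rewrite cnt_bsum; [|exact: hom_comp|exact: hom_const1].
  by rewrite psiO // (cnt_triv _ T) (negPf TT0) muln0.
by rewrite mass_bsum // mass_triv mass_only ?addn0.
Qed.

(** Keep the [O]-part and exchange its complement for a representation of type [O] of the missing
    size, padded trivially. The cost is proportional to the size of the complement. *)
Lemma replace_part n (psi : G -> U n) m : is_hom psi ->
  (mass psi <= m <= n)%N -> occurs (m - mass psi) ->
  exists psi' : G -> U n,
  [/\ is_hom psi', forall T, T \notin O -> T != T0 -> ci psi' T = 0%N, mass psi' = m &
      forall g, D (psi g) (psi' g) <= Kb * (\sum_(T | T \notin O) ci psi T)%N%:R].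
Proof.
move=> psiM; have [a [b [e [w [psia [psib [psiaM psibM psiE psiaE psibE]]]]]]] :=
  split_closed iN psiM Ocl.
have psiaO : only psia by split=> // T TO; rewrite psiaE (negPf TO).
have -> : mass psi = a.
  by rewrite -(mass_only psiaO); apply: eq_bigr => T TO; rewrite psiaE TO.
have -> : (\sum_(T | T \notin O) ci psi T)%N = b.
  rewrite -(cnt_sum (hom_comp iM psibM)) [RHS](bigID (mem O)) /=.
  rewrite [X in (X + _)%N]big1 ?add0n; last by move=> T TO; rewrite psibE TO.
  by apply: eq_bigr => T TO; rewrite psibE (negPf TO).
subst n; move=> /andP[am mab] fO.
have [|tau [tauM tau0 taut]] := occurs_pad (n := b) fO; first by rewrite leq_subLR.
have sM : is_hom (fun g => bsum (psia g) (tau g)) by exact: hom_bsum.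
have cE T : ci (fun g => bsum (psia g) (tau g) ^ w)%g T = (ci psia T + ci tau T)%N.
  rewrite (cnt_conj w (hom_comp iM sM)) cnt_bsum //; exact: hom_comp.
exists (fun g => bsum (psia g) (tau g) ^ w)%g; split; first exact: hom_conj.
- by move=> T TO TT0; rewrite cE tau0 // (psiaO.2 _ TO).
- rewrite /mass (eq_bigr _ (fun T _ => cE T)) big_split.
  rewrite [LHS](_ : _ = mass psia + mass tau)%N //.
  by rewrite taut mass_only // subnKC.
- by move=> g; rewrite psiE /= D_conj D_bsum D_id add0r; exact: D_le.
Qed.

Hypothesis stG : stableU M G.
Variable s : seq G.

Lemma reduce_type : exists2 d, (0 < d)%N & forall eps : R, 0 < eps ->
  exists2 delta : R, 0 < delta & forall n N (psi : G -> U n) m,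
    only psi -> (n <= N)%N -> (d %| m)%N -> (m <= n)%N -> (n - m)%N%:R <= delta * N%:R ->
  exists psi' : G -> U n,
  [/\ is_hom psi', forall T, T \notin O -> T != T0 -> ci psi' T = 0%N, mass psi' = m &
      forall g, g \in s -> D (psi g) (psi' g) <= eps * N%:R].
Proof.
have nm n N (psi : G -> U n) (e : R) : only psi -> 0 < e -> exists psi' : G -> U n,
  [/\ is_hom psi', forall T, T \notin O -> T != T0 -> ci psi' T = 0%N, mass psi' = n &
      forall g, g \in s -> D (psi g) (psi' g) <= e * N%:R].
  move=> psiO e0; exists psi; split; [by case: psiO|by move=> T TO _; exact: psiO.2| |].
    exact: mass_only.
  by move=> g _; rewrite D_id mulr_ge0 ?ler0n ?ltW.
(* If no positive size occurs, a block of type [O] is empty and there is nothing to reduce, so any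
   [d] will do. *)
have [[d [d0 dO]]|nod] := pselect (exists d, (0 < d)%N /\ occurs d); last first.
  exists 1%N => // eps eps0; exists 1 => // n N psi m psiO _ _ mn _.
  have [n0|n0] := posnP n; last by case: nod; exists n; split; [|exists psi].
  have -> : m = n by apply/eqP; rewrite eqn_leq mn n0.
  exact: nm.
exists d => // eps eps0.
have [C CP] := semigroup_residue d0 occurs0 occursD.
have K0 := Kb_gt0 M; have p0 : 0 <= p%:R :> R by rewrite ler0n.
have C0 : 0 <= C%:R :> R by rewrite ler0n.
pose e1 : R := eps / (4 * Kb); have e10 : 0 < e1 by rewrite divr_gt0 // mulr_gt0.
have e1E : Kb * e1 = eps / 4 by rewrite /e1; field; rewrite gt_eqF.
pose ec : R := eps / (8 * Kb * (p%:R + 1)).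
have ec0 : 0 < ec by rewrite divr_gt0 // !mulr_gt0 // ltr_wpDl.
have ecE : 2 * (Kb * (p%:R * ec)) <= eps / 4.
  have -> : eps / 4 = 2 * (Kb * ((p%:R + 1) * ec)).
    by rewrite /ec; field; rewrite !gt_eqF // ltr_wpDl.
  by rewrite ler_pM2l // ler_pM2l // ler_pM2r // lerDl.
have [dc dc0 dcP] := cnt_cont M ec0.
pose es : R := Num.min (eps / 16) (dc / 4).
have es0 : 0 < es by rewrite lt_min !divr_gt0.
have es1 : es <= eps / 16 by rewrite ge_min lexx.
have es2 : es <= dc / 4 by rewrite ge_min lexx orbT.
have [ds ds0 dsP] := stableU_uniform (s ++ [seq i h | h <- enum H]) stG es0.
clearbody e1 ec es.
have [|delta delta0 /= /and5P[del1 del2 del3 del4 /andP[del5 _]]] := @small_delta R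
  [:: (4 * Kb * (1 + C%:R), eps / 4); (2 * Kb * (1 + C%:R), dc * e1 / 2);
      (Kb, eps / 4); (C%:R, e1 / 2); (10 * Kb * (1 + C%:R), ds * e1 / 2)].
  by rewrite /= !andbT !divr_gt0 ?mulr_gt0.
exists delta => // n N psi m psiO nN dm mn mdelta.
have [mE|mE] := eqVneq m n; first by rewrite mE; exact: nm.
have {}mn : (m < n)%N by rewrite ltn_neqAle mE.
pose X : R := delta * N%:R.
(* As [m < n], [X] is at least 1, so that the constant [C] is absorbed into [C * X]. *)
have X1 : 1 <= X by apply: le_trans mdelta; rewrite ler1n subn_gt0.
have N0 : 0 <= N%:R :> R by rewrite ler0n.
(* Below [e1 * N] the whole block is so small that it can be replaced cheaply. Otherwise [m]
   dominates [C], and errors small relative to [N] are small relative to [m]. *)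
have [mN|mN] := ltP (m%:R : R) (e1 * N%:R).
  have [|psi' [psi'M psi'0 psi't]] := occurs_pad (n := n) (f := m) _ (ltnW mn).
    by rewrite -(divnK dm); exact: occursM.
  exists psi'; split=> // g _; apply: le_trans (D_le _ _) _.
  rewrite -(subnKC (ltnW mn)) natrD.
  apply: (@le_trans _ _ (Kb * (e1 * N%:R + delta * N%:R))).
    by rewrite ler_pM2l // lerD // ltW.
  rewrite -mulrDl mulrA ler_wpM2r // mulrDr; lra.
have psiM : is_hom psi by case: psiO.
have CX : C%:R <= m%:R / 2 :> R.
  have := ler_wpM2r N0 del4; rewrite -mulrA -/X => h.
  have : C%:R * 1 <= C%:R * X by rewrite ler_wpM2l.
  lra.
have Nn : N%:R > 0 :> R by rewrite ltr0n; apply: leq_trans nN; case: (n) mn.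
have m0 : m%:R > 0 :> R by apply: lt_le_trans mN; rewrite mulr_gt0.
have Cm : (C <= m)%N by rewrite -(ler_nat R); lra.
(* The extra cut by [C] leaves room between [mass Psi] and [m] for a correction of size at most
   [C]. *)
pose k := (n - m + C)%N; pose m' := (m - C)%N.
have nE : n = (k + m')%N by rewrite /k /m' -addnA subnKC // subnK // ltnW.
have m'E : m'%:R = m%:R - C%:R :> R by rewrite /m' natrB.
have kX : k%:R <= (1 + C%:R) * X.
  rewrite /k natrD mulrDl mul1r lerD // -[leLHS]mulr1; exact: ler_wpM2l.
clearbody k m'; subst n.
have /choice[phi phiP] : forall g, exists B : U m', D (psi g) (bsum 1%g B) <= Kb * k%:R.
  by move=> g; exact: trim.
have [||psi' psi'M psi'P] := dsP m' phi.
- by rewrite -(ltr0n R) m'E; lra.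
(* Each trimming costs [Kb * k], and the doubled triangle inequality at two levels gives 2 * (2 * (1
   + 1) + 1) = 10. *)
- move=> g h; apply: (@le_trans _ _ (10 * (Kb * k%:R))).
    have -> : D (phi g * phi h)%g (phi (g * h)%g) =
      D (bsum (1%g : U k) (phi g) * bsum (1%g : U k) (phi h))%g (bsum 1%g (phi (g * h)%g)).
      by rewrite -bsumM D_bsum mulg1 D_id add0r.
    apply: le_trans (D_tri (psi g * psi h)%g _ _) _.
    have := D_mul2 (bsum 1%g (phi g)) (psi g) (bsum 1%g (phi h)) (psi h).
    have := phiP g; have := phiP h; have := phiP (g * h)%g.
    rewrite (D_sym _ (psi g)) (D_sym _ (psi h)) psiM; lra.
  apply: (@le_trans _ _ (ds * (e1 * N%:R) / 2)); last first.
    by rewrite -mulrA ler_pM2l // m'E; lra.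
  have h1 : Kb * k%:R <= Kb * ((1 + C%:R) * X) by rewrite ler_pM2l.
  by have := ler_wpM2r N0 del5; rewrite /X in h1; lra.
pose Psi g := bsum (1%g : U k) (psi' g).
have PsiM : is_hom Psi by apply: hom_bsum => //; exact: hom_const1.
have psiPsi g : g \in s ++ [seq i h | h <- enum H] ->
    D (psi g) (Psi g) <= 2 * (Kb * ((1 + C%:R) * X)) + 2 * (es * m'%:R).
  move=> gs; apply: le_trans (D_tri (bsum 1%g (phi g)) _ _) _.
  rewrite D_bsum D_id add0r mulrDr lerD ?ler_pM2l //; last exact: psi'P.
  by apply: le_trans (phiP g) _; rewrite ler_pM2l.
have X2 : 4 * (Kb * ((1 + C%:R) * X)) <= eps / 4 * N%:R.
  by have := ler_wpM2r N0 del1; rewrite /X; lra.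
have X3 : 2 * (Kb * ((1 + C%:R) * X)) <= dc * (e1 * N%:R) / 2.
  by have := ler_wpM2r N0 del2; rewrite /X; lra.
have m'n : m'%:R <= (k + m')%:R :> R by rewrite ler_nat leq_addl.
have mlen : m%:R <= (k + m')%:R :> R by rewrite ler_nat ltnW.
have nleN : (k + m')%:R <= N%:R :> R by rewrite ler_nat.
(* These multiplicities vanish for [psi], and [Psi] is close to [psi], so they are small by
   continuity. The [k] added trivial copies are included. *)
have Psi0 T : T \notin O -> (ci Psi T)%:R <= ec * N%:R :> R.
  move=> TO; apply: le_trans (dcP _ _ (fun h => psi (i h)) _ _ _ T) _.
  - exact: hom_comp.
  - exact: hom_comp.
  - move=> h; rewrite D_sym; apply: le_trans (psiPsi _ _) _.
      by rewrite mem_cat map_f ?orbT // mem_enum.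
    have : dc * (e1 * N%:R) <= dc * (k + m')%:R by rewrite ler_pM2l //; exact: le_trans mlen.
    have : es * m'%:R <= dc / 4 * (k + m')%:R by apply: ler_pM => //; exact: ltW.
    lra.
  - by rewrite psiO.2 // add0r ler_pM2l.
have Psit : (mass Psi <= m')%N.
  rewrite mass_bsum //; last exact: hom_const1.
  by rewrite mass_triv add0n -[leqRHS](mass_compl psi'M) leq_addr.
have [r [rO rC dr]] := CP _ (occurs_mass PsiM).
have m'C : (m' + C = m)%N.
  by apply/eqP; rewrite -(eqr_nat R) natrD m'E subrK.
have tm : (mass Psi + r <= m)%N by rewrite -m'C leq_add.
have [||psi'' [psi''M psi''0 psi''t psi''P]] := @replace_part _ Psi m PsiM.
- by rewrite (leq_trans (leq_addr r _) tm) ltnW.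
(* The missing size is [r] plus a multiple of [d]; both occur. *)
- have /divnK dE : (d %| m - (mass Psi + r))%N by exact: dvdn_sub.
  have -> : (m - mass Psi)%N = (m - (mass Psi + r) + r)%N.
    by rewrite subnDA subnK // leq_subRL // (leq_trans (leq_addr r _) tm).
  by rewrite -dE; apply: occursD rO; exact: occursM.
exists psi''; split=> // g gs; apply: le_trans (D_tri (Psi g) _ _) _.
have := psiPsi g; rewrite mem_cat gs => /(_ isT).
have : (\sum_(T | T \notin O) ci Psi T)%N%:R <= p%:R * (ec * N%:R) :> R.
  rewrite natr_sum; apply: le_trans (ler_sum _ (fun T TO => Psi0 T TO)) _.
  rewrite sumr_const -[leLHS]mulr_natl ler_wpM2r ?mulr_ge0 ?(ltW ec0) //.
  by rewrite ler_nat max_card.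
rewrite -(ler_pM2l K0) => /(le_trans (psi''P g)) h1 /lerD/(_ h1).
rewrite -(ler_pM2l (_ : 0 < 2 :> R)) // => /le_trans; apply.
have := ler_wpM2r N0 ecE.
have : es * m'%:R <= eps / 16 * N%:R.
  by apply: ler_pM => //; [exact: ltW|exact: le_trans nleN].
have : 0 <= eps * N%:R by rewrite mulr_ge0 // ltW.
clear -X2; lra.
Qed.

End OneOrbit.

(** * Prescribing all multiplicities *)

Section Adjust.
Variables (R : realType) (H : finGroupType) (M : rep_model R H).
Local Notation U := (U M).
Local Notation Kb := (Kb M).
Local Notation htype := (htype M).
Local Notation p := #|htype|.
Local Notation T0 := (T0 M).
Variables (G : groupType) (i : H -> G).
Hypotheses (iN : normal_embedding i) (stG : stableU M G).
Let iM : is_hom i. Proof. by case: iN. Qed.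
Local Notation ci psi T := (cnt (fun h => psi (i h)) T).
Local Notation e := (@rel_type _ _ M _ i).
Local Notation closed A := (fingraph.closed e A).

Let esym : connect_sym e. Proof. exact/sym_connect_sym/rel_type_sym. Qed.

Variable s : seq G.

(** Treats one orbit at a time: its block is split off and corrected, and the trivial type takes up
    the difference, so the other orbits stay untouched. *)
Lemma adjust : exists2 d, (0 < d)%N & forall eps : R, 0 < eps ->
  exists2 delta : R, 0 < delta & forall N (psi : G -> U N) (t : htype -> nat),
    is_hom psi -> (forall T T', e T T' -> t T = t T') ->
    (forall T, T != T0 ->
      [/\ (t T <= ci psi T)%N, (d %| t T)%N & (ci psi T - t T)%N%:R <= delta * N%:R]) ->
  exists psi' : G -> U N,
  [/\ is_hom psi', forall T, T != T0 -> ci psi' T = t T &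
      forall g, g \in s -> D (psi g) (psi' g) <= eps * N%:R].
Proof.
pose good (O : {set htype}) := closed (mem O) /\ T0 \notin O.
have ex_d O : exists d, (0 < d)%N /\ (good O -> forall eps : R, 0 < eps ->
  exists2 delta : R, 0 < delta & forall n N (psi : G -> U n) m,
    only i O psi -> (n <= N)%N -> (d %| m)%N -> (m <= n)%N -> (n - m)%N%:R <= delta * N%:R ->
  exists psi' : G -> U n,
  [/\ is_hom psi', forall T, T \notin O -> T != T0 -> ci psi' T = 0%N, mass i O psi' = m &
      forall g, g \in s -> D (psi g) (psi' g) <= eps * N%:R]).
  have [[Ocl T0O]|nO] := pselect (good O); last by exists 1%N.
  by have [d d0 dP] := reduce_type iN Ocl T0O stG s; exists d.
have [d dP] := choice ex_d.
have d0 : (0 < \prod_O d O)%N by apply: prodn_gt0 => O; case: (dP O).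
exists (\prod_O d O)%N => // eps eps0.
have p1 : 0 < p%:R + 1 :> R by rewrite ltr_wpDl.
pose e1 := eps / (p%:R + 1); have e10 : 0 < e1 by rewrite divr_gt0.
have [|O|delta delta0 deltaP] := @fin_delta R _ (fun O delta => good O ->
    forall n N (psi : G -> U n) m,
    only i O psi -> (n <= N)%N -> (d O %| m)%N -> (m <= n)%N -> (n - m)%N%:R <= delta * N%:R ->
  exists psi' : G -> U n,
  [/\ is_hom psi', forall T, T \notin O -> T != T0 -> ci psi' T = 0%N, mass i O psi' = m &
      forall g, g \in s -> D (psi g) (psi' g) <= e1 * N%:R]).
- move=> O dl dl' dl'0 dl'dl dlP Og n N psi m psiO nN dm mn mdl.
  by apply: dlP => //; apply: le_trans mdl _; rewrite ler_wpM2r.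
- have [Og|nO] := pselect (good O); last by exists 1.
  by have [dl dl0 dlP] := (dP O).2 Og e1 e10; exists dl.
exists (delta / (p%:R + 1)); first by rewrite divr_gt0.
move=> N psi0 t psi0M tconst psi0t.
have tconn T T' : connect e T T' -> t T = t T'.
  move=> /connectP[q]; elim: q T => [|S q IHq] T /=; first by move=> _ ->.
  by move=> /andP[/tconst -> /IHq]; exact.
(* [Z] contains the nontrivial types still present. Removing an orbit from it costs at most
   [e1 * N]; blocks shrink to size [n], but errors stay measured against [N]. *)
suff adjZ c (Z : {set htype}) n (psi : G -> U n) : (#|Z| <= c)%N -> good Z -> (n <= N)%N ->
    is_hom psi -> (forall T, T \notin Z -> T != T0 -> ci psi T = 0%N) ->
    (forall T, T \in Z -> [/\ (t T <= ci psi T)%N, (\prod_O d O %| t T)%N &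
       (ci psi T - t T)%N%:R <= delta / (p%:R + 1) * N%:R]) ->
  exists psi' : G -> U n,
  [/\ is_hom psi', forall T, T != T0 -> ci psi' T = if T \in Z then t T else 0%N &
      forall g, g \in s -> D (psi g) (psi' g) <= (c%:R * e1) * N%:R].
  have [||||T|T|psi' [psi'M psi't psi'P]] := adjZ p (finset.setT :\ T0)%SET N psi0 => //.
  - by rewrite max_card.
  - split; last by rewrite !inE eqxx.
    move=> T T' TT'; rewrite !inE !andbT.
    (* The orbit of [T0] is a singleton: the trivial representation of [G] has equal multiplicities
       on related types and contains only [T0]. *)
    have T0cl S S' : e S S' -> S = T0 -> S' = T0.
      move=> SS' ST0; have t1 := @hom_const1 G (U 1).
      have := cnt_rel iN t1 SS'; rewrite ST0 (cnt_triv 1 T0) (cnt_triv 1 S') eqxx.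
      by case: eqP.
    congr negb; apply/eqP/eqP; first exact: T0cl.
    by apply: T0cl; rewrite rel_type_sym.
  - by rewrite !inE andbT negbK => /eqP ->; rewrite eqxx.
  - by rewrite !inE andbT => /psi0t.
  exists psi'; split=> //.
    by move=> T TT0; rewrite psi't // !inE TT0.
  move=> g gs; apply: le_trans (psi'P g gs) _; rewrite ler_wpM2r //.
  by rewrite /e1 mulrCA ler_piMr ?(ltW eps0) // ler_pdivrMr // mul1r lerDl.
elim: c Z n psi {psi0 psi0M psi0t} => [|c IHc] Z n psi Zc [Zcl T0Z] nN psiM psi0 psit.
  have Z0 T : T \notin Z by move: Zc; rewrite leqn0 cards_eq0 => /eqP ->; rewrite inE.
  exists psi; split=> // [T TT0|g _]; first by rewrite (negPf (Z0 T)) psi0.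
  by rewrite D_id !mul0r.
have [Z0|[T TZ]] := set_0Vmem Z.
  have [||||||psi' [psi'M psi't psi'P]] := IHc Z n psi; rewrite ?Z0 ?cards0 //.
  - by split=> // [T T'|]; rewrite !inE.
  - by move=> T TZ; apply: psi0; rewrite Z0.
  - by move=> T; rewrite inE.
  exists psi'; split=> // [T TT0|g gs]; first by rewrite psi't // Z0.
  by apply: le_trans (psi'P g gs) _; rewrite ler_wpM2r // ler_wpM2r ?ler_nat // ltW.
pose O := [set T' | connect e T T']%SET.
have TO : T \in O by rewrite inE connect0.
have OZ T' : T' \in O -> T' \in Z.
  by rewrite inE => /(closed_connect Zcl) <-.
have Ocl : closed (mem O).
  by move=> x y xy; rewrite !inE; exact: (connect_closed esym).
have T0O : T0 \notin O by apply: contra T0Z; exact: OZ.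
have [a [b [eab [w [psia [psib [psiaM psibM psiE psiaE psibE]]]]]]] :=
  split_closed iN psiM Ocl.
have psiaO : only i O psia by split=> // S SO; rewrite psiaE (negPf SO).
have [aN bN] : (a <= N)%N /\ (b <= N)%N by clear -eab nN; lia.
have tO T' : T' \in O -> t T' = t T by rewrite inE => /tconn.
pose m := (\sum_(T' in O) t T')%N.
have mE : m = (#|O| * t T)%N by rewrite /m (eq_bigr _ tO) sum_nat_const.
have aE : a = (\sum_(T' in O) ci psi T')%N.
  by rewrite -(mass_only iN psiaO); apply: eq_bigr => S SO; rewrite psiaE SO.
have [|||||psia' [psia'M psia'0 psia't psia'P]] := deltaP O (conj Ocl T0O) a N psia m => //.
- rewrite mE dvdn_mull //; have [_ + _] := psit T TZ; apply: dvdn_trans.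
  by rewrite (bigD1 O) //= dvdn_mulr.
- by rewrite aE; apply: leq_sum => S /OZ /psit[].
- rewrite aE /m -sumnB; last by move=> S /OZ /psit[].
  rewrite natr_sum; apply: le_trans (ler_sum _ _) _.
    by move=> S /OZ /psit[_ _]; exact.
  rewrite sumr_const -[leLHS]mulr_natl mulrA ler_wpM2r //.
  rewrite mulrCA ler_piMr ?(ltW delta0) // ler_pdivrMr // mul1r.
  by apply: le_trans (_ : p%:R <= _); rewrite ?ler_nat ?max_card // lerDl.
have [||||||psib' [psib'M psib't psib'P]] := IHc (Z :\: O)%SET b psib => //.
- rewrite -ltnS; apply: leq_trans Zc; apply: proper_card; rewrite properE subsetDl.
  by apply/subsetPn; exists T; rewrite // inE TO.
- split; last by rewrite inE negb_and T0Z orbT.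
  by move=> x y xy; have := Zcl x y xy; have := Ocl x y xy; rewrite /= !finset.in_setD => -> ->.
- move=> S; rewrite inE negb_and negbK psibE; case: ifP => //= SO SZ ST0.
  exact: psi0.
- by move=> S; rewrite inE psibE => /andP[/negPf ->]; exact: psit.
(* Only the total mass of [O] was prescribed; multiplicities being constant on the orbit, it
   determines each of them. *)
have psia't' S : S \in O -> ci psia' S = t S.
  move=> SO; have psia'c S' : S' \in O -> ci psia' S' = ci psia' T.
    by rewrite inE => /(cnt_connect iN psia'M).
  rewrite (psia'c _ SO) (tO _ SO); move: psia't.
  rewrite /mass (eq_bigr _ psia'c) sum_nat_const mE => /eqP.
  by rewrite eqn_pmul2l => [/eqP //|]; apply/card_gt0P; exists T.
subst n.
have sM : is_hom (fun g => bsum (psia' g) (psib' g)) by exact: hom_bsum.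
exists (fun g => bsum (psia' g) (psib' g) ^ w)%g; split; first exact: hom_conj.
  move=> S ST0; rewrite (cnt_conj w (hom_comp iM sM)).
  rewrite cnt_bsum; [|exact: hom_comp..]; rewrite psib't // inE.
  case: (boolP (S \in O)) => SO /=; last by rewrite psia'0.
  by rewrite psia't' // OZ // addn0.
move=> g gs; rewrite psiE /= D_conj D_bsum -natr1 mulrDl mul1r mulrDl addrC.
by rewrite lerD // ?psia'P ?psib'P.
Qed.

End Adjust.

(** * Reconciling the two factors; homomorphisms from the amalgam *)

Section CommonTarget.
Variables (R : realType) (T : finType) (e1 e2 : rel T) (n1 n2 : T -> nat).
Hypotheses (e1_sym : symmetric e1) (e2_sym : symmetric e2).
Hypotheses (e1n : forall x y, e1 x y -> n1 x = n1 y) (e2n : forall x y, e2 x y -> n2 x = n2 y).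
Variable eta : R.
Hypotheses (n12 : forall x, (n1 x)%:R <= (n2 x)%:R + eta).
Hypotheses (n21 : forall x, (n2 x)%:R <= (n1 x)%:R + eta).

(** Take the minimum of [n1] and [n2] over each component of the union of both relations and round
    it down. A step preserves [n1] or [n2], so it changes each by at most [2 * eta], and a simple
    path has at most [#|T|] steps; the remaining [eta] compares [n1] with [n2] at its end. *)
Lemma common_target d : (0 < d)%N -> exists t : T -> nat,
  [/\ forall x, (d %| t x)%N, forall x, (t x <= minn (n1 x) (n2 x))%N,
      forall x y, e1 x y || e2 x y -> t x = t y &
      forall x, (maxn (n1 x) (n2 x) - t x)%N%:R <= (2 * #|T|%:R + 1) * eta + d%:R].
Proof.
move=> d0; pose e := relU e1 e2; pose m x := minn (n1 x) (n2 x).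
have esym : connect_sym e.
  by apply: sym_connect_sym => x y; rewrite /= e1_sym e2_sym.
pose mu x := m [arg min_(y < x | connect e x y) m y].
have muP x : (forall y, connect e x y -> (mu x <= m y)%N) /\
    exists2 y, connect e x y & mu x = m y.
  by rewrite /mu; case: arg_minnP => [|z xz zP]; [exact: connect0 | split=> //; exists z].
have mu_e x y : connect e x y -> mu x = mu y.
  have half u v : connect e u v -> (mu u <= mu v)%N.
    move=> uv; have [_ [z vz ->]] := muP v; apply: (muP u).1.
    exact: connect_trans uv vz.
  by move=> xy; apply/eqP; rewrite eqn_leq !half // esym.
exists (fun x => mu x %/ d * d)%N; split.
- by move=> x; rewrite dvdn_mull.
- by move=> x; apply: leq_trans (leq_trunc_div _ _) _; exact: (muP x).1 (connect0 _ _).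
- by move=> x y xy; rewrite (mu_e x y) // connect1.
move=> x; have [_ [y xy muE]] := muP x.
have eta0 : 0 <= eta by have := n12 x; have := n21 x; lra.
have far : (maxn (n1 x) (n2 x))%:R <= (m y)%:R + (2 * #|T|%:R + 1) * eta.
  have [q xq [yE uq]] : exists2 q, path e x q & y = last x q /\ uniq (x :: q).
    by have /connectP[q /shortenP[q' xq' uq' _] yE] := xy; exists q'.
  have sq : (size q)%:R <= #|T|%:R :> R.
    by rewrite ler_nat -(card_uniqP (subseq_uniq (subseq_cons q x) uq)) max_card.
  have chain (n : T -> nat) : (forall u v, e u v -> (n u)%:R <= (n v)%:R + 2 * eta) ->
      (n x)%:R <= (n y)%:R + (size q)%:R * (2 * eta).
    move=> nP; rewrite yE; elim: (q) (x) xq => [|z r IHr] u /=.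
      by rewrite mul0r addr0.
    move=> /andP[/nP uz /IHr]; rewrite -natr1 mulrDl mul1r; lra.
  have c1 : (n1 x)%:R <= (n1 y)%:R + (size q)%:R * (2 * eta).
    apply: chain => u v /orP[/e1n ->|/e2n uv]; first by lra.
    by have := n12 u; have := n21 v; rewrite uv; lra.
  have c2 : (n2 x)%:R <= (n2 y)%:R + (size q)%:R * (2 * eta).
    apply: chain => u v /orP[/e1n uv|/e2n ->]; last by lra.
    by have := n21 u; have := n12 v; rewrite uv; lra.
  have : (size q)%:R * (2 * eta) <= #|T|%:R * (2 * eta) by rewrite ler_wpM2r // mulr_ge0.
  have := n12 y; have := n21 y; rewrite /m /maxn /minn.
  by case: ltnP => _; case: ltnP => _; lra.
have : (mu x)%:R <= (mu x %/ d * d)%N%:R + d%:R :> R.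
  by rewrite -natrD ler_nat {1}(divn_eq (mu x) d) leq_add2l ltnW // ltn_mod.
rewrite natrB; last first.
  apply: leq_trans (leq_trunc_div _ _) _; apply: leq_trans ((muP x).1 _ (connect0 _ _)) _.
  by rewrite /m geq_min leq_maxl.
by rewrite muE in far *; lra.
Qed.

End CommonTarget.

Section Merge.
Variables (R : realType) (H : finGroupType) (M : rep_model R H).
Local Notation U := (U M).
Variables (G1 G2 : groupType) (i1 : H -> G1) (i2 : H -> G2).
Hypotheses (i1N : normal_embedding i1) (i2N : normal_embedding i2).
Hypotheses (stG1 : stableU M G1) (stG2 : stableU M G2).
Variables (s1 : seq G1) (s2 : seq G2).

Lemma reconcile (eps : R) : 0 < eps -> exists2 delta : R, 0 < delta &
  forall N (psi1 : G1 -> U N) (psi2 : G2 -> U N), is_hom psi1 -> is_hom psi2 ->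
    (forall h, D (psi1 (i1 h)) (psi2 (i2 h)) <= delta * N%:R) ->
  exists psi1' : G1 -> U N, exists psi2' : G2 -> U N,
  [/\ is_hom psi1', is_hom psi2', forall h, psi1' (i1 h) = psi2' (i2 h),
      forall g, g \in s1 -> D (psi1 g) (psi1' g) <= eps * N%:R &
      forall g, g \in s2 -> D (psi2 g) (psi2' g) <= eps * N%:R].
Proof.
move=> eps0; have [i1M i2M] : is_hom i1 /\ is_hom i2 by case: i1N; case: i2N.
have e7 : 0 < eps / 16 by rewrite divr_gt0.
have [d7 d70 near] := near_conj M e7.
(* By two uses of [D_tri], the corrected homomorphisms differ on [H] by at most
   [6 * ea + 4 * (d7 / 8)] relative to [N], hence by at most [d7]. *)
pose ea := Num.min (eps / 4) (d7 / 12).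
have ea0 : 0 < ea by rewrite lt_min !divr_gt0.
have ea1 : ea <= eps / 4 by rewrite ge_min lexx.
have ea2 : ea <= d7 / 12 by rewrite ge_min lexx orbT.
have [b1 b10 /(_ _ ea0)[a1 a10 adj1]] := adjust i1N stG1 (s1 ++ [seq i1 h | h <- enum H]).
have [b2 b20 /(_ _ ea0)[a2 a20 adj2]] := adjust i2N stG2 (s2 ++ [seq i2 h | h <- enum H]).
clearbody ea.
pose b := (b1 * b2)%N; have b0 : (0 < b)%N by rewrite muln_gt0 b10.
(* The bound of [common_target], with its additive term [b] absorbed into [b * (eta * N)] once
   [1 <= eta * N]. *)
pose c : R := 2 * #|htype M|%:R + 1 + b%:R.
have [|eta eta0 /= /and3P[eta1 eta2 _]] := @small_delta R [:: (c, a1); (c, a2)].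
  by rewrite /= a10 a20.
have [dc dc0 dcP] := cnt_cont M eta0.
exists (Num.min dc (d7 / 8)); first by rewrite lt_min dc0 divr_gt0.
move=> N psi1 psi2 psi1M psi2M psi12; have N0 : 0 <= N%:R :> R by [].
have psi12d h : D (psi1 (i1 h)) (psi2 (i2 h)) <= d7 / 8 * N%:R.
  by apply: le_trans (psi12 h) _; rewrite ler_wpM2r // ge_min lexx orbT.
have {}psi12 h : D (psi1 (i1 h)) (psi2 (i2 h)) <= dc * N%:R.
  by apply: le_trans (psi12 h) _; rewrite ler_wpM2r // ge_min lexx.
pose n1 T := cnt (fun h => psi1 (i1 h)) T; pose n2 T := cnt (fun h => psi2 (i2 h)) T.
have n12 T : (n1 T)%:R <= (n2 T)%:R + eta * N%:R.
  by apply: dcP => //; exact: hom_comp.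
have n21 T : (n2 T)%:R <= (n1 T)%:R + eta * N%:R.
  by apply: dcP => [||h]; [exact: hom_comp..|rewrite D_sym].
suff [psi1' [psi2' [psi1'M psi2'M cntE psi1'P psi2'P]]] :
    exists psi1' : G1 -> U N, exists psi2' : G2 -> U N,
  [/\ is_hom psi1', is_hom psi2',
      forall T, cnt (fun h => psi2' (i2 h)) T = cnt (fun h => psi1' (i1 h)) T,
      forall g, g \in s1 ++ [seq i1 h | h <- enum H] -> D (psi1 g) (psi1' g) <= ea * N%:R &
      forall g, g \in s2 ++ [seq i2 h | h <- enum H] -> D (psi2 g) (psi2' g) <= ea * N%:R].
  have [||h||w wE w1] := near N (fun h => psi2' (i2 h)) (fun h => psi1' (i1 h)) => //.
  - exact: hom_comp.
  - exact: hom_comp.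
  - apply: le_trans (D_tri (psi2 (i2 h)) _ _) _.
    have := D_tri (psi1 (i1 h)) (psi2 (i2 h)) (psi1' (i1 h)).
    have := psi12d h; rewrite D_sym.
    have := psi1'P (i1 h); rewrite mem_cat map_f ?mem_enum ?orbT // => /(_ isT).
    have := psi2'P (i2 h); rewrite mem_cat map_f ?mem_enum ?orbT // => /(_ isT).
    rewrite (D_sym (psi2 (i2 h)) (psi2' _)); have := ler_wpM2r N0 ea2; lra.
  exists psi1', (fun g => psi2' g ^ w)%g; split=> //.
  - exact: hom_conj.
  - move=> g gs; have := psi1'P g; rewrite mem_cat gs => /(_ isT) h.
    by apply: le_trans h _; rewrite ler_wpM2r //; apply: le_trans ea1 _; lra.
  - move=> g gs; have := psi2'P g; rewrite mem_cat gs => /(_ isT) h.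
    apply: le_trans (D_tri (psi2' g) _ _) _; have := D_conjr (psi2' g) w.
    by have := ler_wpM2r N0 ea1; lra.
(* Integers differing by less than 1 are equal, so in this case the multiplicities already agree. *)
have [etaN|etaN] := ltP (eta * N%:R) 1.
  have leE k l : k%:R <= l%:R + eta * N%:R -> (k <= l)%N.
    move=> kl; rewrite -ltnS -(ltr_nat R) -[l.+1]addn1 natrD.
    by apply: le_lt_trans kl _; rewrite ltrD2l.
  exists psi1, psi2; split=> // [T|g _|g _]; try by rewrite D_id mulr_ge0 // ltW.
  by apply/eqP; rewrite eqn_leq; apply/andP; split; apply: leE; [exact: n21 | exact: n12].
have [||t [bt tn te tE]] := @common_target R _ _ _ n1 n2
  (@rel_type_sym _ _ M _ i1) (@rel_type_sym _ _ M _ i2) _ _ (eta * N%:R) n12 n21 b b0.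
- by move=> x y; exact: cnt_rel.
- by move=> x y; exact: cnt_rel.
have tc T : (maxn (n1 T) (n2 T) - t T)%N%:R <= c * eta * N%:R.
  apply: le_trans (tE T) _; rewrite -mulrA /c [leRHS]mulrDl lerD2l -[leLHS]mulr1.
  exact: ler_wpM2l.
have [|T _|psi1' [psi1'M psi1't psi1'P]] := adj1 N psi1 t psi1M.
- by move=> T T' TT'; rewrite (te T T') ?TT'.
- split; first by apply: leq_trans (tn T) _; exact: geq_minl.
    by apply: dvdn_trans (bt T); exact: dvdn_mulr.
  apply: le_trans (le_trans (tc T) _); last by rewrite ler_wpM2r.
  by rewrite ler_nat leq_sub2r // leq_maxl.
have [|T _|psi2' [psi2'M psi2't psi2'P]] := adj2 N psi2 t psi2M.
- by move=> T T' TT'; rewrite (te T T') ?TT' ?orbT.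
- split; first by apply: leq_trans (tn T) _; exact: geq_minr.
    by apply: dvdn_trans (bt T); exact: dvdn_mull.
  apply: le_trans (le_trans (tc T) _); last by rewrite ler_wpM2r.
  by rewrite ler_nat leq_sub2r // leq_maxr.
exists psi1', psi2'; split=> // T.
(* All other multiplicities agree and both families sum to [N], so those of [T0] agree as well. *)
have [->|TT0] := eqVneq T (T0 M); last by rewrite psi1't // psi2't.
have /eqP := cnt_sum (hom_comp i1M psi1'M).
rewrite -{2}(cnt_sum (hom_comp i2M psi2'M)) (bigD1 (T0 M)) //= [X in _ == X](bigD1 (T0 M)) //=.
rewrite [X in (_ + X)%N == _](eq_bigr (fun T => cnt (fun h => psi2' (i2 h)) T)).
  by rewrite eqn_add2r => /eqP.
by move=> S ST0; rewrite psi1't // psi2't.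
Qed.

End Merge.

(** * Universal property of the amalgam *)

Section Amalgam.
Variables (G1 G2 H : groupType) (i1 : H -> G1) (i2 : H -> G2).
Local Open Scope group_scope.
Local Notation S := [set x | exists h : H, x = fp_inl G2 (i1 h) * (fp_inr G1 (i2 h))^-1]%classic.

Definition amalgam_inl (g : G1) : amalgam i1 i2 := quotient_proj S (fp_inl G2 g).
Definition amalgam_inr (g : G2) : amalgam i1 i2 := quotient_proj S (fp_inr G1 g).

Lemma quotient_proj_hom (G : groupType) (X : classical_sets.set G) :
  is_hom (quotient_proj X : G -> Defs.quotient_group X).
Proof. by move=> x y; rewrite -quotient_projM. Qed.

Lemma fp_word_hom s t : fp_word (s ++ t) = fp_word s * fp_word t :> free_product G1 G2.
Proof. by rewrite -fp_wordM. Qed.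

Lemma amalgam_inl_hom : is_hom amalgam_inl.
Proof.
move=> x y; rewrite -quotient_proj_hom; congr quotient_proj.
by rewrite -fp_word_hom; apply/fp_wordP/word_sym/word_Ml.
Qed.

Lemma amalgam_inr_hom : is_hom amalgam_inr.
Proof.
move=> x y; rewrite -quotient_proj_hom; congr quotient_proj.
by rewrite -fp_word_hom; apply/fp_wordP/word_sym/word_Mr.
Qed.

Lemma amalgam_glue h : amalgam_inl (i1 h) = amalgam_inr (i2 h).
Proof.
apply/esym/quotient_projP => A [[_ AJ] SA].
have := SA _ (ex_intro _ h (erefl _)) => /(AJ _ (fp_inr G1 (i2 h))).
by rewrite conjgE mulgVK.
Qed.

Lemma amalgam_ind (P : amalgam i1 i2 -> Prop) :
  (forall x y, P x -> P y -> P (x * y)) ->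
  (forall g, P (amalgam_inl g)) -> (forall g, P (amalgam_inr g)) -> forall x, P x.
Proof.
move=> PM P1 P2 x; rewrite -(quotient_reprK x) -(fp_reprK (quotient_repr x)).
elim: (fp_repr _) => [|a s IHs].
  suff -> : fp_word [::] = fp_inl G2 (1 : G1) by exact: P1.
  by apply/fp_wordP; apply: word_sym; exact: word_1l.
rewrite -cat1s fp_word_hom quotient_proj_hom; apply: PM IHs.
by case: a => g; [exact: P1 | exact: P2].
Qed.

Lemma amalgam_lift (K : groupType) (f1 : G1 -> K) (f2 : G2 -> K) :
  is_hom f1 -> is_hom f2 -> (forall h, f1 (i1 h) = f2 (i2 h)) ->
  exists f : amalgam i1 i2 -> K,
  [/\ is_hom f, forall g, f (amalgam_inl g) = f1 g & forall g, f (amalgam_inr g) = f2 g].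
Proof.
move=> f1M f2M f12.
pose ev (s : seq (G1 + G2)) := \prod_(x <- s) (match x with inl a => f1 a | inr b => f2 b end).
have ev_cat s t : ev (s ++ t) = ev s * ev t by rewrite /ev big_cat.
have evP s t : word_eqv s t -> ev s = ev t.
  elim=> {s t} //=.
  - by move=> s t u _ -> _ ->.
  - by move=> s s' t t' _ ss' _ tt'; rewrite !ev_cat ss' tt'.
  - by rewrite /ev big_seq1 big_nil hom1.
  - by rewrite /ev big_seq1 big_nil hom1.
  - by move=> a b; rewrite /ev !big_cons !big_nil !mulg1 f1M.
  - by move=> a b; rewrite /ev !big_cons !big_nil !mulg1 f2M.
pose ef (u : free_product G1 G2) := ev (fp_repr u).
have efE s : ef (fp_word s) = ev s by apply: evP; apply/fp_wordP; exact: fp_reprK.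
have efM : is_hom ef.
  by move=> u v; rewrite -(fp_reprK u) -(fp_reprK v) -fp_word_hom !efE.
have kerN : is_normal_subgroup [set x | ef x = 1]%classic.
  split; first split; rewrite /= ?(hom1 efM) //.
    by move=> x y /= x1 y1; rewrite efM (homV efM) x1 y1 invg1 mulg1.
  by move=> x g /= x1; rewrite (homJ efM) x1 conj1g.
have efN x : normal_closure S x -> ef x = 1.
  move=> /(_ [set x | ef x = 1]%classic); apply; split=> // _ [h ->] /=.
  by rewrite efM (homV efM) !efE /ev !big_seq1 f12 mulgV.
pose f (x : amalgam i1 i2) := ef (quotient_repr x).
have fE u : f (quotient_proj S u) = ef u.
  have /efN : normal_closure S ((quotient_repr (quotient_proj S u))^-1 * u).
    by apply/quotient_projP; rewrite quotient_reprK.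
  by rewrite efM (homV efM) => /(canRL (mulKVg _)); rewrite mulg1.
exists f; split=> [x y|g|g]; last 2 first.
- by rewrite fE efE /ev big_seq1.
- by rewrite fE efE /ev big_seq1.
by rewrite -(quotient_reprK x) -(quotient_reprK y) -quotient_proj_hom !fE efM.
Qed.

End Amalgam.

Lemma normal_embedding_range (H : finGroupType) (G : groupType) (i : {multiplicative H -> G}) :
  injective i -> is_normal_subgroup (range i) -> normal_embedding i.
Proof.
move=> iI [_ iJ]; split=> // [x y|g]; first exact: gmulfM.
have /choice[a aP] : forall h, exists k, i k = (i h ^ g)%g.
  move=> h; have [|k _ kE] := iJ (i h) g; [by exists h | by exists k].
by exists a.
Qed.

(** * Stability of the amalgam in the abstract model *)

Section Stable.
Variables (R : realType) (H : finGroupType) (M : rep_model R H).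
Local Notation U := (U M).

(** The elements at which both sequences agree asymptotically form a subgroup. For quotients,
    [phi (x y^-1) phi y] is compared with [phi x], since [phi] need not respect inverses. *)
Lemma close_generated (G : groupType) (s : seq G) (N : nat -> nat)
    (phi psi : forall k, G -> U (N k)) :
  smallest (@is_subgroup G) [set` s]%classic = [set: G]%classic ->
  (forall k, is_hom (psi k)) ->
  (forall g h (eps : R), 0 < eps -> exists K, forall k, (K <= k)%N ->
    D (phi k g * phi k h)%g (phi k (g * h)%g) <= eps * (N k)%:R) ->
  (forall eps : R, 0 < eps -> exists K, forall k, (K <= k)%N ->
    forall g, g \in s -> D (phi k g) (psi k g) <= eps * (N k)%:R) ->
  forall g (eps : R), 0 < eps -> exists K, forall k, (K <= k)%N ->
    D (phi k g) (psi k g) <= eps * (N k)%:R.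
Proof.
move=> genG psiM phiM near_s g.
pose A := [set g : G | forall eps : R, 0 < eps -> exists K, forall k, (K <= k)%N ->
  D (phi k g) (psi k g) <= eps * (N k)%:R]%classic.
suff : A g by [].
have : (smallest (@is_subgroup G) [set` s]%classic) g by rewrite genG.
apply; split; last first.
  move=> h /= hs eps eps0; have [K KP] := near_s eps eps0.
  by exists K => k Kk; exact: KP.
have A1 : A 1%g.
  move=> eps eps0; have [K KP] := phiM 1%g 1%g _ eps0; exists K => k /KP.
  by rewrite (hom1 (psiM k)) -(D_mull (phi k 1%g) 1%g (phi k 1%g)) !mulg1.
split=> // x y Ax Ay eps eps0.
have e0 : 0 < eps / 16 by rewrite divr_gt0.
have [K1 K1P] := Ax _ e0; have [K2 K2P] := Ay _ e0.
have [K3 K3P] := phiM (x * y^-1)%g y _ e0.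
exists (maxn K1 (maxn K2 K3)) => k; rewrite !geq_max => /and3P[/K1P h1 /K2P h2 /K3P].
rewrite mulgVK => h3; rewrite (psiM k) (homV (psiM k)).
have -> : D (phi k (x * y^-1)%g) (psi k x * (psi k y)^-1)%g =
    D (phi k (x * y^-1) * psi k y)%g (psi k x).
  by rewrite -[RHS](@D_mulr _ _ _ _ _ _ (psi k y)^-1%g) mulgK.
have := D_tri (phi k x) (phi k (x * y^-1) * psi k y)%g (psi k x).
have := D_tri (phi k (x * y^-1) * phi k y)%g (phi k (x * y^-1) * psi k y)%g (phi k x).
rewrite D_mull (D_sym (psi k y)); move: h1 h2 h3.
have : 0 <= eps * (N k)%:R by rewrite mulr_ge0 // ltW.
lra.
Qed.

Variables (G1 G2 : groupType) (i1 : H -> G1) (i2 : H -> G2).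

Lemma stableU_amalgam : normal_embedding i1 -> normal_embedding i2 ->
  finitely_generated G1 -> finitely_generated G2 ->
  stableU M G1 -> stableU M G2 -> stableU M (amalgam i1 i2).
Proof.
move=> i1N i2N [s1 s1P] [s2 s2P] stG1 stG2 N phi N0 phiM.
pose j1 := amalgam_inl i1 i2; pose j2 := amalgam_inr i1 i2.
have phi1M g h (e : R) : 0 < e -> exists K, forall k, (K <= k)%N ->
    D (phi k (j1 g) * phi k (j1 h))%g (phi k (j1 (g * h)%g)) <= e * (N k)%:R.
  by rewrite /j1 amalgam_inl_hom; exact: phiM.
have phi2M g h (e : R) : 0 < e -> exists K, forall k, (K <= k)%N ->
    D (phi k (j2 g) * phi k (j2 h))%g (phi k (j2 (g * h)%g)) <= e * (N k)%:R.
  by rewrite /j2 amalgam_inr_hom; exact: phiM.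
have [psi1 psi1M psi1P] := stG1 N _ N0 phi1M.
have [psi2 psi2M psi2P] := stG2 N _ N0 phi2M.
pose agree k (f : (G1 -> U (N k)) * (G2 -> U (N k))) :=
  [/\ is_hom f.1, is_hom f.2 & forall h, f.1 (i1 h) = f.2 (i2 h)].
pose within k (f : (G1 -> U (N k)) * (G2 -> U (N k))) (e : R) :=
  (forall g, g \in s1 -> D (phi k (j1 g)) (f.1 g) <= e * (N k)%:R) /\
  (forall g, g \in s2 -> D (phi k (j2 g)) (f.2 g) <= e * (N k)%:R).
have approx (e : R) : 0 < e -> exists K, forall k, (K <= k)%N ->
    exists2 f, agree k f & within k f e.
  move=> e0; have e4 : 0 < e / 4 by rewrite divr_gt0.
  have [delta delta0 deltaP] := reconcile i1N i2N stG1 stG2 s1 s2 e4.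
  have d2 : 0 < delta / 4 by rewrite divr_gt0.
  have [K1 K1P] := eventually_seq s1 (fun g => psi1P g _ e4).
  have [K2 K2P] := eventually_seq s2 (fun g => psi2P g _ e4).
  have [K3 K3P] := eventually_seq (enum H) (fun h => psi1P (i1 h) _ d2).
  have [K4 K4P] := eventually_seq (enum H) (fun h => psi2P (i2 h) _ d2).
  exists (maxn (maxn K1 K2) (maxn K3 K4)) => k; rewrite !geq_max.
  move=> /andP[/andP[/K1P h1 /K2P h2] /andP[/K3P h3 /K4P h4]].
  have [|f1 [f2 [f1M f2M f12 f1P f2P]]] := deltaP (N k) (psi1 k) (psi2 k) (psi1M k) (psi2M k).
    move=> h; apply: le_trans (D_tri (phi k (j1 (i1 h))) _ _) _.
    have := h3 h; have := h4 h; rewrite mem_enum => /(_ isT) + /(_ isT).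
    rewrite /j1 amalgam_glue (D_sym (psi1 _ _)); lra.
  exists (f1, f2); split=> //= g gs.
    by apply: le_trans (D_tri (psi1 k g) _ _) _; have := f1P g gs; have := h1 g gs; lra.
  by apply: le_trans (D_tri (psi2 k g) _ _) _; have := f2P g gs; have := h2 g gs; lra.
(* A diagonal choice: [f k] is [1/m]-close for the largest possible [m <= k]. *)
pose Q k m := `[< exists2 f, agree k f & m = 0%N \/ within k f m%:R^-1 >] && (m <= k)%N.
have f_ex : forall k, exists f, agree k f /\
    forall m, Q k m -> m = 0%N \/ within k f m%:R^-1.
  (* The clause [m = 0] makes the trivial pair admissible at every [k], so a maximal [m] exists. *)
  move=> k; have Q0 : exists m, Q k m.
    exists 0%N; rewrite /Q leq0n andbT; apply/asboolP.
    exists (fun=> 1%g, fun=> 1%g); last by left.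
    by split=> //=; exact: hom_const1.
  have Qk m : Q k m -> (m <= k)%N by case/andP.
  have [m /andP[/asboolP[f fk fm] mk] mmax] := ex_maxnP Q0 Qk; exists f; split=> // l Ql.
  case: fm => [m0|fm]; first by left; apply/eqP; rewrite -leqn0 -m0 mmax.
  have [->|l0] := posnP l; [by left|right].
  have ml : m%:R^-1 <= l%:R^-1 :> R.
    have lm := mmax _ Ql; rewrite lef_pV2 ?ler_nat // posrE ltr0n //.
    exact: leq_trans l0 lm.
  by case: fm => fm1 fm2; split=> g gs;
    [apply: le_trans (fm1 g gs) _|apply: le_trans (fm2 g gs) _]; rewrite ler_wpM2r.
pose f k := projT1 (cid (f_ex k)).
have fP k : agree k (f k) /\ forall m, Q k m -> m = 0%N \/ within k (f k) m%:R^-1 :=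
  projT2 (cid (f_ex k)).
clearbody f.
have f_close (e : R) : 0 < e -> exists K, forall k, (K <= k)%N -> within k (f k) e.
  move=> e0; pose m := (Num.truncn e^-1).+1.
  have m0 : 0 < m%:R :> R by rewrite ltr0n.
  have me : m%:R^-1 <= e by rewrite invf_ple ?posrE // ltW // truncnS_gt.
  have mi0 : 0 < m%:R^-1 :> R by rewrite invr_gt0.
  have [K KP] := approx _ mi0; exists (maxn K m) => k; rewrite geq_max => /andP[Kk mk].
  have [f' f'k f'm] := KP k Kk; have [_ /(_ m)] := fP k.
  case=> [|//|[w1 w2]]; first by rewrite /Q mk andbT; apply/asboolP; exists f'; [|right].
  by split=> g gs; [apply: le_trans (w1 g gs) _|apply: le_trans (w2 g gs) _];
    rewrite ler_wpM2r.
have psi_ex : forall k, exists psi : amalgam i1 i2 -> U (N k), [/\ is_hom psi,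
    forall g, psi (j1 g) = (f k).1 g & forall g, psi (j2 g) = (f k).2 g].
  by move=> k; have [[f1M f2M f12] _] := fP k; exact: amalgam_lift.
pose psi k := projT1 (cid (psi_ex k)).
have psiP k : [/\ is_hom (psi k), forall g, psi k (j1 g) = (f k).1 g &
    forall g, psi k (j2 g) = (f k).2 g] := projT2 (cid (psi_ex k)).
clearbody psi.
have psiM k : is_hom (psi k) by case: (psiP k).
exists psi => //; apply: amalgam_ind => [x y Px Py eps eps0|g|g].
- have e0 : 0 < eps / 16 by rewrite divr_gt0.
  have [K1 K1P] := Px _ e0; have [K2 K2P] := Py _ e0; have [K3 K3P] := phiM x y _ e0.
  exists (maxn K1 (maxn K2 K3)) => k; rewrite !geq_max => /and3P[/K1P h1 /K2P h2 /K3P h3].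
  rewrite psiM; apply: le_trans (D_tri (phi k x * phi k y)%g _ _) _.
  have := D_mul2 (phi k x) (psi k x) (phi k y) (psi k y); rewrite D_sym in h3.
  have : 0 <= eps * (N k)%:R by rewrite mulr_ge0 // ltW.
  lra.
- apply: (close_generated (phi := fun k g => phi k (j1 g)) (psi := fun k g => psi k (j1 g)) s1P).
  + by move=> k x y /=; rewrite /j1 amalgam_inl_hom psiM.
  + exact: phi1M.
  + move=> e /f_close[K KP]; exists K => k /KP[h _] g' g's.
    by have [_ -> _] := psiP k; exact: h.
- apply: (close_generated (phi := fun k g => phi k (j2 g)) (psi := fun k g => psi k (j2 g)) s2P).
  + by move=> k x y /=; rewrite /j2 amalgam_inr_hom psiM.
  + exact: phi2M.
  + move=> e /f_close[K KP]; exists K => k /KP[_ h] g' g's.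
    by have [_ _ ->] := psiP k; exact: h.
Qed.

End Stable.

(** * Symmetric groups *)

Section BlockPerm.
Local Open Scope group_scope.

Definition perm_sum_fun m n (s : {perm 'I_m}) (t : {perm 'I_n}) (x : 'I_(m + n)) :=
  unsplit (match split x with inl a => inl (s a) | inr b => inr (t b) end).

Lemma perm_sum_inj m n (s : {perm 'I_m}) (t : {perm 'I_n}) : injective (perm_sum_fun s t).
Proof.
move=> x y /(can_inj (@unsplitK _ _)) xy; apply: (can_inj (@splitK _ _)).
by move: xy; case: (split x) => a; case: (split y) => b // [/perm_inj ->].
Qed.

Definition perm_sum m n (s : {perm 'I_m}) (t : {perm 'I_n}) : {perm 'I_(m + n)} :=
  perm (@perm_sum_inj m n s t).

Lemma perm_suml m n (s : {perm 'I_m}) (t : {perm 'I_n}) a :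
  perm_sum s t (lshift n a) = lshift n (s a).
Proof. by rewrite permE /perm_sum_fun (unsplitK (inl a)). Qed.

Lemma perm_sumr m n (s : {perm 'I_m}) (t : {perm 'I_n}) b :
  perm_sum s t (rshift m b) = rshift m (t b).
Proof. by rewrite permE /perm_sum_fun (unsplitK (inr b)). Qed.

Lemma perm_sumM m n (s s' : {perm 'I_m}) (t t' : {perm 'I_n}) :
  perm_sum (s * s') (t * t') = perm_sum s t * perm_sum s' t'.
Proof.
apply/permP => x; rewrite -(splitK x); case: (split x) => a /=;
by rewrite permM ?perm_suml ?perm_sumr permM.
Qed.

End BlockPerm.

Section Hamming.
Variable R : realType.

Definition hamming n (s t : {perm 'I_n}) : R := (\sum_x (s x != t x))%N%:R.

Lemma hamming_ge0 n (s t : {perm 'I_n}) : 0 <= hamming s t.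
Proof. exact: ler0n. Qed.

Lemma hamming_id n (s : {perm 'I_n}) : hamming s s = 0.
Proof. by rewrite /hamming big1 // => x _; rewrite eqxx. Qed.

Lemma hamming_sym n (s t : {perm 'I_n}) : hamming s t = hamming t s.
Proof. by congr _%:R; apply: eq_bigr => x _; rewrite eq_sym. Qed.

Lemma hamming_tri n (t s u : {perm 'I_n}) : hamming s u <= 2 * (hamming s t + hamming t u).
Proof.
rewrite -natrD -natrM ler_nat mulSn mul1n; apply: leq_trans (leq_addr _ _).
rewrite -big_split; apply: leq_sum => x _.
have [//|su] := eqVneq (s x) (u x); have [<-|//] := eqVneq (s x) (t x).
by rewrite su.
Qed.

Lemma hamming_mull n (s t u : {perm 'I_n}) : hamming (u * s)%g (u * t)%g = hamming s t.
Proof.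
congr _%:R; rewrite [RHS](reindex_inj (@perm_inj _ u)) /=.
by apply: eq_bigr => x _; rewrite !permM.
Qed.

Lemma hamming_mulr n (s t u : {perm 'I_n}) : hamming (s * u)%g (t * u)%g = hamming s t.
Proof.
by congr _%:R; apply: eq_bigr => x _; rewrite !permM (inj_eq perm_inj).
Qed.

Lemma sum_bool_le (I : finType) (P : pred I) : (\sum_x P x <= #|I|)%N.
Proof. by rewrite -sum1_card; apply: leq_sum => x _; case: (P x). Qed.

Lemma hamming_le n (s t : {perm 'I_n}) : hamming s t <= 2 * n%:R.
Proof.
apply: (@le_trans _ _ n%:R); last by rewrite ler_peMl // ler1n.
by rewrite ler_nat -[leqRHS]card_ord sum_bool_le.
Qed.

Lemma hamming_sum m n (s s' : {perm 'I_m}) (t t' : {perm 'I_n}) :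
  hamming (perm_sum s t) (perm_sum s' t') = hamming s s' + hamming t t'.
Proof.
rewrite -natrD; congr _%:R; rewrite big_split_ord /=.
by congr addn; apply: eq_bigr => x _;
  rewrite ?perm_suml ?perm_sumr (inj_eq (@lshift_inj _ _), inj_eq (@rshift_inj _ _)).
Qed.

End Hamming.

(** * Actions of [H] and their point stabilizers *)

Section Stabilizers.
Variable H : finGroupType.
Implicit Types X : finType.

Definition stab X (r : H -> {perm X}) (x : X) : {set H} := [set h | r h x == x]%SET.

Definition nstab X (r : H -> {perm X}) (T : {set H}) : nat := (\sum_x (stab r x == T))%N.

Lemma stabP X (r : H -> {perm X}) x h : (h \in stab r x) = (r h x == x).
Proof. by rewrite inE. Qed.

Lemma nstab_sum n (r : H -> {perm 'I_n}) : (\sum_T nstab r T = n)%N.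
Proof.
rewrite exchange_big /= -[RHS]card_ord -sum1_card; apply: eq_bigr => x _.
rewrite (bigD1 (stab r x)) //= eqxx big1 // => T; rewrite eq_sym => /negPf -> //.
Qed.

Lemma nstab_perm_sum m n (r : H -> {perm 'I_m}) (r' : H -> {perm 'I_n}) T :
  nstab (fun h => perm_sum (r h) (r' h)) T = (nstab r T + nstab r' T)%N.
Proof.
rewrite /nstab big_split_ord /=; congr addn; apply: eq_bigr => x _; congr (nat_of_bool (_ == _));
  apply/setP => h; rewrite !stabP ?perm_suml ?perm_sumr;
  by rewrite (inj_eq (@lshift_inj _ _), inj_eq (@rshift_inj _ _)).
Qed.

Lemma nstab_conj X (r : H -> {perm X}) (w : {perm X}) T :
  nstab (fun h => r h ^ w)%g T = nstab r T.
Proof.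
rewrite /nstab (reindex_inj (@perm_inj _ w)) /=; apply: eq_bigr => x _.
congr (nat_of_bool (_ == _)); apply/setP => h.
by rewrite !stabP permJ (inj_eq perm_inj).
Qed.

Lemma nstab_twist X (r : H -> {perm X}) (a : H -> H) T : injective a ->
  nstab (fun h => r (a h)) T = nstab r (a @: T)%SET.
Proof.
move=> aI; apply: eq_bigr => x _; congr nat_of_bool.
have -> : stab (fun h => r (a h)) x = (a @^-1: stab r x)%SET.
  by apply/setP => h; rewrite !inE.
apply/eqP/eqP => [<-|->].
  apply/setP => h; apply/idP/imsetP => [hx|[k]]; last by rewrite !inE => + ->.
  by have [b _ bK] := injF_bij aI; exists (b h); move: hx; rewrite !inE bK.
by apply/setP => h; rewrite inE (mem_imset _ _ aI).
Qed.

(** A point whose stabilizer changes is sent to different places by [r h] and [r' h] for some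
    [h]. *)
Lemma nstab_le X (r r' : H -> {perm X}) T :
  (nstab r T <= nstab r' T + \sum_h \sum_x (r h x != r' h x))%N.
Proof.
rewrite exchange_big -big_split; apply: leq_sum => x _ /=.
have [xT|//] := eqVneq (stab r x) T; have [//|x'T] := eqVneq (stab r' x) T.
have [h hx] : exists h, r h x != r' h x.
  apply/existsP; apply: contra_neqT x'T; rewrite negb_exists => /forallP rr'.
  by rewrite -xT; apply/setP => h; rewrite !stabP (eqP (negbNE (rr' h))).
by rewrite (bigD1 h) //= hx.
Qed.

(* An equivariant injection defined on an invariant set extends to an equivariant permutation
   as soon as all stabilizer types occur equally often: extend along one orbit at a time. *)
Lemma extend_equivariant X (r r' : H -> {perm X}) (Y : {set X}) (f : X -> X) :
  is_hom r -> is_hom r' -> (forall T, nstab r T = nstab r' T) ->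
  (forall h x, x \in Y -> r h x \in Y) -> {in Y &, injective f} ->
  (forall h x, x \in Y -> f (r h x) = r' h (f x)) ->
  exists2 w : {perm X}, forall h x, w (r h x) = r' h (w x) & {in Y, w =1 f}.
Proof.
move=> rM r'M rr'; move: {2}#|_| (leqnn #|~: Y|) => c.
elim: c Y f => [|c IHc] Y f Yc YH fI fH.
  have YT x : x \in Y.
    by move: Yc; rewrite leqn0 cards_eq0 => /eqP/setP/(_ x); rewrite !inE => /negbFE.
  have fI' : injective f by move=> x y; apply: fI.
  by exists (perm fI') => [h x|x _]; rewrite !permE ?fH.
have [x xY|YT] := pickP (fun x => x \notin Y); last first.
  apply: (IHc Y) => //; suff -> : (~: Y)%SET = finset.set0 by rewrite cards0.
  by apply/setP => x; rewrite !inE; apply/negbTE; rewrite negbK; apply/negPn/negbT/YT.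
have r1 z : r 1%g z = z by rewrite (hom1 rM) perm1.
have r'1 z : r' 1%g z = z by rewrite (hom1 r'M) perm1.
have rK h z : r h^-1%g (r h z) = z by rewrite -permM -rM mulgV r1.
have r'K h z : r' h (r' h^-1%g z) = z by rewrite -permM -r'M mulVg r'1.
have fst y : y \in Y -> stab r' (f y) = stab r y.
  move=> yY; apply/setP => h; rewrite !stabP -fH //.
  by apply/eqP/eqP => [/fI|->//]; apply; rewrite ?YH.
(* [f] matches the points of type [stab r x] in [Y] with those in [f @: Y]. The totals agree and [x]
   lies outside [Y], so one such point lies outside [f @: Y]. *)
have [x' x'Y x'x] : exists2 x', x' \notin f @: Y & stab r' x' = stab r x.
  apply: contrapT => no; have := rr' (stab r x).
  rewrite /nstab (bigID (mem Y)) [RHS](bigID (mem (f @: Y))) /=.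
  rewrite [in RHS](big_imset _ fI) /= [X in (_ + X)%N = _](bigD1 x) //= eqxx.
  rewrite (eq_bigr _ (fun y yY => congr1 (fun T => nat_of_bool (T == stab r x)) (fst y yY))).
  move/addnI; rewrite [RHS]big1 // => z zY.
  by case: eqP => // zx; case: no; exists z.
have rD h k z : r k (r h z) = r (h * k)%g z by rewrite rM permM.
have r'D h k z : r' k (r' h z) = r' (h * k)%g z by rewrite r'M permM.
have orb h k : (r h x == r k x) = (r' h x' == r' k x').
  have st u v (s : H -> {perm X}) (z : X) : is_hom s ->
      (s u z == s v z) = (u * v^-1 \in stab s z)%g.
    move=> sM; rewrite stabP sM permM (homV sM) -[RHS](inj_eq (@perm_inj _ (s v))).
    by rewrite permKV.
  by rewrite !st // x'x.
(* Equality of the two stabilizers makes [g] well defined on the orbit of [x]. The default [z] is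
   never reached on the enlarged set. *)
pose g z := if z \in Y then f z else if [pick h | r h x == z] is Some h then r' h x' else z.
have gY z : z \in Y -> g z = f z by rewrite /g => ->.
have rxY h : r h x \notin Y by apply: contra xY => /(YH h^-1%g); rewrite rK.
have gx h : g (r h x) = r' h x'.
  rewrite /g (negPf (rxY h)); case: pickP => [k|/(_ h)]; last by rewrite eqxx.
  by rewrite orb => /eqP.
have fx' y h : y \in Y -> f y != r' h x'.
  move=> yY; apply: contra x'Y => /eqP fy; apply/imsetP; exists (r h^-1%g y); first exact: YH.
  by rewrite fH // fy r'D mulgV r'1.
pose Y' := (Y :|: [set r h x | h : H])%SET.
have Y'P z : z \in Y' -> z \in Y \/ exists h, z = r h x.
  by rewrite inE => /orP[|/imsetP[h _ ->]]; [left|right; exists h].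
have xY' h : r h x \in Y' by rewrite inE imset_f ?orbT.
have [||||w wH wY'] := IHc Y' g.
- rewrite -ltnS; apply: leq_trans Yc; apply: proper_card; rewrite properE.
  rewrite finset.setCS finset.subsetUl /=.
  apply/subsetPn; exists x; rewrite inE // negbK; by have := xY' 1%g; rewrite r1.
- move=> h z /Y'P[zY|[k ->]]; first by rewrite inE YH.
  by rewrite rD xY'.
- move=> y z /Y'P[yY|[h ->]] /Y'P[zY|[k ->]].
  + by rewrite !gY //; exact: fI.
  + by rewrite gY // gx => /eqP; rewrite (negPf (fx' _ _ yY)).
  + by rewrite gx gY // => /esym/eqP; rewrite (negPf (fx' _ _ zY)).
  + by rewrite !gx => /eqP; rewrite -orb => /eqP.
- move=> h z /Y'P[zY|[k ->]]; first by rewrite !gY ?YH ?fH.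
  by rewrite rD !gx r'D.
by exists w => // y yY; rewrite wY' ?gY // inE yY.
Qed.

End Stabilizers.

Section PermModel.
Variables (R : realType) (H : finGroupType).
Local Notation hamming := (hamming R).

(** The points of the last block that stay in it define a partial injection, completed by
    [extend_equivariant] for trivial actions. At most [k] points leave, and the first block has [k]
    points, whence the factor 2. *)
Lemma hamming_trim k m (A : {perm 'I_(k + m)}) :
  exists A' : {perm 'I_m}, hamming A (perm_sum 1%g A') <= 2 * k%:R.
Proof.
pose Y := [set x : 'I_m | [exists y : 'I_m, A (rshift k x) == rshift k y]]%SET.
pose f x := odflt x [pick y : 'I_m | A (rshift k x) == rshift k y].
have fP x : x \in Y -> A (rshift k x) = rshift k (f x).
  rewrite inE => /existsP[y xy]; rewrite /f; case: pickP => [z /eqP //|/(_ y)].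
  by rewrite xy.
pose tr (h : H) : {perm 'I_m} := 1%g.
have trM : is_hom tr by exact: hom_const1.
have [|x y xY yY fxy|h x xY|w _ wf] := @extend_equivariant _ _ tr tr Y f trM trM (fun=> erefl).
- by move=> h x; rewrite perm1.
- by apply: (@rshift_inj k); apply: (@perm_inj _ A); rewrite !fP // fxy.
- by rewrite !perm1.
exists w; rewrite -natrM ler_nat big_split_ord /= mulSn mul1n leq_add //.
  by rewrite -[leqRHS]card_ord sum_bool_le.
have YC : (\sum_x (A (rshift k x) != perm_sum 1 w (rshift k x)) <= #|~: Y|)%N.
  rewrite -sum1_card [leqRHS]big_mkcond; apply: leq_sum => x _; rewrite perm_sumr finset.in_setC.
  by case: (boolP (x \in Y)) => [xY|_]; [rewrite wf // fP // eqxx|case: eqP].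
apply: leq_trans YC _; rewrite -[leqRHS]card_ord.
have AI : injective (fun x : 'I_m => A (rshift k x)).
  by move=> x y /perm_inj /rshift_inj.
rewrite -(card_imset _ AI) -[leqRHS]cardsT; apply: leq_trans (leq_imset_card (lshift m) _).
apply/subset_leq_card/fintype.subsetP => _ /imsetP[x xY ->].
case: (splitP (A (rshift k x))) => y yE.
  by apply/imsetP; exists y; rewrite ?finset.in_setT //; apply: val_inj.
move: xY; rewrite !inE negb_exists => /forallP/(_ y)/eqP[].
exact: val_inj.
Qed.

(** The identity is equivariant on the invariant set where both actions agree, and equal types let
    it extend. The extension can move only points where some [r h] and [r' h] differ. *)
Lemma perm_near_conj (eps : R) : 0 < eps -> exists2 delta : R, 0 < delta &
  forall n (r r' : H -> {perm 'I_n}), is_hom r -> is_hom r' ->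
    (forall h, hamming (r h) (r' h) <= delta * n%:R) ->
    (forall T, nstab r T = nstab r' T) ->
  exists2 w : {perm 'I_n}, (forall h, r' h = r h ^ w)%g & hamming w 1%g <= eps * n%:R.
Proof.
move=> eps0; have H0 : 0 < #|H|%:R :> R by rewrite ltr0n; apply/card_gt0P; exists 1%g.
exists (eps / #|H|%:R); first by rewrite divr_gt0.
move=> n r r' rM r'M rr' rrE.
pose Y := [set x | [forall h, r h x == r' h x]]%SET.
have YP x : x \in Y -> forall h, r h x = r' h x.
  by rewrite inE => /forallP xY h; exact/eqP.
have [h x xY|//|h x xY|w wr w1] := @extend_equivariant _ _ r r' Y id rM r'M rrE.
- rewrite inE; apply/forallP => k.
  by rewrite -permM -rM YP // r'M permM YP.
- exact: YP.
exists w => [h|]; first by apply/permP => x; rewrite -{2}(permKV w x) permJ wr permKV.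
apply: (@le_trans _ _ (\sum_h hamming (r h) (r' h))); last first.
  apply: le_trans (ler_sum _ (fun h _ => rr' h)) _.
  by rewrite sumr_const -[leLHS]mulr_natl mulrA mulrCA divff ?mulr1 // gt_eqF.
rewrite -natr_sum ler_nat exchange_big; apply: leq_sum => x _ /=.
case: (boolP (x \in Y)) => [xY|]; first by rewrite w1 // perm1 eqxx.
rewrite inE negb_forall => /existsP[h hx]; rewrite (bigD1 h) //= hx.
by case: (_ == _).
Qed.

Lemma nstab_cont (eps : R) : 0 < eps -> exists2 delta : R, 0 < delta &
  forall n (r r' : H -> {perm 'I_n}), is_hom r -> is_hom r' ->
    (forall h, hamming (r h) (r' h) <= delta * n%:R) ->
  forall T, (nstab r T)%:R <= (nstab r' T)%:R + eps * n%:R :> R.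
Proof.
move=> eps0; have H0 : 0 < #|H|%:R :> R by rewrite ltr0n; apply/card_gt0P; exists 1%g.
exists (eps / #|H|%:R); first by rewrite divr_gt0.
move=> n r r' _ _ rr' T.
apply: (@le_trans _ _ (nstab r' T + \sum_h \sum_x (r h x != r' h x))%N%:R).
  by rewrite ler_nat nstab_le.
rewrite natrD lerD2l natr_sum; apply: le_trans (ler_sum _ (fun h _ => rr' h)) _.
by rewrite sumr_const -[leLHS]mulr_natl mulrA mulrCA divff ?mulr1 // gt_eqF.
Qed.

Lemma restrict_perm (G : groupType) n (psi : G -> {perm 'I_n}) (Y : {set 'I_n}) :
  is_hom psi -> (forall g x, x \in Y -> psi g x \in Y) ->
  exists2 rho : G -> {perm 'I_#|Y|}, is_hom rho &
    forall g j, enum_val (rho g j) = psi g (enum_val j).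
Proof.
move=> psiM YG; pose f g (j : 'I_#|Y|) := enum_rank_in (enum_valP j) (psi g (enum_val j)).
have fE g j : enum_val (f g j) = psi g (enum_val j).
  by rewrite enum_rankK_in // YG // enum_valP.
have fI g : injective (f g).
  by move=> j k /(congr1 enum_val); rewrite !fE => /perm_inj/enum_val_inj.
exists (fun g => perm (fI g)) => [g h|g j]; last by rewrite permE fE.
by apply/permP => j; apply: enum_val_inj; rewrite permM !permE !fE psiM permM.
Qed.

Lemma ecast_perm_conj k n (e : k = n) (c : 'I_k -> 'I_n) (w : {perm 'I_n})
    (s : {perm 'I_k}) (t : {perm 'I_n}) :
  (forall x, w (cast_ord e x) = c x) -> (forall x, t (c x) = c (s x)) ->
  t = (ecast i {perm 'I_i} e s ^ w)%g.
Proof.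
case: n / e c w t => c w t wc tc; have {}wc x : w x = c x by rewrite -wc cast_ord_id.
by apply/permP => x; rewrite -(permKV w x) permJ !wc tc.
Qed.

(** [psi g] carries a point with stabilizer [T] to one with stabilizer [a @: T], so [G] preserves
    the set of points with stabilizer in [O] and its complement. *)
Lemma perm_split (G : groupType) (i : H -> G) (O : {set {set H}}) n (psi : G -> {perm 'I_n}) :
  normal_embedding i -> is_hom psi ->
  (forall g a T, conj_by i g a -> T \in O -> (a @: T)%SET \in O) ->
  exists a b (e : (a + b)%N = n) (w : {perm 'I_n}) (psia : G -> {perm 'I_a})
    (psib : G -> {perm 'I_b}),
    [/\ is_hom psia, is_hom psib,
        forall g, psi g = (ecast n {perm 'I_n} e (perm_sum (psia g) (psib g)) ^ w)%g,
        forall T, T \notin O -> nstab (fun h => psia (i h)) T = 0%N &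
        forall T, T \in O -> nstab (fun h => psib (i h)) T = 0%N].
Proof.
move=> iN psiM Ocl; pose Y := [set x | stab (fun h => psi (i h)) x \in O]%SET.
have Ysub g x : x \in Y -> psi g x \in Y.
  rewrite !inE => xY; case: (iN) => _ _ /(_ g)[a ga].
  suff -> : stab (fun h => psi (i h)) (psi g x) = (a @: stab (fun h => psi (i h)) x)%SET.
    exact: Ocl ga xY.
  have aS h : (a h \in stab (fun h => psi (i h)) (psi g x)) =
      (h \in stab (fun h => psi (i h)) x).
    by rewrite !stabP ga (homJ psiM) permJ (inj_eq perm_inj).
  have [b _ bK] := injF_bij (conj_by_inj iN ga).
  apply/setP => h; rewrite -{1}(bK h) aS; apply/idP/imsetP => [hx|[k kx ->]].
    by exists (b h).
  by have := aS k; rewrite kx -{1}[a k]bK aS.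
have YsubC g x : x \in (~: Y)%SET -> psi g x \in (~: Y)%SET.
  rewrite !finset.in_setC; apply: contra => /(Ysub g^-1%g).
  by rewrite -permM -psiM mulgV (hom1 psiM) perm1.
have [psia psiaM psiaE] := restrict_perm psiM Ysub.
have [psib psibM psibE] := restrict_perm psiM YsubC.
have e : (#|Y| + #|~: Y|)%N = n by rewrite cardsC card_ord.
pose c (x : 'I_(#|Y| + #|~: Y|)) : 'I_n :=
  match split x with inl j => enum_val j | inr j => enum_val j end.
have cI : injective c.
  move=> x y; rewrite /c => xy; apply: (can_inj (@splitK _ _)); move: xy.
  case: (split x) => j; case: (split y) => k.
  - by move/enum_val_inj ->.
  - by move=> jk; have := enum_valP k; rewrite -jk finset.in_setC enum_valP.
  - by move=> jk; have := enum_valP j; rewrite jk finset.in_setC enum_valP.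
  - by move/enum_val_inj ->.
have wI : injective (fun x => c (cast_ord (esym e) x)) by move=> x y /cI /cast_ord_inj.
exists #|Y|, #|~: Y|, e, (perm wI), psia, psib; split=> //.
- move=> g; apply: (@ecast_perm_conj _ _ e c) => x; first by rewrite permE cast_ordK.
  rewrite /c -{1 2}(splitK x); case: (split x) => j /=.
    by rewrite (unsplitK (inl j)) perm_suml (unsplitK (inl _)) psiaE.
  by rewrite (unsplitK (inr j)) perm_sumr (unsplitK (inr _)) psibE.
- move=> T TO; rewrite /nstab big1 // => j _; case: eqP => // jT.
  have := enum_valP j; rewrite inE (_ : stab _ _ = T) ?(negPf TO) // -jT.
  by apply/setP => h; rewrite !stabP -psiaE (inj_eq enum_val_inj).
- move=> T TO; rewrite /nstab big1 // => j _; case: eqP => // jT.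
  have := enum_valP j; rewrite !inE (_ : stab _ _ = T) ?TO // -jT.
  by apply/setP => h; rewrite !stabP -psibE (inj_eq enum_val_inj).
Qed.

Definition perm_model : rep_model R H := {|
  U := fun n => {perm 'I_n};
  D := hamming;
  bsum := perm_sum;
  (* This proof also determines [Kb] as 2. *)
  Kb_gt0 := ltr0Sn R 1;
  D_ge0 := @hamming_ge0 R;
  D_id := @hamming_id R;
  D_sym := @hamming_sym R;
  D_tri := @hamming_tri R;
  D_mull := @hamming_mull R;
  D_mulr := @hamming_mulr R;
  D_le := @hamming_le R;
  bsumM := perm_sumM;
  D_bsum := @hamming_sum R;
  trim := hamming_trim;
  htype := {set H};
  cnt := fun n => @nstab H 'I_n;
  cnt_sum := fun n r _ => nstab_sum r;
  cnt_bsum := fun m n r r' _ _ => nstab_perm_sum r r';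
  cnt_conj := fun n r w _ => nstab_conj r w;
  twist := fun a T => (a @: T)%SET;
  cnt_twist := fun n r a _ _ aI T => nstab_twist r T aI;
  cnt_cont := nstab_cont;
  near_conj := perm_near_conj;
  split_rep := perm_split
|}.

End PermModel.

Lemma cvg0P (R : realType) (u : nat -> R) : (forall k, 0 <= u k) ->
  (u k @[k --> \oo] --> (0 : R))%classic <->
  forall eps, 0 < eps -> exists K, forall k, (K <= k)%N -> u k <= eps.
Proof.
move=> u0; split=> [/cvgrPdist_le u_cvg eps /u_cvg[K _ KP]|u_small].
  by exists K => k /KP /=; rewrite sub0r normrN ger0_norm.
apply/cvgrPdist_le => eps /u_small[K KP]; exists K => // k /KP.
by rewrite /= sub0r normrN ger0_norm.
Qed.

Lemma is_hom_multiplicative (G K : groupType) (f : G -> K) : is_hom f ->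
  exists f' : {multiplicative G -> K}, f' =1 f.
Proof.
move=> fM; pose F := isMultiplicative.Build G K f fM.
pose f' : {multiplicative G -> K} := HB.pack f F.
by exists f'.
Qed.

(** * Transfer between finite sets and ordinals *)

Section PermStable.
Variables (R : realType) (H : finGroupType) (G : groupType).
Local Notation M := (perm_model R H).

Lemma stable_P_stableU : stable (P_class R) G -> stableU M G.
Proof.
move=> stG N phi N0 phiM.
have NX k : (0 < #|'I_(N k)|)%N by rewrite card_ord.
pose X k : mc_obj (P_class R) := exist (fun X : finType => (0 < #|X|)%N) 'I_(N k) (NX k).
have distE k (s t : {perm 'I_(N k)}) :
    @mc_dist _ (P_class R) (X k) s t = hamming R s t / (N k)%:R.
  rewrite /= /hamming_dist card_ord /hamming -sum1dep_card big_mkcond /=.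
  by congr (_%:R / _); apply: eq_bigr => x _; case: (_ != _).
have [|psi psiP] := stG X phi.
  move=> g h; apply/cvg0P => [k|eps eps0]; first by rewrite distE divr_ge0 ?hamming_ge0.
  have [K KP] := phiM g h eps eps0; exists K => k Kk.
  by rewrite distE ler_pdivrMr ?ltr0n ?N0 //; exact: KP.
exists (fun k => psi k) => [k x y|g eps eps0]; first exact: gmulfM.
have d0 k : 0 <= @mc_dist _ (P_class R) (X k) (phi k g) (psi k g).
  by rewrite distE divr_ge0 ?hamming_ge0.
have [K KP] := (cvg0P d0).1 (psiP g) eps eps0.
by exists K => k /KP; rewrite distE ler_pdivrMr ?ltr0n ?N0.
Qed.

Lemma stableU_stable_P : stableU M G -> stable (P_class R) G.
Proof.
move=> stG X phi phiM.
have X0 k : (0 < #|sval (X k)|)%N := svalP (X k).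
pose to k (s : {perm sval (X k)}) : {perm 'I_#|sval (X k)|} :=
  perm (inj_comp enum_rank_inj (inj_comp (@perm_inj _ s) enum_val_inj)).
pose from k (s : {perm 'I_#|sval (X k)|}) : {perm sval (X k)} :=
  perm (inj_comp enum_val_inj (inj_comp (@perm_inj _ s) enum_rank_inj)).
have toE k s x : to k s x = enum_rank (s (enum_val x)) by rewrite permE.
have fromE k s x : from k s x = enum_val (s (enum_rank x)) by rewrite permE.
have toM k (s t : {perm sval (X k)}) : to k (s * t)%g = (to k s * to k t)%g.
  by apply/permP => x; rewrite permM !toE enum_rankK permM.
have fromM k s t : from k (s * t)%g = (from k s * from k t)%g.
  by apply/permP => x; rewrite permM !fromE enum_valK permM.
have toK k s : to k (from k s) = s.
  by apply/permP => x; rewrite toE fromE !enum_valK.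
have distE k (s t : {perm sval (X k)}) :
    @mc_dist _ (P_class R) (X k) s t = hamming R (to k s) (to k t) / #|sval (X k)|%:R.
  rewrite /= /hamming_dist /hamming -sum1dep_card big_mkcond /=.
  congr (_%:R / _); rewrite (reindex (fun j : 'I_#|sval (X k)| => enum_val j)) /=; last first.
    by apply: onW_bij; exact: enum_val_bij.
  apply: eq_bigr => x _; rewrite !toE (inj_eq enum_rank_inj).
  by case: (_ != _).
have dist0 k (s t : {perm sval (X k)}) : 0 <= @mc_dist _ (P_class R) (X k) s t.
  by rewrite distE divr_ge0 ?hamming_ge0.
have [|psi psiM psiP] := stG (fun k => #|sval (X k)|) (fun k g => to k (phi k g)) X0.
  move=> g h eps eps0; have [K KP] := (cvg0P (fun k => dist0 k _ _)).1 (phiM g h) eps eps0.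
  by exists K => k /KP; rewrite distE ler_pdivrMr ?ltr0n ?X0 // toM.
have psi_ex k : exists psi' : {multiplicative G -> {perm sval (X k)}},
    psi' =1 fun g => from k (psi k g).
  by apply: is_hom_multiplicative => x y; rewrite psiM fromM.
exists (fun k => projT1 (cid (psi_ex k))) => g.
apply/cvg0P => [k|eps eps0]; first exact: dist0.
have [K KP] := psiP g eps eps0; exists K => k /KP h.
by rewrite (projT2 (cid (psi_ex k))) distE toK ler_pdivrMr ?ltr0n ?X0.
Qed.

End PermStable.

(** * Frobenius norm, functional calculus, polar decomposition *)

Local Open Scope sesquilinear_scope.

Section Frobenius.
Variable C : numClosedFieldType.

Lemma ctrM m n p (A : 'M[C]_(m, n)) (B : 'M_(n, p)) : (A *m B)^t* = B^t* *m A^t*.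
Proof. by rewrite trmx_mul map_mxM. Qed.

Lemma ctrD m n (A B : 'M[C]_(m, n)) : (A + B)^t* = A^t* + B^t*.
Proof. by rewrite linearD /= map_mxD. Qed.

Lemma ctrB m n (A B : 'M[C]_(m, n)) : (A - B)^t* = A^t* - B^t*.
Proof. by rewrite linearB /= map_mxB. Qed.

Lemma ctrZ m n c (A : 'M[C]_(m, n)) : (c *: A)^t* = c^* *: A^t*.
Proof. by rewrite linearZ /= map_mxZ. Qed.

Lemma ctr1 n : (1%:M : 'M[C]_n)^t* = 1%:M.
Proof. by rewrite trmx1 map_mx1. Qed.

Lemma ctr0 m n : (0 : 'M[C]_(m, n))^t* = 0.
Proof. by rewrite trmx0 map_mx0. Qed.

Lemma ctr_sum m n (I : Type) (s : seq I) (Q : pred I) (F : I -> 'M[C]_(m, n)) :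
  (\sum_(i <- s | Q i) F i)^t* = \sum_(i <- s | Q i) (F i)^t*.
Proof. exact: (big_morph _ (@ctrD m n) (ctr0 m n)). Qed.

Lemma tr_ctr n (A : 'M[C]_n) : \tr (A^t*) = (\tr A)^*.
Proof. by rewrite trace_map_mx mxtrace_tr. Qed.

(** The squared Frobenius norm, not divided by the size. *)
Definition sqn m n (A : 'M[C]_(m, n)) : C := \sum_i \sum_j `|A i j| ^+ 2.

Lemma sqn_tr m n (A : 'M[C]_(m, n)) : sqn A = \tr (A *m A^t*).
Proof.
by apply: eq_bigr => i _; rewrite mxE; apply: eq_bigr => j _; rewrite !mxE normCK.
Qed.

Lemma sqn_trC m n (A : 'M[C]_(m, n)) : sqn A = \tr (A^t* *m A).
Proof. by rewrite sqn_tr mxtrace_mulC. Qed.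

Lemma sqn_ge0 m n (A : 'M[C]_(m, n)) : 0 <= sqn A.
Proof. by apply: sumr_ge0 => i _; apply: sumr_ge0 => j _; exact: exprn_ge0. Qed.

Lemma sqn_eq0 m n (A : 'M[C]_(m, n)) : sqn A = 0 -> A = 0.
Proof.
move=> /eqP; rewrite psumr_eq0 => [/allP A0|i _]; last first.
  by apply: sumr_ge0 => j _; exact: exprn_ge0.
apply/matrixP => i j; rewrite mxE; have := A0 i (mem_index_enum _).
rewrite psumr_eq0 => [/allP/(_ j (mem_index_enum _))|k _]; last exact: exprn_ge0.
by rewrite expf_eq0 /= normr_eq0 => /eqP.
Qed.

Lemma sqn_ctr m n (A : 'M[C]_(m, n)) : sqn (A^t*) = sqn A.
Proof. by rewrite sqn_tr trmxCK -sqn_trC. Qed.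

Lemma sqnN m n (A : 'M[C]_(m, n)) : sqn (- A) = sqn A.
Proof. by apply: eq_bigr => i _; apply: eq_bigr => j _; rewrite mxE normrN. Qed.

Lemma sqn0 m n : sqn (0 : 'M[C]_(m, n)) = 0.
Proof. by rewrite /sqn big1 // => i _; rewrite big1 // => j _; rewrite mxE normr0 expr0n. Qed.

Lemma sqnD m n (A B : 'M[C]_(m, n)) : sqn (A + B) <= 2 * (sqn A + sqn B).
Proof.
rewrite /sqn -big_split mulr_sumr; apply: ler_sum => i _ /=.
rewrite -big_split mulr_sumr; apply: ler_sum => j _ /=; rewrite mxE.
rewrite -subr_ge0.
have -> : 2 * (`|A i j| ^+ 2 + `|B i j| ^+ 2) - `|A i j + B i j| ^+ 2 = `|A i j - B i j| ^+ 2.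
  by rewrite !normCK !rmorphD rmorphN /=; ring.
exact: exprn_ge0.
Qed.

Lemma sqnZ m n c (A : 'M[C]_(m, n)) : sqn (c *: A) = `|c| ^+ 2 * sqn A.
Proof.
rewrite /sqn mulr_sumr; apply: eq_bigr => i _; rewrite mulr_sumr.
by apply: eq_bigr => j _; rewrite mxE normrM exprMn.
Qed.

Lemma unitary_mulVmx n (U : 'M[C]_n) : U \is unitarymx -> U^t* *m U = 1%:M.
Proof. by move=> /unitarymxP/mulmx1C. Qed.

Lemma sqn_unitaryl m n (U : 'M[C]_m) (A : 'M_(m, n)) : U \is unitarymx -> sqn (U *m A) = sqn A.
Proof.
by move=> /unitary_mulVmx U1; rewrite !sqn_trC ctrM mulmxA -(mulmxA (A^t*)) U1 mulmx1.
Qed.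

Lemma sqn_unitaryr m n (U : 'M[C]_n) (A : 'M_(m, n)) : U \is unitarymx -> sqn (A *m U) = sqn A.
Proof.
by move=> /unitarymxP U1; rewrite !sqn_tr ctrM mulmxA -(mulmxA A) U1 mulmx1.
Qed.

Lemma sqn_unitary n (U : 'M[C]_n) : U \is unitarymx -> sqn U = n%:R.
Proof. by move=> /unitarymxP U1; rewrite sqn_tr U1 mxtrace1. Qed.

Lemma sqn_block m1 m2 n1 n2 (A : 'M[C]_(m1, n1)) (B : 'M_(m1, n2)) (A' : 'M_(m2, n1))
    (B' : 'M_(m2, n2)) :
  sqn (block_mx A B A' B') = sqn A + sqn B + (sqn A' + sqn B').
Proof.
rewrite /sqn big_split_ord /=; congr (_ + _); rewrite -big_split /=;
  apply: eq_bigr => i _; rewrite big_split_ord /=; congr (_ + _);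
  by apply: eq_bigr => j _; rewrite ?block_mxEul ?block_mxEur ?block_mxEdl ?block_mxEdr.
Qed.

(** In the full-rank factorization of [P], idempotence makes the product of the factors in reverse
    order the identity; the trace is cyclic. *)
Lemma idem_trace_rank n (P : 'M[C]_n) : P *m P = P -> \tr P = (\rank P)%:R.
Proof.
move=> PP; have bc : row_base P *m col_base P = 1%:M.
  apply: (row_full_inj (col_base_full P)); apply: (row_free_inj (row_base_free P)).
  by rewrite /= mulmx1 (mulmxA _ (row_base P)) mulmx_base -mulmxA mulmx_base PP.
by rewrite -[in LHS](mulmx_base P) mxtrace_mulC bc mxtrace1.
Qed.

End Frobenius.

Section Spectral.
Variables (C : numClosedFieldType) (n : nat) (P : 'M[C]_n) (d : 'rV[C]_n).
Hypothesis PU : P \is unitarymx.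

Definition fcalc (f : C -> C) : 'M[C]_n := P^t* *m diag_mx (map_mx f d) *m P.

Lemma eq_fcalc f g : (forall i, f (d 0 i) = g (d 0 i)) -> fcalc f = fcalc g.
Proof.
by move=> fg; congr (_ *m diag_mx _ *m _); apply/rowP => i; rewrite !mxE fg.
Qed.

Lemma fcalcM f g : fcalc f *m fcalc g = fcalc (fun x => f x * g x).
Proof.
rewrite /fcalc !mulmxA -(mulmxA _ P) (unitarymxP PU) mulmx1 -(mulmxA (P^t*)) mulmx_diag.
by congr (_ *m diag_mx _ *m _); apply/rowP => i; rewrite !mxE.
Qed.

Lemma fcalc1 : fcalc (fun=> 1) = 1%:M.
Proof.
have -> : fcalc (fun=> 1) = P^t* *m diag_mx (const_mx 1) *m P.
  by congr (_ *m diag_mx _ *m _); apply/rowP => i; rewrite !mxE.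
by rewrite diag_const_mx mulmx1 unitary_mulVmx.
Qed.

Lemma fcalcB f g : fcalc f - fcalc g = fcalc (fun x => f x - g x).
Proof.
rewrite /fcalc -mulmxBl -mulmxBr -linearB /=; congr (_ *m diag_mx _ *m _).
by apply/rowP => i; rewrite !mxE.
Qed.

Lemma fcalc_ctr f : (forall i, (f (d 0 i))^* = f (d 0 i)) -> (fcalc f)^t* = fcalc f.
Proof.
move=> fR; rewrite /fcalc !ctrM trmxCK mulmxA tr_diag_mx map_diag_mx.
by congr (_ *m diag_mx _ *m _); apply/rowP => i; rewrite !mxE; exact: fR.
Qed.

(** In the eigenbasis, a nonzero entry of a matrix commuting with the diagonal one links equal
    eigenvalues, on which [f] agrees. *)
Lemma fcalc_comm f B : B *m fcalc id = fcalc id *m B -> B *m fcalc f = fcalc f *m B.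
Proof.
have PU' := unitary_mulVmx PU; have PP := unitarymxP PU.
pose B' := P *m B *m P^t*.
have BE : B = P^t* *m B' *m P.
  by rewrite /B' !mulmxA PU' mul1mx -mulmxA PU' mulmx1.
have comm g : (B *m fcalc g == fcalc g *m B) =
    (B' *m diag_mx (map_mx g d) == diag_mx (map_mx g d) *m B').
  have -> : B *m fcalc g = P^t* *m (B' *m diag_mx (map_mx g d)) *m P.
    by rewrite BE /fcalc !mulmxA -(mulmxA _ P (P^t*)) PP mulmx1.
  have -> : fcalc g *m B = P^t* *m (diag_mx (map_mx g d) *m B') *m P.
    by rewrite BE /fcalc !mulmxA -(mulmxA _ P (P^t*)) PP mulmx1.
  apply/eqP/eqP => [/(congr1 (fun X => P *m X *m P^t*))|-> //].
  by rewrite !mulmxA PP !mul1mx -!(mulmxA _ P (P^t*)) PP !mulmx1.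
clearbody B'.
move/eqP; rewrite comm => /eqP B'd; apply/eqP; rewrite comm; apply/eqP/matrixP => i j.
have /matrixP/(_ i j) := B'd; rewrite !mul_mx_diag !mul_diag_mx !mxE.
have [->|Bij] := eqVneq (B' i j) 0; first by rewrite !mul0r !mulr0.
move=> /= dij; suff -> : d 0 j = d 0 i by rewrite mulrC.
by apply: (mulfI Bij); rewrite dij mulrC.
Qed.

Lemma sqn_fcalc f : sqn (fcalc f) = \sum_i `|f (d 0 i)| ^+ 2.
Proof.
rewrite /fcalc sqn_unitaryr // sqn_unitaryl; last by rewrite trmxC_unitary.
apply: eq_bigr => i _; rewrite (bigD1 i) //= !mxE eqxx mulr1n big1 ?addr0 // => j ji.
by rewrite !mxE eq_sym (negPf ji) mulr0n normr0 expr0n.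
Qed.

End Spectral.

Section Polar.
Variable C : numClosedFieldType.

Lemma psd_spectral n (A : 'M[C]_n) : exists P d, [/\ P \is unitarymx,
  A^t* *m A = fcalc P d id & forall i, 0 <= d 0 i].
Proof.
set M := _ *m _; have Mn : M \is normalmx by apply/normalmxP; rewrite /M ctrM trmxCK.
exists (spectralmx M), (spectral_diag M); have PU := spectral_unitarymx M.
have ME : M = fcalc (spectralmx M) (spectral_diag M) id.
  by rewrite /fcalc [map_mx id _]map_mx_id // -(invmx_unitary PU); exact: (orthomx_spectralP Mn).
split=> // i; set P := spectralmx M in PU ME *; set d := spectral_diag M in ME *.
suff -> : d 0 i = ((A *m P^t*)^t* *m (A *m P^t*)) i i.
  by rewrite mxE sumr_ge0 // => j _; rewrite !mxE mulrC mul_conjC_ge0.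
rewrite ctrM trmxCK mulmxA -(mulmxA P) -/M ME /fcalc [map_mx id _]map_mx_id // !mulmxA.
by rewrite (unitarymxP PU) mul1mx -mulmxA (unitarymxP PU) mulmx1 mxE eqxx mulr1n.
Qed.

Lemma polar_partial n (A : 'M[C]_n) : exists g s : 'M[C]_n,
  [/\ (A *m g) *m (A *m g)^t* *m (A *m g) = A *m g, A *m g *m s = A,
      (A *m g)^t* *m (A *m g) *m s = s,
      forall B, B *m (A^t* *m A) = A^t* *m A *m B -> B *m g = g *m B &
      sqn (s - 1%:M) <= sqn (A^t* *m A - 1%:M)].
Proof.
have [P [d [PU ME d0]]] := psd_spectral A.
(* Since [0^-1 = 0], [gf] inverts the square root on the support and vanishes elsewhere; [q] gives
   the projection onto the support. *)
pose gf (x : C) := (sqrtC x)^-1; pose q (x : C) := (x != 0)%:R : C.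
exists (fcalc P d gf), (fcalc P d sqrtC).
have gR i : (gf (d 0 i))^* = gf (d 0 i).
  by apply/CrealP; rewrite realV ger0_real // sqrtC_ge0.
have gqE x : gf x * x * gf x = q x.
  rewrite /gf /q; have [->|x0] := eqVneq x 0; first by rewrite sqrtC0 invr0 !mul0r.
  by rewrite -{2}(sqrtCK x) mulrAC expr2 mulrACA !mulVf ?sqrtC_eq0 // mulr1.
have QE : (A *m fcalc P d gf)^t* *m (A *m fcalc P d gf) = fcalc P d q.
  rewrite ctrM (fcalc_ctr _ gR) mulmxA -(mulmxA (fcalc P d gf)) ME !fcalcM //.
  exact: eq_fcalc.
have Aq : A *m fcalc P d q = A.
  apply/eqP; rewrite -subr_eq0 -{2}[A]mulmx1 -mulmxBr; apply/eqP/sqn_eq0.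
  rewrite sqn_trC ctrM mulmxA -(mulmxA _ (A^t*)) ME -(fcalc1 d PU) fcalcB.
  rewrite fcalc_ctr; last by move=> i; rewrite rmorphB /= rmorph1 conjC_nat.
  rewrite !fcalcM // (@eq_fcalc _ _ P d _ (fun=> 0)); last first.
    by move=> i; rewrite /q; case: eqP => [->|_]; rewrite ?(mulr0, mul0r, subrr).
  rewrite /fcalc; suff -> : map_mx (fun=> 0 : C) d = 0 by rewrite linear0 mulmx0 mul0mx mxtrace0.
  by apply/rowP => i; rewrite !mxE.
split.
- rewrite -mulmxA QE -mulmxA fcalcM //; congr (_ *m _); apply: eq_fcalc => i.
  by rewrite /gf /q; case: eqP => [->|_]; rewrite ?mulr1 // sqrtC0 invr0 mul0r.
- rewrite -mulmxA fcalcM // -[RHS]Aq; congr (_ *m _); apply: eq_fcalc => i.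
  by rewrite /gf /q; case: eqVneq => [->|?]; rewrite ?sqrtC0 ?mulr0 // mulVf // sqrtC_eq0.
- rewrite QE fcalcM //; apply: eq_fcalc => i.
  by rewrite /q; case: eqVneq => [->|?]; rewrite ?sqrtC0 ?mulr0 // mul1r.
- by move=> B; rewrite ME; exact: fcalc_comm.
- rewrite ME -(fcalc1 d PU) !fcalcB !sqn_fcalc //; apply: ler_sum => i _.
  have s0 : 0 <= sqrtC (d 0 i) by rewrite sqrtC_ge0.
  rewrite -{2}(sqrtCK (d 0 i)) -[1 in leRHS](expr1n C 2) subr_sqr normrM exprMn.
  rewrite ler_peMr ?exprn_ge0 // exprn_ege1 // ger0_norm ?addr_ge0 //.
  by rewrite lerDr.
Qed.

End Polar.

Lemma mul_delta_entry (C : nzSemiRingType) m n p q (A : 'M[C]_(m, n)) (B : 'M_(p, q)) i i' j j' :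
  (A *m delta_mx i j *m B) i' j' = A i' i * B j j'.
Proof.
by rewrite -(mul_delta_mx (0 : 'I_1)) mulmxA -colE -mulmxA -rowE mxE big_ord1 !mxE.
Qed.

(** * Equivariant polar decomposition *)

Section UnitaryRep.
Variables (C : numClosedFieldType) (H : finGroupType).

Definition unirep n (r : H -> 'M[C]_n) :=
  (forall h, r h \is unitarymx) /\ {morph r : x y / (x * y)%g >-> x *m y}.

Lemma unirep1 n (r : H -> 'M[C]_n) : unirep r -> r 1%g = 1%:M.
Proof.
move=> [rU rM]; have r1 := unitarymx_unit (rU 1%g).
by rewrite -[LHS]mulmx1 -(mulmxV r1) mulmxA -rM mulg1 mulmxV.
Qed.

Lemma unirepV n (r : H -> 'M[C]_n) h : unirep r -> r h^-1%g = (r h)^t*.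
Proof.
move=> rP; have [rU rM] := rP.
by rewrite -[LHS]mulmx1 -(unitarymxP (rU h)) mulmxA -rM mulVg unirep1 // mul1mx.
Qed.

Lemma unirep_triv n : unirep (fun _ : H => 1%:M : 'M[C]_n).
Proof. by split=> [h|x y]; [apply/unitarymxP; rewrite ctr1 mulmx1 | rewrite mulmx1]. Qed.

Variables (n : nat) (r r' : H -> 'M[C]_n).
Hypotheses (rP : unirep r) (r'P : unirep r').

Definition inter (A : 'M[C]_n) := forall h, r h *m A = A *m r' h.

Lemma inter_ctr A : inter A -> forall h, r' h *m A^t* = A^t* *m r h.
Proof.
move=> rA h; have := congr1 (fun X : 'M[C]_n => X^t*) (rA h^-1%g).
by rewrite /= !ctrM !unirepV // !trmxCK.
Qed.

Lemma inter_gram A : inter A -> forall h, r' h *m (A^t* *m A) = A^t* *m A *m r' h.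
Proof. by move=> rA h; rewrite mulmxA inter_ctr // -mulmxA rA mulmxA. Qed.

Lemma inter_avg X : inter (\sum_h r h *m X *m r' h^-1%g).
Proof.
move=> k; rewrite mulmx_sumr mulmx_suml [RHS](reindex_inj (mulgI k)) /=.
apply: eq_bigr => h _; have [[_ rM] [_ r'M]] := (rP, r'P).
by rewrite -!mulmxA -r'M invMg mulgKV !mulmxA -rM.
Qed.

Hypothesis tr_rr' : forall h, \tr (r h) = \tr (r' h).

(** The complements of the initial and final spaces of [U] have the same character, because [U]
    identifies what is removed. Being nonzero, they admit a nonzero intertwiner, found by
    averaging. *)
Lemma avg_neq0 (U : 'M[C]_n) : inter U -> U *m U^t* *m U = U -> U^t* *m U != 1%:M ->
  exists2 B, inter B & B != 0 /\ (1%:M - U *m U^t*) *m B *m (1%:M - U^t* *m U) = B.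
Proof.
move=> rU UUU; set P := 1%:M - U^t* *m U; set P' := 1%:M - U *m U^t* => U1.
have P0 : P != 0 by rewrite subr_eq0 eq_sym.
have Padj : P^t* = P by rewrite ctrB ctr1 ctrM trmxCK.
have UUU' : U^t* *m U *m U^t* = U^t*.
  by have := congr1 (fun X : 'M[C]_n => X^t*) UUU; rewrite /= !ctrM trmxCK mulmxA.
have PP : P *m P = P.
  by rewrite {1}/P mulmxBl mul1mx {2}/P mulmxBr mulmx1 mulmxA UUU' subrr subr0.
have P'P' : P' *m P' = P'.
  by rewrite {1}/P' mulmxBl mul1mx {2}/P' mulmxBr mulmx1 mulmxA UUU subrr subr0.
have rP' h : r h *m P' = P' *m r h.
  by rewrite mulmxBr mulmxBl mulmx1 mul1mx mulmxA rU -!mulmxA inter_ctr.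
have r'P0 h : r' h *m P = P *m r' h.
  by rewrite mulmxBr mulmxBl mulmx1 mul1mx inter_gram.
have trP h : \tr (P' *m r h) = \tr (P *m r' h).
  rewrite !mulmxBl !mul1mx !raddfB /= tr_rr'; congr (_ - _).
  by rewrite -mulmxA mxtrace_mulC -mulmxA rU mulmxA.
have [[X BX0]|no] := pselect (exists X : 'M[C]_n, \sum_h r h *m (P' *m X *m P) *m r' h^-1%g != 0).
  exists (\sum_h r h *m (P' *m X *m P) *m r' h^-1%g); first exact: inter_avg.
  split=> //; rewrite mulmx_sumr mulmx_suml; apply: eq_bigr => h _.
  by rewrite !mulmxA -rP' -!mulmxA r'P0 (mulmxA P P) PP (mulmxA P' P') P'P'.
have avg0 X : \sum_h (P' *m r h) *m X *m (r' h^-1%g *m P) = 0.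
  apply/eqP/negPn/negP => X0; apply: no; exists X; apply: contra X0 => /eqP X0; apply/eqP.
  rewrite -[RHS]X0; apply: eq_bigr => h _.
  by rewrite !mulmxA rP' -!mulmxA r'P0.
(* The matrix coefficients of the two restrictions are orthogonal, yet their traces agree. *)
have sum0 : \sum_h \tr (P' *m r h) * \tr (r' h^-1%g *m P) = 0.
  transitivity (\sum_i \sum_j (\sum_h (P' *m r h) *m delta_mx i j *m (r' h^-1%g *m P)) i j).
    rewrite (eq_bigr (fun h => \sum_i \sum_j
        ((P' *m r h) *m delta_mx i j *m (r' h^-1%g *m P)) i j)); last first.
      move=> h _; rewrite mulr_suml; apply: eq_bigr => i _; rewrite mulr_sumr.
      by apply: eq_bigr => j _; rewrite mul_delta_entry.
    rewrite exchange_big; apply: eq_bigr => i _; rewrite exchange_big; apply: eq_bigr => j _.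
    by rewrite summxE.
  by rewrite big1 // => i _; rewrite big1 // => j _; rewrite avg0 mxE.
have trC h : \tr (r' h^-1%g *m P) = (\tr (P *m r' h))^*.
  by rewrite -tr_ctr ctrM Padj unirepV.
case/negP: P0; apply/eqP/sqn_eq0; rewrite sqn_tr Padj PP.
move/eqP: sum0; rewrite psumr_eq0 => [/allP/(_ 1%g (mem_index_enum _))|h _]; last first.
  by rewrite trC trP mul_conjC_ge0.
by rewrite trC trP mul_conjC_eq0 unirep1 // mulmx1 => /eqP.
Qed.

(** The polar part [V] of an intertwiner between the complements is orthogonal to [U], so [U + V] is
    a larger partial isometry and the rank of the defect drops. The last equation says that [W]
    extends [U]. *)
Lemma extend_isometry c (U : 'M[C]_n) : (\rank (1%:M - U^t* *m U)%R <= c)%N ->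
  inter U -> U *m U^t* *m U = U ->
  exists W : 'M[C]_n, [/\ W \is unitarymx, inter W & W *m (U^t* *m U) = U].
Proof.
elim: c U => [|c IHc] U Uc rU UUU.
  have U1 : U^t* *m U = 1%:M.
    by move: Uc; rewrite leqn0 mxrank_eq0 subr_eq0 => /eqP ->.
  by exists U; split=> //; [exact/unitarymxP/mulmx1C | rewrite U1 mulmx1].
have [U1|U1] := eqVneq (U^t* *m U) 1%:M.
  by exists U; split=> //; [exact/unitarymxP/mulmx1C | rewrite U1 mulmx1].
have [B rB [B0 BE]] := avg_neq0 rU UUU U1.
set P := 1%:M - U^t* *m U in BE; set P' := 1%:M - U *m U^t* in BE.
have UUU' : U^t* *m U *m U^t* = U^t*.
  by have := congr1 (fun X : 'M[C]_n => X^t*) UUU; rewrite /= !ctrM trmxCK mulmxA.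
have [g [s [VVV Vs _ gC _]]] := polar_partial B; set V := B *m g in VVV Vs.
have V0 : V != 0 by apply: contra B0 => /eqP V0; rewrite -Vs V0 mul0mx.
have Padj : P^t* = P by rewrite ctrB ctr1 ctrM trmxCK.
have PP : P *m P = P.
  by rewrite {1}/P mulmxBl mul1mx {2}/P mulmxBr mulmx1 mulmxA UUU' subrr subr0.
have P'P' : P' *m P' = P'.
  by rewrite {1}/P' mulmxBl mul1mx {2}/P' mulmxBr mulmx1 mulmxA UUU subrr subr0.
have BP : B *m P = B by rewrite -BE -(mulmxA _ P P) PP.
have P'B : P' *m B = B by rewrite -BE !mulmxA P'P'.
have gP : P *m g = g *m P.
  apply: gC; rewrite -mulmxA BP mulmxA; congr (_ *m _).
  by rewrite -{1}Padj -ctrM BP.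
have VP : V *m P = V by rewrite /V -mulmxA -gP mulmxA BP.
have P'V : P' *m V = V by rewrite /V mulmxA P'B.
have rV : inter V.
  by move=> h; rewrite /V mulmxA rB -!mulmxA gC //; exact: inter_gram.
have UP' : U^t* *m P' = 0 by rewrite /P' mulmxBr mulmx1 mulmxA UUU' subrr.
have PU : P *m U^t* = 0 by rewrite /P mulmxBl mul1mx UUU' subrr.
have UV : U^t* *m V = 0 by rewrite -P'V mulmxA UP' mul0mx.
have VU : V *m U^t* = 0 by rewrite -VP -mulmxA PU mulmx0.
have VU' : V^t* *m U = 0.
  by have := congr1 (fun X : 'M[C]_n => X^t*) UV; rewrite /= ctrM trmxCK ctr0.
have UV' : U *m V^t* = 0.
  by have := congr1 (fun X : 'M[C]_n => X^t*) VU; rewrite /= ctrM trmxCK ctr0.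
have gramE : (U + V)^t* *m (U + V) = U^t* *m U + V^t* *m V.
  by rewrite ctrD mulmxDl !mulmxDr UV VU' addr0 add0r.
have [|||W [WU rW WE]] := IHc (U + V).
- rewrite -ltnS; apply: leq_trans Uc; rewrite -(ltr_nat C).
  have idemE (A : 'M[C]_n) : A *m A = A -> (1%:M - A) *m (1%:M - A) = 1%:M - A.
    by move=> AA; rewrite mulmxBl mul1mx mulmxBr mulmx1 AA subrr subr0.
  rewrite -!idem_trace_rank ?idemE //; last 2 first.
  + by rewrite mulmxA UUU'.
  + have XY : U^t* *m U *m (V^t* *m V) = 0 by rewrite -mulmxA (mulmxA U) UV' mul0mx mulmx0.
    have YX : V^t* *m V *m (U^t* *m U) = 0 by rewrite -mulmxA (mulmxA V) VU mul0mx mulmx0.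
    rewrite gramE mulmxDl !mulmxDr XY YX addr0 add0r mulmxA UUU'.
    by rewrite -mulmxA (mulmxA V) VVV.
  rewrite gramE opprD addrA raddfB /= ltrBlDr ltrDl -sqn_trC.
  by rewrite lt_def sqn_ge0 andbT; apply: contra V0 => /eqP/sqn_eq0 ->.
- by move=> h; rewrite mulmxDr mulmxDl rU rV.
- rewrite -mulmxA gramE mulmxDl !mulmxDr (mulmxA U) UUU (mulmxA U) UV' mul0mx addr0.
  by rewrite (mulmxA V) VU mul0mx add0r (mulmxA V) VVV.
exists W; split=> //; have := congr1 (fun X => X *m (U^t* *m U)) WE.
have XX : (U^t* *m U + V^t* *m V) *m (U^t* *m U) = U^t* *m U.
  by rewrite mulmxDl mulmxA UUU' -mulmxA (mulmxA V) VU mul0mx mulmx0 addr0.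
rewrite /= gramE -mulmxA XX => ->.
by rewrite mulmxDl (mulmxA V) VU mul0mx addr0 mulmxA.
Qed.

(** Write [T = V s] and extend the partial isometry [V] to a unitary intertwiner [W]; then
    [T - W = W (s - 1)]. *)
Lemma polar T : inter T -> exists W : 'M[C]_n,
  [/\ W \is unitarymx, inter W & sqn (T - W) <= sqn (T^t* *m T - 1%:M)].
Proof.
move=> rT; have [g [s [VVV Vs QS gC le_s]]] := polar_partial T; set V := T *m g in VVV Vs QS.
have rV : inter V.
  by move=> h; rewrite /V mulmxA rT -!mulmxA gC //; exact: inter_gram.
have [W [WU rW WV]] := extend_isometry (leqnn _) rV VVV.
exists W; split=> //; apply: le_trans le_s.
rewrite -(sqn_unitaryl (s - 1%:M) WU) mulmxBr mulmx1.
suff -> : W *m s = T by [].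
by rewrite -QS mulmxA WV Vs.
Qed.

End UnitaryRep.

(** * Unitary groups *)

(* The groups [unitary_group R n] of the statement have dimension [n.+1]; block decompositions
   need dimension 0 as well. *)
Section UnitaryGroups.
Variables (R : realType) (n : nat).

Definition ugroup : Type := {A : 'M[R[i]]_n | A \is unitarymx}.
HB.instance Definition _ := Choice.on ugroup.

Lemma unitarymx1 : (1%:M : 'M[R[i]]_n) \is unitarymx.
Proof. by apply/unitarymxP; rewrite ctr1 mulmx1. Qed.

Definition ugroup_one : ugroup := exist _ 1%:M unitarymx1.
Definition ugroup_mul (A B : ugroup) : ugroup :=
  exist _ (val A *m val B) (mul_unitarymx (valP A) (valP B)).
Definition ugroup_inv (A : ugroup) : ugroup :=
  exist _ ((val A)^t*) (etrans (trmxC_unitary (val A)) (valP A)).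

Lemma ugroup_mulA : associative ugroup_mul.
Proof. by move=> A B D; apply: val_inj; rewrite /= mulmxA. Qed.
Lemma ugroup_mul1g : left_id ugroup_one ugroup_mul.
Proof. by move=> A; apply: val_inj; rewrite /= mul1mx. Qed.
Lemma ugroup_mulg1 : right_id ugroup_one ugroup_mul.
Proof. by move=> A; apply: val_inj; rewrite /= mulmx1. Qed.
Lemma ugroup_mulgV : right_inverse ugroup_one ugroup_inv ugroup_mul.
Proof. by move=> A; apply: val_inj; exact/unitarymxP/(valP A). Qed.
Lemma ugroup_mulVg : left_inverse ugroup_one ugroup_inv ugroup_mul.
Proof. by move=> A; apply/val_inj/unitary_mulVmx/(valP A). Qed.

HB.instance Definition _ := isGroup.Build ugroup
  ugroup_mulA ugroup_mul1g ugroup_mulg1 ugroup_mulVg ugroup_mulgV.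

End UnitaryGroups.

Section FrobeniusDistance.
Variable R : realType.
Local Notation C := R[i].

(* Locked, lest closing tactics unfold the double sum. *)
Definition nrm m n (A : 'M[C]_(m, n)) : R := locked (complex.Re (sqn A)).

Lemma nrmE m n (A : 'M[C]_(m, n)) : (nrm A)%:C%C = sqn A.
Proof. by rewrite /nrm -lock RRe_real // ger0_real // sqn_ge0. Qed.

Lemma nrm_ge0 m n (A : 'M[C]_(m, n)) : 0 <= nrm A.
Proof. by rewrite -lecR nrmE sqn_ge0. Qed.

Lemma nrmN m n (A : 'M[C]_(m, n)) : nrm (- A) = nrm A.
Proof. by rewrite /nrm sqnN. Qed.

Lemma nrm0 m n : nrm (0 : 'M[C]_(m, n)) = 0.
Proof. by rewrite /nrm sqn0 -lock. Qed.

Lemma nrm_ctr m n (A : 'M[C]_(m, n)) : nrm (A^t*) = nrm A.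
Proof. by rewrite /nrm sqn_ctr. Qed.

Lemma nrm_unitaryl m n (U : 'M[C]_m) (A : 'M_(m, n)) : U \is unitarymx ->
  nrm (U *m A) = nrm A.
Proof. by move=> UU; rewrite /nrm sqn_unitaryl. Qed.

Lemma nrm_unitaryr m n (U : 'M[C]_n) (A : 'M_(m, n)) : U \is unitarymx ->
  nrm (A *m U) = nrm A.
Proof. by move=> UU; rewrite /nrm sqn_unitaryr. Qed.

Lemma nrmD m n (A B : 'M[C]_(m, n)) : nrm (A + B) <= 2 * (nrm A + nrm B).
Proof. by rewrite -lecR rmorphM rmorph_nat rmorphD /= !nrmE sqnD. Qed.

Lemma nrm_unitary n (A : 'M[C]_n) : A \is unitarymx -> nrm A = n%:R.
Proof. by move=> AU; apply: complexI; rewrite nrmE sqn_unitary // rmorph_nat. Qed.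

Lemma nrmZ_invn m n (A : 'M[C]_(m, n)) k : nrm (k%:R^-1 *: A) = k%:R^-1 ^+ 2 * nrm A.
Proof.
apply: complexI; rewrite nrmE sqnZ rmorphM rmorphXn fmorphV rmorph_nat /= nrmE.
by rewrite ger0_norm ?invr_ge0 ?ler0n.
Qed.

(** The constant is crude, but the sums will be indexed by the fixed group [H]. *)
Lemma nrm_sum m n (I : Type) (s : seq I) (F : I -> 'M[C]_(m, n)) :
  nrm (\sum_(i <- s) F i) <= 2 ^+ size s * \sum_(i <- s) nrm (F i).
Proof.
elim: s => [|i s IHs]; first by rewrite !big_nil nrm0 mulr0.
rewrite !big_cons /= exprS -mulrA; apply: le_trans (nrmD _ _) _.
rewrite ler_pM2l // mulrDr lerD // ler_peMl ?nrm_ge0 // exprn_ege1 //.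
by rewrite ler1n.
Qed.

Lemma nrm_avg m n (I : finType) (F : I -> 'M[C]_(m, n)) (x : R) : (0 < #|I|)%N ->
  (forall i, nrm (F i) <= x) ->
  nrm (#|I|%:R^-1 *: \sum_i F i) <= 2 ^+ #|I| * x.
Proof.
move=> I0 Fx; have I1 : 0 < #|I|%:R :> R by rewrite ltr0n.
have x0 : 0 <= x by have [i _] := card_gt0P I0; exact: le_trans (nrm_ge0 _) (Fx i).
rewrite nrmZ_invn; apply: (@le_trans _ _ (#|I|%:R^-1 ^+ 2 * (2 ^+ #|I| * (#|I|%:R * x)))).
  rewrite ler_pM2l ?exprn_gt0 ?invr_gt0 //; apply: le_trans (nrm_sum _ _) _.
  rewrite -[size _]/(size (index_enum I)) [size _](_ : _ = #|I|); last by rewrite cardT enumT.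
  rewrite ler_pM2l ?exprn_gt0 //; apply: le_trans (ler_sum _ (fun i _ => Fx i)) _.
  by rewrite sumr_const -[leLHS]mulr_natl.
rewrite mulrCA ler_pM2l ?exprn_gt0 // expr2 -mulrA (mulrA _ #|I|%:R) mulVf ?gt_eqF // mul1r.
by rewrite ler_piMl // invf_le1 // ler1n.
Qed.

Definition udist n (A B : ugroup R n) : R := nrm (val A - val B).

Lemma udist_ge0 n (A B : ugroup R n) : 0 <= udist A B.
Proof. exact: nrm_ge0. Qed.

Lemma udist_id n (A : ugroup R n) : udist A A = 0.
Proof. by rewrite /udist subrr nrm0. Qed.

Lemma udist_sym n (A B : ugroup R n) : udist A B = udist B A.
Proof. by rewrite /udist -opprB nrmN. Qed.

Lemma udist_tri n (B A D : ugroup R n) : udist A D <= 2 * (udist A B + udist B D).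
Proof. by apply: le_trans (nrmD _ _); rewrite subrKA. Qed.

Lemma udist_mull n (A B D : ugroup R n) : udist (D * A)%g (D * B)%g = udist A B.
Proof. by rewrite /udist /= -mulmxBr (nrm_unitaryl _ (valP D)). Qed.

Lemma udist_mulr n (A B D : ugroup R n) : udist (A * D)%g (B * D)%g = udist A B.
Proof. by rewrite /udist /= -mulmxBl (nrm_unitaryr _ (valP D)). Qed.

Lemma udist_le n (A B : ugroup R n) : udist A B <= 8 * n%:R.
Proof.
apply: le_trans (nrmD _ _) _; rewrite nrmN !nrm_unitary ?(valP A) ?(valP B) //.
have : 0 <= n%:R :> R by []; lra.
Qed.

Lemma block_unitary m n (A : 'M[C]_m) (B : 'M_n) : A \is unitarymx -> B \is unitarymx ->
  block_mx A 0 0 B \is unitarymx.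
Proof.
move=> /unitarymxP AU /unitarymxP BU; apply/unitarymxP.
rewrite tr_block_mx map_block_mx mulmx_block !ctr0.
by rewrite !mulmx0 !mul0mx !addr0 !add0r AU BU -scalar_mx_block.
Qed.

Definition usum m n (A : ugroup R m) (B : ugroup R n) : ugroup R (m + n) :=
  exist _ (block_mx (val A) 0 0 (val B)) (block_unitary (valP A) (valP B)).

Lemma usumM m n (A A' : ugroup R m) (B B' : ugroup R n) :
  usum (A * A')%g (B * B')%g = (usum A B * usum A' B')%g.
Proof.
apply: val_inj; rewrite /= mulmx_block.
by rewrite !mulmx0 !mul0mx !addr0 !add0r.
Qed.

Lemma nrm_block m1 m2 n1 n2 (A : 'M[C]_(m1, n1)) (B : 'M_(m1, n2)) (A' : 'M_(m2, n1))
    (B' : 'M_(m2, n2)) :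
  nrm (block_mx A B A' B') = nrm A + nrm B + (nrm A' + nrm B').
Proof. by apply: complexI; rewrite !rmorphD /= !nrmE sqn_block. Qed.

Lemma udist_usum m n (A A' : ugroup R m) (B B' : ugroup R n) :
  udist (usum A B) (usum A' B') = udist A A' + udist B B'.
Proof.
rewrite /udist /= opp_block_mx add_block_mx !subr0 nrm_block !nrm0.
by rewrite addr0 add0r.
Qed.

Variable H : finGroupType.

(** Unitarity gives [B^t* B = 1 - Y^t* Y] for the last corner, so the unitary polar part [W]
    satisfies [nrm (B - W) <= nrm Y], while [nrm X + nrm Y = nrm X + nrm Z = k]. *)
Lemma utrim k m (A : ugroup R (k + m)) :
  exists A' : ugroup R m, udist A (usum 1%g A') <= 8 * k%:R.
Proof.
case: A => A AU; pose X := ulsubmx A; pose Y := ursubmx A; pose Z := dlsubmx A; pose B := drsubmx A.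
have AE : A = block_mx X Y Z B by rewrite submxK.
have := unitarymxP AU.
rewrite {1 2}AE tr_block_mx map_block_mx mulmx_block (@scalar_mx_block _ k m).
move=> /eq_block_mx[XY _ _ _].
have := unitary_mulVmx AU.
rewrite {1 2}AE tr_block_mx map_block_mx mulmx_block (@scalar_mx_block _ k m).
move=> /eq_block_mx[XZ _ _ YB].
(* For trivial representations every matrix is an intertwiner. *)
have t1 := @unirep_triv C H m.
have [|W [WU _ BW]] := polar t1 t1 (fun=> erefl) (T := B).
  by move=> h; rewrite mul1mx mulmx1.
exists (exist _ W WU).
rewrite /udist /= AE opp_block_mx add_block_mx !subr0 nrm_block.
have xy : nrm X + nrm Y = k%:R.
  by apply: complexI; rewrite rmorphD /= !nrmE !sqn_tr -raddfD /= XY mxtrace1 rmorph_nat.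
have xz : nrm X + nrm Z = k%:R.
  by apply: complexI; rewrite rmorphD /= !nrmE !sqn_trC -raddfD /= XZ mxtrace1 rmorph_nat.
have yy : nrm (Y^t* *m Y) <= nrm Y.
  rewrite -lecR !nrmE sqn_trC ctrM trmxCK -mulmxA mxtrace_mulC -!mulmxA.
  have -> : Y *m Y^t* = 1%:M - X *m X^t* by rewrite -XY addrAC subrr add0r.
  rewrite mulmxBr mulmx1 mulmxBr raddfB /= -sqn_tr lerBlDr lerDl.
  have -> : \tr (Y *m (Y^t* *m (X *m X^t*))) = sqn (X^t* *m Y).
    by rewrite sqn_trC ctrM trmxCK mxtrace_mulC !mulmxA.
  exact: sqn_ge0.
have bw : nrm (B - W) <= nrm (Y^t* *m Y).
  by move: BW; rewrite -YB opprD addrCA subrr addr0 sqnN -!nrmE lecR.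
have x1 := nrmD X (- 1%:M); rewrite nrmN (nrm_unitary (unitarymx1 R k)) in x1.
have x0 := nrm_ge0 X; have y0 := nrm_ge0 Y.
move: (nrm X) (nrm Y) (nrm Z) (nrm (X - _)) (nrm (B - W)) (nrm (Y^t* *m Y)) xy xz yy bw x1 x0 y0.
by clear => *; lra.
Qed.

(** The average [T] of [r h r'(h)^-1] is an intertwiner close to 1. Its unitary polar part
    conjugates [r] to [r'] and is close to [T], as [T^t* T - 1] is small. *)
Lemma unear_conj (eps : R) : 0 < eps -> exists2 delta : R, 0 < delta &
  forall n (r r' : H -> ugroup R n), is_hom r -> is_hom r' ->
    (forall h, udist (r h) (r' h) <= delta * n%:R) ->
    (forall h, \tr (val (r h)) = \tr (val (r' h))) ->
  exists2 w : ugroup R n, (forall h, r' h = r h ^ w)%g & udist w 1%g <= eps * n%:R.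
Proof.
move=> eps0; pose c : R := 2 ^+ #|H|; have c0 : 0 < c by rewrite exprn_gt0.
have H0 : (0 < #|H|)%N by apply/card_gt0P; exists 1%g.
have H1 : #|H|%:R != 0 :> C by rewrite pnatr_eq0 -lt0n.
(* Combines [nrm (1 - T) <= c e] with [nrm (T - W) <= 2 (c e + c^2 e)] through the factor 2 of
   [nrmD]. *)
pose b : R := 2 * (2 * (c + c * c) + c); have b0 : 0 < b by rewrite !(addr_gt0, mulr_gt0).
exists (eps / b); first by rewrite divr_gt0.
move=> n r r' rM r'M rr' trE; pose e := eps / b * n%:R.
pose rho h := val (r h); pose rho' h := val (r' h).
have rhoP : unirep rho by split=> [h|x y]; [exact: valP | rewrite /rho rM].
have rho'P : unirep rho' by split=> [h|x y]; [exact: valP | rewrite /rho' r'M].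
pose T := #|H|%:R^-1 *: \sum_h rho h *m 1%:M *m rho' h^-1%g.
have TI : inter rho rho' T.
  by move=> h; rewrite -scalemxAr -scalemxAl; congr (_ *: _); exact: inter_avg.
have avgB (A : 'M[C]_n) (F : H -> 'M[C]_n) :
    A - #|H|%:R^-1 *: \sum_h F h = #|H|%:R^-1 *: \sum_h (A - F h).
  by rewrite sumrB scalerBr sumr_const -[A *+ _]scaler_nat scalerA mulVf // scale1r.
have T1 : nrm (1%:M - T) <= c * e.
  rewrite avgB; apply: (nrm_avg H0) => h; rewrite mulmx1.
  have -> : 1%:M - rho h *m rho' h^-1%g = (rho' h - rho h) *m rho' h^-1%g.
    by rewrite mulmxBl -[in RHS]rho'P.2 mulgV unirep1.
  rewrite (nrm_unitaryr _ (rho'P.1 _)) -[rho' h - rho h]opprB nrmN.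
  exact: rr'.
have [|W [WU WI TW]] := polar rhoP rho'P _ TI; first exact: trE.
have TT : nrm (T^t* *m (1%:M - T)) <= c * (c * e).
  have -> : T^t* *m (1%:M - T) = #|H|%:R^-1 *: \sum_h (rho h *m rho' h^-1%g)^t* *m (1%:M - T).
    rewrite {1}/T ctrZ fmorphV rmorph_nat -scalemxAl -mulmx_suml; congr (_ *: (_ *m _)).
    by rewrite ctr_sum; apply: eq_bigr => h _; rewrite mulmx1.
  apply: (nrm_avg H0) => h; rewrite nrm_unitaryl; first exact: T1.
  by rewrite trmxC_unitary; exact: mul_unitarymx (rhoP.1 _) (rho'P.1 _).
have W1 : nrm (T - W) <= 2 * (c * e + c * (c * e)).
  apply: (@le_trans _ _ (nrm (T^t* *m T - 1%:M))).
    by move: TW; rewrite -!nrmE lecR.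
  have -> : T^t* *m T - 1%:M = - ((1%:M - T)^t* + T^t* *m (1%:M - T)).
    by rewrite ctrB ctr1 mulmxBr mulmx1 addrA subrK opprB.
  rewrite nrmN; apply: le_trans (nrmD _ _) _.
  by rewrite nrm_ctr ler_pM2l // lerD.
exists (exist _ W WU).
  move=> h; apply: val_inj; rewrite /= -[LHS]mul1mx -(unitary_mulVmx WU) -mulmxA.
  by have := WI h; rewrite /rho /rho' => <-.
rewrite /udist /=; have -> : W - 1%:M = - ((T - W) + (1%:M - T)).
  by rewrite [in RHS]addrC addrA subrK opprB.
rewrite nrmN; apply: le_trans (nrmD _ _) _.
have -> : eps * n%:R = 2 * (2 * (c * e + c * (c * e)) + c * e).
  transitivity (b * e); last by rewrite /b; ring.
  by rewrite /e mulrA mulrCA mulfV ?mulr1 // gt_eqF.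
by rewrite ler_pM2l //; exact: lerD W1 T1.
Qed.

End FrobeniusDistance.

(** * Isotypic projections *)

Lemma normal_idem_herm (C : numClosedFieldType) n (P : 'M[C]_n) :
  P *m P = P -> P *m P^t* = P^t* *m P -> P^t* = P.
Proof.
move=> PP PN; have PP' : P^t* *m P^t* = P^t* by rewrite -ctrM PP.
suff PE : P = P *m P^t* by rewrite {1}PE ctrM trmxCK -PE.
apply/eqP; rewrite -subr_eq0; apply/eqP/sqn_eq0.
have PPP' : P *m (P *m P^t*) = P *m P^t* by rewrite mulmxA PP.
have PP'P' : P *m P^t* *m P^t* = P *m P^t* by rewrite -mulmxA PP'.
have P4 : P *m P^t* *m (P *m P^t*) = P *m P^t*.
  by rewrite {2}PN -mulmxA (mulmxA (P^t*)) PP' -PN PPP'.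
by rewrite sqn_tr ctrB ctrM trmxCK mulmxBr !mulmxBl PPP' PP'P' P4 !subrr raddf0.
Qed.

Section IsotypicProjections.
Variables (C : numClosedFieldType) (H : finGroupType).
Local Notation G := [set: H]%G.
Local Notation aG := (regular_repr C G).
Local Notation sG := (DecSocleType aG : irrType C G).

Definition irr_type : finType := sG.
Local Notation eW T := (@Wedderburn_id C H G sG T).

Lemma pchar'G : ([pchar C]^'.-group G)%g.
Proof. by apply/pgroupP=> p _; rewrite inE /= pchar_num. Qed.

Lemma Wedderburn_in_gring (T : irr_type) : ((eW T) \in group_ring C G)%MS.
Proof.
rewrite -(Wedderburn_sum_pchar sG pchar'G).
by apply: submx_trans (Wedderburn_id_mem T) _; rewrite (sumsmx_sup T).
Qed.

(** Coefficients of the central idempotent of [T], chosen once so that the same combination gives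
    the projection in every representation. *)
Definition zcoef (T : irr_type) : H -> C := sval (cid (envelop_mxP (Wedderburn_in_gring T))).

Lemma zcoefE (T : irr_type) : (eW T) = \sum_h zcoef T h *: aG h.
Proof.
rewrite {1}(svalP (cid (envelop_mxP (Wedderburn_in_gring T)))).
by apply: eq_bigl => h; rewrite inE.
Qed.

(* The projection onto the [T]-isotypic component of [r]; locked, lest closing tactics
   unfold it. *)
Definition isot n (r : H -> 'M[C]_n) (T : irr_type) : 'M[C]_n :=
  locked (\sum_h zcoef T h *: r h).

Lemma isot_def n (r : H -> 'M[C]_n) T : isot r T = \sum_h zcoef T h *: r h.
Proof. by rewrite /isot -lock. Qed.

Definition matrep n (r : H -> 'M[C]_n) :=
  r 1%g = 1%:M /\ {morph r : x y / (x * y)%g >-> x *m y}.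

Lemma matrep_mx_repr n (r : H -> 'M[C]_n) : matrep r -> mx_repr G r.
Proof. by case=> r1 rM; split=> // x y _ _; exact: rM. Qed.

Lemma gring_op_sum n (rG : mx_representation C G n) (c : H -> C) (f : H -> H) :
  gring_op rG (\sum_h c h *: aG (f h)) = \sum_h c h *: rG (f h).
Proof.
rewrite linear_sum; apply: eq_bigr => h _.
by rewrite linearZ /= gring_opG // inE.
Qed.

Lemma isotE n (rG : mx_representation C G n) T : isot rG T = gring_op rG (eW T).
Proof. by rewrite isot_def zcoefE (gring_op_sum rG _ id). Qed.

Lemma Wedderburn_neq0 (T : irr_type) : (eW T) != 0.
Proof. by have [] := Wedderburn_is_id_pchar pchar'G T. Qed.

Lemma Wedderburn_mul (T S : irr_type) : (eW T) *m (eW S) = (T == S)%:R *: (eW T).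
Proof.
have [<-|TS] := eqVneq T S.
  by have [_ _ eT _] := Wedderburn_is_id_pchar pchar'G T; rewrite scale1r eT ?Wedderburn_id_mem.
by rewrite scale0r (Wedderburn_mulmx0 TS) ?Wedderburn_id_mem.
Qed.

Lemma center_expand A : (A \in 'Z(group_ring C G))%MS ->
  exists w : irr_type -> C, A = \sum_T w T *: (eW T).
Proof.
have splitG : group_splitting_field C G by exact: group_closure_closed_field.
rewrite (Wedderburn_center_pchar sG pchar'G splitG) => /submxP[u].
rewrite mulmx_sum_row => Au; exists (fun T => u 0 (enum_rank T)).
apply: (can_inj mxvecK); rewrite Au linear_sum (reindex (fun j : 'I_#|irr_type| => enum_val j)) /=;
  last first.
  by apply: onW_bij; exact: enum_val_bij.
by apply: eq_bigr => j _; rewrite linearZ rowK enum_valK.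
Qed.

Lemma center_mem A : (exists (c : H -> C) (f : H -> H), A = \sum_h c h *: aG (f h)) ->
  (forall h, A *m aG h = aG h *m A) -> (A \in 'Z(group_ring C G))%MS.
Proof.
move=> [c [f ->]] cA; rewrite sub_capmx memmx_cent_envelop; apply/andP; split.
  rewrite linear_sum summx_sub // => h _; rewrite linearZ scalemx_sub //.
  by rewrite envelop_mx_id // inE.
by apply/centgmxP => h _; rewrite cA.
Qed.

Section Rep.
Variables (n : nat) (r : H -> 'M[C]_n).
Hypothesis rP : matrep r.
Local Notation rG := (MxRepresentation (matrep_mx_repr rP)).

Lemma isot_mul T S : isot r T *m isot r S = (T == S)%:R *: isot r T.
Proof.
rewrite !(@isotE _ rG) -gring_opM ?Wedderburn_in_gring //.
by rewrite Wedderburn_mul linearZ.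
Qed.

Lemma isot_sum : \sum_T isot r T = 1%:M.
Proof.
rewrite (eq_bigr _ (fun T _ => @isotE _ rG T)) -linear_sum.
by rewrite (Wedderburn_sum_id_pchar _ pchar'G) /= gring_op1.
Qed.

Lemma isot_comm T h : isot r T *m r h = r h *m isot r T.
Proof.
have eZ : (mxvec (eW T) <= 'Z(group_ring C G))%MS.
  have splitG : group_splitting_field C G by exact: group_closure_closed_field.
  rewrite (Wedderburn_center_pchar sG pchar'G splitG).
  by apply: (eq_row_sub (enum_rank T)); rewrite rowK enum_rankK.
have Gh : h \in G by rewrite inE.
move: eZ; rewrite sub_capmx memmx_cent_envelop => /andP[_ /centgmxP/(_ h Gh) eh].
have -> : r h = gring_op rG (aG h) by rewrite gring_opG.
rewrite (@isotE _ rG) -!gring_opM ?eh ?Wedderburn_in_gring //.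
by rewrite envelop_mx_id.
Qed.

End Rep.

Lemma regular_matrep : matrep aG.
Proof. by split=> [|x y]; rewrite ?repr_mx1 ?repr_mxM ?inE. Qed.

(** Class sums are central, hence combinations of the central idempotents, with weights independent
    of the representation. Through traces, multiplicities will determine the character. *)
Lemma class_sum_expand : exists w : H -> irr_type -> C,
  forall n (r : H -> 'M[C]_n), matrep r ->
  forall h, \sum_k r (h ^ k)%g = \sum_T w h T *: isot r T.
Proof.
have ex h : exists w : irr_type -> C, \sum_k aG (h ^ k)%g = \sum_T w T *: (eW T).
  apply/center_expand/center_mem.
    by exists (fun=> 1), (fun k => h ^ k)%g; apply: eq_bigr => k _; rewrite scale1r.
  have [_ aM] := regular_matrep.
  move=> x; rewrite mulmx_suml mulmx_sumr [LHS](reindex_inj (mulIg x^-1%g)) /=.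
  apply: eq_bigr => k _; rewrite -!aM; congr (aG _).
  by rewrite conjgM -conjgCV.
have [w wP] := choice ex; exists w => n r rP h.
pose rG := MxRepresentation (matrep_mx_repr rP).
have := congr1 (gring_op rG) (wP h).
rewrite (eq_bigr (fun k => 1 *: aG (h ^ k)%g)) => [|k _]; last by rewrite scale1r.
rewrite gring_op_sum linear_sum /= => hE.
rewrite [LHS](_ : _ = \sum_k 1 *: rG (h ^ k)%g); last first.
  by apply: eq_bigr => k _; rewrite scale1r.
by rewrite hE; apply: eq_bigr => T _; rewrite linearZ /= (@isotE _ rG).
Qed.

(** An automorphism permutes the central idempotents. The images [B T] are orthogonal central
    idempotents with sum 1, so their weights are 0 or 1; as no [B T] vanishes, counting gives a
    bijection. *)
Lemma isot_twist_ex (a : H -> H) : is_hom a -> injective a ->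
  exists2 f : irr_type -> irr_type, injective f &
  forall n (r : H -> 'M[C]_n), matrep r ->
  forall T, isot (fun h => r (a h)) T = isot r (f T).
Proof.
move=> aM aI; have aP m (r : H -> 'M[C]_m) : matrep r -> matrep (fun h => r (a h)).
  by case=> r1 rM; split=> [|x y]; rewrite ?(hom1 aM) // aM rM.
have [b aK bK] := injF_bij aI.
have bM : is_hom b by move=> x y; apply: aI; rewrite aM !bK.
pose B T := isot (fun h => aG (a h)) T.
have aGP := aP _ _ regular_matrep.
have BM T S : B T *m B S = (T == S)%:R *: B T by exact: isot_mul.
have B1 : \sum_T B T = 1%:M by exact: isot_sum.
have ex T : exists w : irr_type -> C, B T = \sum_S w S *: (eW S).
  apply/center_expand/center_mem; first by exists (zcoef T), a; rewrite /B isot_def.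
  by move=> h; rewrite -(bK h); exact: isot_comm.
have [w wE] := choice ex.
have Be T S : B T *m (eW S) = w T S *: (eW S).
  rewrite wE mulmx_suml (bigD1 S) //= -scalemxAl Wedderburn_mul eqxx scale1r.
  rewrite big1 ?addr0 // => S' /negPf S'S.
  by rewrite -scalemxAl Wedderburn_mul S'S scale0r scaler0.
have scaleI (x y : C) S : x *: (eW S) = y *: (eW S) -> x = y.
  move=> xy; apply/eqP; rewrite -subr_eq0; have /eqP := congr1 (fun A => A - y *: (eW S)) xy.
  by rewrite /= subrr -scalerBl scaler_eq0 (negPf (Wedderburn_neq0 S)) orbF.
have wM T T' S : w T S * w T' S = (T == T')%:R * w T S.
  apply: (@scaleI _ _ S); rewrite mulrC -!scalerA -(Be T) [RHS]scalemxAl -BM.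
  by rewrite -mulmxA (Be T') scalemxAr.
have w1 S : \sum_T w T S = 1.
  apply: (@scaleI _ _ S); rewrite scaler_suml scale1r.
  by rewrite (eq_bigr _ (fun T _ => esym (Be T S))) -mulmx_suml B1 mul1mx.
have w01 T S : w T S != 0 -> forall T', w T' S = (T' == T)%:R.
  move=> w0 T'; have := wM T T' S; rewrite eq_sym => /eqP.
  by rewrite mulrC -[_ == _]subr_eq0 -mulrBl mulf_eq0 (negPf w0) orbF subr_eq0 => /eqP.
(* The regular representation twisted by the inverse [b] sends [B T] back to the nonzero idempotent
   of [T]. *)
have Bneq0 T : exists S, w T S != 0.
  apply: contrapT => no; case/negP: (Wedderburn_neq0 T); apply/eqP.
  have BT0 : B T = 0.
    rewrite wE big1 // => S _; case: (eqVneq (w T S) 0) => [->|w0]; first by rewrite scale0r.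
    by case: no; exists S.
  have aGbP : matrep (fun h => aG (b h)).
    by case: regular_matrep => r1 rM; split=> [|x y]; rewrite ?(hom1 bM) // bM rM.
  pose rb := MxRepresentation (matrep_mx_repr aGbP).
  have := congr1 (gring_op rb) BT0; rewrite /B isot_def gring_op_sum linear0 => <-.
  by rewrite zcoefE; apply: eq_bigr => h _; rewrite /= aK.
have [f fP] := choice Bneq0.
have fI : injective f.
  move=> T T' ff; have := w01 _ _ (fP T) T'; rewrite ff.
  by case: eqVneq => // _ w0; have := fP T'; rewrite w0 eqxx.
have [f' fK f'K] := injF_bij fI.
exists f => // n r rP T.
pose rG := MxRepresentation (matrep_mx_repr rP).
have BE : B T = (eW (f T)).
  rewrite wE (bigD1 (f T)) //= (w01 _ _ (fP T)) eqxx scale1r big1 ?addr0 // => S SfT.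
  have := w01 _ _ (fP (f' S)) T; rewrite f'K => ->.
  by case: eqVneq => [TS|]; [rewrite TS f'K eqxx in SfT|rewrite scale0r].
have := congr1 (gring_op rG) BE; rewrite /B isot_def gring_op_sum -(@isotE _ rG) => <-.
exact: isot_def.
Qed.

Section IsotSet.
Variables (n : nat) (r : H -> 'M[C]_n) (O : {set irr_type}).

Definition isot_set : 'M[C]_n := locked (\sum_(T in O) isot r T).

Lemma isot_set_def : isot_set = \sum_(T in O) isot r T.
Proof. by rewrite /isot_set -lock. Qed.

Hypothesis rP : matrep r.

Lemma isot_setM T : isot_set *m isot r T = if T \in O then isot r T else 0.
Proof.
rewrite isot_set_def mulmx_suml; case: ifPn => TO.
  rewrite (bigD1 T) //= isot_mul // eqxx scale1r big1 ?addr0 // => S /andP[_ /negPf ST].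
  by rewrite isot_mul // ST scale0r.
rewrite big1 // => S SO; rewrite isot_mul //; case: eqVneq => [ST|_]; last by rewrite scale0r.
by rewrite ST (negPf TO) in SO.
Qed.

Lemma isot_set_idem : isot_set *m isot_set = isot_set.
Proof.
rewrite {2}isot_set_def mulmx_sumr [RHS]isot_set_def; apply: eq_bigr => T TO.
by rewrite isot_setM TO.
Qed.

Lemma isot_set_comm h : isot_set *m r h = r h *m isot_set.
Proof.
rewrite isot_set_def mulmx_suml mulmx_sumr; apply: eq_bigr => T _.
exact: isot_comm.
Qed.

(** The adjoint is a combination of matrices [r h^-1], which commute with the projection; a normal
    idempotent is Hermitian. *)
Lemma isot_set_herm : (forall h, r h^-1%g = (r h)^t*) -> isot_set^t* = isot_set.
Proof.
move=> rV; apply: normal_idem_herm; first exact: isot_set_idem.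
have -> : isot_set^t* = \sum_(T in O) (isot r T)^t* by rewrite isot_set_def ctr_sum.
rewrite mulmx_sumr mulmx_suml; apply: eq_bigr => T _.
rewrite isot_def ctr_sum mulmx_sumr mulmx_suml; apply: eq_bigr => h _.
by rewrite ctrZ -rV -scalemxAr -scalemxAl isot_set_comm.
Qed.

(** Conjugation by [u] permutes the projections indexed by [O], since an injective self-map of a
    finite set is onto. *)
Lemma isot_set_twist (u : 'M[C]_n) (f : irr_type -> irr_type) : u \is unitarymx ->
  injective f -> (forall T, T \in O -> f T \in O) ->
  (forall T, isot (fun h => u^t* *m r h *m u) T = isot r (f T)) ->
  u *m isot_set = isot_set *m u.
Proof.
move=> uU fI fO rf; have OE : (f @: O)%SET = O.
  apply/eqP; rewrite eqEcard (card_imset _ fI) leqnn andbT.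
  by apply/fintype.subsetP => _ /imsetP[T TO ->]; exact: fO.
have PE : isot_set = u^t* *m isot_set *m u.
  rewrite [LHS]isot_set_def -OE big_imset /=; last by move=> ? ? _ _; exact: fI.
  rewrite isot_set_def mulmx_sumr mulmx_suml; apply: eq_bigr => T _.
  rewrite -rf !isot_def mulmx_sumr mulmx_suml; apply: eq_bigr => h _.
  by rewrite -scalemxAr -scalemxAl.
by rewrite {1}PE !mulmxA (unitarymxP uU) mul1mx.
Qed.

End IsotSet.

End IsotypicProjections.

(** * The unitary model *)

(* Summing [2 t |x| <= t^2 + |x|^2] over the diagonal. *)
Lemma norm_trace_le (C : numClosedFieldType) n (A : 'M[C]_n) (t : C) : 0 <= t ->
  2 * t * `|\tr A| <= t ^+ 2 * n%:R + sqn A.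
Proof.
move=> t0; apply: (@le_trans _ _ (\sum_i (t ^+ 2 + `|A i i| ^+ 2))); last first.
  rewrite big_split /= sumr_const card_ord mulr_natr lerD2l; apply: ler_sum => i _.
  by rewrite (bigD1 i) //= lerDl sumr_ge0 // => j _; exact: exprn_ge0.
apply: (@le_trans _ _ (\sum_i 2 * t * `|A i i|)).
  by rewrite -mulr_sumr ler_wpM2l ?mulr_ge0 // ler_norm_sum.
apply: ler_sum => i _; rewrite -subr_ge0.
have -> : t ^+ 2 + `|A i i| ^+ 2 - 2 * t * `|A i i| = (t - `|A i i|) ^+ 2 by ring.
by rewrite real_exprn_even_ge0 // rpredB ?normr_real // ger0_real.
Qed.

Section UnitaryTypes.
Variables (R : realType) (H : finGroupType).
Local Notation C := R[i].
Local Notation irrH := (irr_type C H).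
Implicit Types (T : irrH).

Definition urep n (r : H -> ugroup R n) : H -> 'M[C]_n := fun h => val (r h).

Lemma urepP n (r : H -> ugroup R n) : is_hom r -> matrep (urep r).
Proof. by move=> rM; split=> [|x y]; rewrite /urep ?(hom1 rM) ?rM. Qed.

Definition ucnt n (r : H -> ugroup R n) T : nat := \rank (isot (urep r) T).

(** Multiplicities become linear in the character, which yields additivity, conjugation invariance
    and continuity. *)
Lemma ucntE n (r : H -> ugroup R n) T : is_hom r ->
  (ucnt r T)%:R = \sum_h zcoef T h * \tr (urep r h).
Proof.
move=> /urepP rP; rewrite -idem_trace_rank; last by rewrite isot_mul // eqxx scale1r.
by rewrite isot_def raddf_sum; apply: eq_bigr => h _; rewrite /= mxtraceZ.
Qed.

Lemma ucnt_sum n (r : H -> ugroup R n) : is_hom r -> (\sum_T ucnt r T = n)%N.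
Proof.
move=> /urepP rP; apply/eqP; rewrite -(eqr_nat C) natr_sum -(mxtrace1 C n) -(isot_sum rP).
rewrite raddf_sum; apply/eqP/eq_bigr => T _.
by rewrite -idem_trace_rank // isot_mul // eqxx scale1r.
Qed.

Lemma ucnt_usum m n (r : H -> ugroup R m) (r' : H -> ugroup R n) : is_hom r -> is_hom r' ->
  forall T, ucnt (fun h => usum (r h) (r' h)) T = (ucnt r T + ucnt r' T)%N.
Proof.
move=> rM r'M T; have rr'M : is_hom (fun h => usum (r h) (r' h)).
  by move=> x y; rewrite rM r'M usumM.
apply/eqP; rewrite -(eqr_nat C) natrD !ucntE // -big_split; apply/eqP/eq_bigr => h _ /=.
by rewrite -mulrDr /urep /= mxtrace_block.
Qed.

Lemma ucnt_conj n (r : H -> ugroup R n) w : is_hom r ->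
  forall T, ucnt (fun h => r h ^ w)%g T = ucnt r T.
Proof.
move=> rM T; have rwM := hom_conj w rM.
apply/eqP; rewrite -(eqr_nat C) !ucntE //; apply/eqP/eq_bigr => h _; congr (_ * _).
by rewrite /urep conjgE /= mxtrace_mulC -mulmxA (unitarymxP (valP w)) mulmx1.
Qed.

(** The model wants a total function of [a]; [id] is the default outside injective endomorphisms. *)
Definition utwist (a : H -> H) : irrH -> irrH :=
  if pselect (is_hom a /\ injective a) is left aP
  then sval (cid2 (isot_twist_ex C aP.1 aP.2)) else id.

Lemma isot_twist n (r : H -> 'M[C]_n) a T : matrep r -> is_hom a -> injective a ->
  isot (fun h => r (a h)) T = isot r (utwist a T).
Proof.
move=> rP aM aI; rewrite /utwist; case: pselect => [aP|[]//].
by case: cid2 => f fI fP /=; exact: fP.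
Qed.

Lemma utwist_inj a : injective (utwist a).
Proof. by rewrite /utwist; case: pselect => [aP|_] //; case: cid2. Qed.

Lemma ucnt_twist n (r : H -> ugroup R n) a : is_hom r -> is_hom a -> injective a ->
  forall T, ucnt (fun h => r (a h)) T = ucnt r (utwist a T).
Proof. by move=> rM aM aI T; rewrite /ucnt -isot_twist //; exact: urepP. Qed.

Lemma ucnt_cont (eps : R) : 0 < eps -> exists2 delta : R, 0 < delta &
  forall n (r r' : H -> ugroup R n), is_hom r -> is_hom r' ->
    (forall h, udist (r h) (r' h) <= delta * n%:R) ->
  forall T, (ucnt r T)%:R <= (ucnt r' T)%:R + eps * n%:R :> R.
Proof.
move=> eps0; pose Z : R := \sum_(T : irrH) \sum_(h : H) complex.Re `|zcoef T h|.
have nE (z : C) : (complex.Re `|z|)%:C%C = `|z| by rewrite RRe_real // normr_real.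
have n0 (z : C) : 0 <= complex.Re `|z| by rewrite -lecR nE normr_ge0.
have Z1 : 0 < Z + 1 by rewrite ltr_wpDl // !sumr_ge0 // => T _; exact: sumr_ge0.
(* By [norm_trace_le], [nrm A <= t^2 n] bounds the modulus of the trace by [t n]; weighting by the
   coefficients costs at most a factor [Z]. *)
have [t t0 tE] : exists2 t, 0 < t & t * (Z + 1) = eps.
  by exists (eps / (Z + 1)); rewrite ?divr_gt0 // mulfVK // gt_eqF.
exists (t ^+ 2); first by rewrite exprn_gt0.
move=> n r r' rM r'M rr' T.
have trB h : complex.Re `|\tr (urep r h) - \tr (urep r' h)| <= t * n%:R.
  have le1 : 2 * t * complex.Re `|\tr (urep r h) - \tr (urep r' h)| <=
      t ^+ 2 * n%:R + nrm (urep r h - urep r' h).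
    have t0C : 0 <= t%:C%C :> C by rewrite lecR ltW.
    rewrite -lecR [in leRHS]rmorphD !rmorphM !rmorph_nat /= nE nrmE.
    by rewrite -raddfB /=; exact: norm_trace_le.
  have : 2 * t * complex.Re `|\tr (urep r h) - \tr (urep r' h)| <= 2 * t * (t * n%:R).
    apply: le_trans le1 _; have -> : 2 * t * (t * n%:R) = t ^+ 2 * n%:R + t ^+ 2 * n%:R by ring.
    by rewrite lerD2l; exact: rr'.
  by rewrite ler_pM2l // mulr_gt0.
have : complex.Re `|(ucnt r T)%:R - (ucnt r' T)%:R : C| <= eps * n%:R.
  apply: (@le_trans _ _ (\sum_h complex.Re `|zcoef T h| * (t * n%:R))).
    rewrite !ucntE // -sumrB -lecR nE rmorph_sum /=.
    apply: le_trans (ler_norm_sum _ _ _) _; apply: ler_sum => h _.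
    by rewrite -mulrBr normrM rmorphM /= nE ler_wpM2l // -nE lecR trB.
  rewrite -mulr_suml; apply: (@le_trans _ _ (Z * (t * n%:R))).
    rewrite ler_wpM2r ?mulr_ge0 ?(ltW t0) // /Z (bigD1 T) // lerDl.
    by apply: sumr_ge0 => S _; apply: sumr_ge0 => h _; exact: n0.
  by rewrite mulrA ler_wpM2r // -tE mulrC ler_wpM2l ?(ltW t0) // lerDl.
move: (ucnt r T) (ucnt r' T) => p q; rewrite -lecR nE => pq.
rewrite -lerBlDl -lecR; apply: le_trans pq.
rewrite rmorphB /= !rmorph_nat; apply: real_ler_norm.
by rewrite rpredB // realn.
Qed.

(** Sum over the conjugates of [h]: all have the same trace, and the sum expands in isotypic
    projections. *)
Lemma eq_ucnt_trace n (r r' : H -> ugroup R n) : is_hom r -> is_hom r' ->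
  (forall T, ucnt r T = ucnt r' T) -> forall h, \tr (val (r h)) = \tr (val (r' h)).
Proof.
have [w wP] := class_sum_expand C H; move=> rM r'M rr' h.
have trE (s : H -> ugroup R n) : is_hom s ->
    #|H|%:R * \tr (val (s h)) = \sum_T w h T * (ucnt s T)%:R.
  move=> sM; have := congr1 mxtrace (wP _ _ (urepP sM) h); rewrite !raddf_sum /= => sE.
  transitivity (\sum_k \tr (urep s (h ^ k)%g)).
    rewrite mulr_natl -sumr_const; apply: eq_bigr => k _.
    by rewrite /urep (homJ sM) conjgE /= mxtrace_mulC -mulmxA (unitarymxP (valP (s k))) mulmx1.
  rewrite sE; apply: eq_bigr => T _; rewrite mxtraceZ -idem_trace_rank //.
  by rewrite isot_mul ?eqxx ?scale1r //; exact: urepP.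
apply: (@mulfI _ (#|H|%:R : C)); last by rewrite !trE //; apply: eq_bigr => T _; rewrite rr'.
by rewrite pnatr_eq0 -lt0n; apply/card_gt0P; exists 1%g.
Qed.

Lemma unitary_near_conj (eps : R) : 0 < eps -> exists2 delta : R, 0 < delta &
  forall n (r r' : H -> ugroup R n), is_hom r -> is_hom r' ->
    (forall h, udist (r h) (r' h) <= delta * n%:R) ->
    (forall T, ucnt r T = ucnt r' T) ->
  exists2 w : ugroup R n, (forall h, r' h = r h ^ w)%g & udist w 1%g <= eps * n%:R.
Proof.
move=> /(unear_conj H)[delta delta0 deltaP]; exists delta => // n r r' rM r'M rr' cntE.
by apply: deltaP => //; exact: eq_ucnt_trace.
Qed.

Lemma projection_basis n (P : 'M[C]_n) : P *m P = P -> P^t* = P ->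
  exists A : 'M[C]_(\rank P, n), A *m A^t* = 1%:M /\ A^t* *m A = P.
Proof.
move=> PP Padj; pose A := schmidt (row_base P); exists A.
have A1 : A *m A^t* = 1%:M by apply/unitarymxP/schmidt_unitarymx/rank_leq_col.
have AP : (A :=: P)%MS.
  apply: eqmx_trans (eq_row_base P); apply: eqmx_schmidt_free; exact: row_base_free.
have AA : A *m P = A.
  have /submxP[X ->] : (A <= P)%MS by rewrite AP.
  by rewrite -mulmxA PP.
have PA : P *m (A^t* *m A) = P.
  have /submxP[X XE] : (P <= A)%MS by rewrite AP.
  transitivity (X *m A *m (A^t* *m A)); first by rewrite -XE.
  by rewrite !mulmxA -(mulmxA X) A1 mulmx1.
split=> //; have := congr1 (fun X : 'M[C]_n => X^t*) PA.
by rewrite /= !ctrM trmxCK Padj -mulmxA AA.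
Qed.

Lemma ecast_unitary k n (e : k = n) (W : 'M[C]_(k, n)) : W *m W^t* = 1%:M ->
  exists w : ugroup R n, forall X : ugroup R k,
    val (ecast j (ugroup R j) e X ^ w)%g = W^t* *m val X *m W.
Proof.
case: n / e W => W /unitarymxP WU; exists (exist _ W WU) => X.
by rewrite conjgE /= mulmxA.
Qed.

Lemma restrict_unitary (G : groupType) n a (psi : G -> ugroup R n) (A : 'M[C]_(a, n))
    (P : 'M[C]_n) : is_hom psi -> A *m A^t* = 1%:M -> A^t* *m A = P ->
  (forall g, val (psi g) *m P = P *m val (psi g)) ->
  exists2 rho : G -> ugroup R a, is_hom rho & forall g, val (rho g) = A *m val (psi g) *m A^t*.
Proof.
move=> psiM A1 AP Pcomm.
have fM g h : (A *m val (psi g) *m A^t*) *m (A *m val (psi h) *m A^t*) =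
    A *m val (psi (g * h)%g) *m A^t*.
  rewrite psiM /= !mulmxA -(mulmxA _ (A^t*) A) AP -(mulmxA A (val (psi g)) P) Pcomm.
  by rewrite mulmxA -AP mulmxA A1 mul1mx.
have fU g : A *m val (psi g) *m A^t* \is unitarymx.
  apply/unitarymxP; have -> : (A *m val (psi g) *m A^t*)^t* = A *m val (psi g^-1%g) *m A^t*.
    by rewrite (homV psiM) !ctrM trmxCK mulmxA.
  by rewrite fM mulgV (hom1 psiM) /= mulmx1.
pose f g : ugroup R a := exist (fun A => A \is unitarymx) _ (fU g).
by exists f => // g h; apply: val_inj; rewrite /= fM.
Qed.

(** The projection onto the types in [O] commutes with [psi g], as conjugation by [psi g] twists the
    restriction to [H]. The blocks are the compressions to its range and to the complement. *)
Lemma unitary_split (G : groupType) (i : H -> G) (O : {set irrH}) n (psi : G -> ugroup R n) :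
  normal_embedding i -> is_hom psi ->
  (forall g a T, conj_by i g a -> T \in O -> utwist a T \in O) ->
  exists a b (e : (a + b)%N = n) (w : ugroup R n) (psia : G -> ugroup R a)
    (psib : G -> ugroup R b),
    [/\ is_hom psia, is_hom psib,
        forall g, psi g = (ecast n (ugroup R n) e (usum (psia g) (psib g)) ^ w)%g,
        forall T, T \notin O -> ucnt (fun h => psia (i h)) T = 0%N &
        forall T, T \in O -> ucnt (fun h => psib (i h)) T = 0%N].
Proof.
move=> iN psiM Ocl; have iM : is_hom i by case: iN.
pose r h := val (psi (i h)); have rP : matrep r := urepP (hom_comp iM psiM).
pose P := isot_set r O; have PP : P *m P = P := isot_set_idem O rP.
have Pctr : P^t* = P.
  by apply: isot_set_herm => // h; rewrite /r (homV iM) (homV psiM).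
have Pcomm g : val (psi g) *m P = P *m val (psi g).
  have [_ _ /(_ g)[a ga]] := iN.
  apply: (isot_set_twist (valP (psi g)) (@utwist_inj a) (Ocl g a ^~ ga)) => T.
  rewrite -(isot_twist _ rP (conj_by_hom iN ga) (conj_by_inj iN ga)).
  congr isot; apply/funext => h.
  by rewrite /r ga (homJ psiM) conjgE /= mulmxA.
pose Q := 1%:M - P.
have QQ : Q *m Q = Q by rewrite mulmxBl mul1mx mulmxBr mulmx1 PP subrr subr0.
have Qctr : Q^t* = Q by rewrite ctrB ctr1 Pctr.
have Qcomm g : val (psi g) *m Q = Q *m val (psi g).
  by rewrite mulmxBl mulmxBr mul1mx mulmx1 Pcomm.
have PQ : P *m Q = 0 by rewrite mulmxBr mulmx1 PP subrr.
have [A [A1 AP]] := projection_basis PP Pctr; have [B [B1 BQ]] := projection_basis QQ Qctr.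
have [psia psiaM psiaE] := restrict_unitary psiM A1 AP Pcomm.
have [psib psibM psibE] := restrict_unitary psiM B1 BQ Qcomm.
have e : (\rank P + \rank Q)%N = n.
  apply/eqP; rewrite -(eqr_nat C) natrD -!idem_trace_rank // -raddfD /=.
  by rewrite /Q addrC subrK mxtrace1.
have APE : A *m P = A by have := mulmxA A (A^t*) A; rewrite AP A1 mul1mx.
have BQE : B *m Q = B by have := mulmxA B (B^t*) B; rewrite BQ B1 mul1mx.
have AXB X : X *m P = P *m X -> A *m X *m B^t* = 0.
  move=> XP; rewrite -APE -BQE ctrM Qctr !mulmxA -(mulmxA A P X) -XP.
  by rewrite -!mulmxA (mulmxA P Q) PQ mul0mx !mulmx0.
have AB : A *m B^t* = 0 by have := @AXB 1%:M; rewrite mulmx1 mul1mx mulmx1 => ->.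
have BA : B *m A^t* = 0 by rewrite -[LHS]trmxCK ctrM trmxCK AB ctr0.
have [w wE] : exists w : ugroup R n, forall X : ugroup R (\rank P + \rank Q),
    val (ecast j (ugroup R j) e X ^ w)%g = (col_mx A B)^t* *m val X *m col_mx A B.
  apply: ecast_unitary; rewrite tr_col_mx map_row_mx mul_col_row A1 B1 AB BA.
  by rewrite -scalar_mx_block.
exists (\rank P), (\rank Q), e, w, psia, psib; split=> //.
- move=> g; apply: val_inj; rewrite wE /= psiaE psibE tr_col_mx map_row_mx.
  rewrite mul_row_block !mulmx0 addr0 add0r mul_row_col !mulmxA AP BQ.
  rewrite -!(mulmxA _ (_^t*)) AP BQ -(mulmxA P) Pcomm mulmxA PP.
  by rewrite -(mulmxA Q) Qcomm mulmxA QQ -mulmxDl addrC subrK mul1mx.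
- move=> T TO; apply/eqP; rewrite mxrank_eq0.
  have -> : isot (urep (fun h => psia (i h))) T = A *m isot r T *m A^t*.
    rewrite !isot_def mulmx_sumr mulmx_suml; apply: eq_bigr => h _.
    by rewrite /urep psiaE -scalemxAr -scalemxAl.
  by rewrite -APE -(mulmxA A) isot_setM // (negPf TO) mulmx0 mul0mx.
- move=> T TO; apply/eqP; rewrite mxrank_eq0.
  have -> : isot (urep (fun h => psib (i h))) T = B *m isot r T *m B^t*.
    rewrite !isot_def mulmx_sumr mulmx_suml; apply: eq_bigr => h _.
    by rewrite /urep psibE -scalemxAr -scalemxAl.
  by rewrite -BQE -(mulmxA B) mulmxBl mul1mx isot_setM // TO subrr mulmx0 mul0mx.
Qed.

Definition unitary_model : rep_model R H := {|
  U := fun n => ugroup R n;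
  D := @udist R;
  bsum := @usum R;
  Kb_gt0 := ltr0Sn R 7;
  D_ge0 := @udist_ge0 R;
  D_id := @udist_id R;
  D_sym := @udist_sym R;
  D_tri := @udist_tri R;
  D_mull := @udist_mull R;
  D_mulr := @udist_mulr R;
  D_le := @udist_le R;
  bsumM := @usumM R;
  D_bsum := @udist_usum R;
  trim := @utrim R H;
  htype := irrH;
  cnt := ucnt;
  cnt_sum := ucnt_sum;
  cnt_bsum := ucnt_usum;
  cnt_conj := ucnt_conj;
  twist := utwist;
  cnt_twist := ucnt_twist;
  cnt_cont := ucnt_cont;
  near_conj := unitary_near_conj;
  split_rep := unitary_split
|}.

End UnitaryTypes.

(** * Transfer to the normalized Hilbert-Schmidt distance *)

Section UnitaryStable.
Variables (R : realType) (H : finGroupType) (G : groupType).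
Local Notation M := (unitary_model R H).

Definition to_ugroup n (A : unitary_group R n) : ugroup R n.+1 :=
  exist (fun B => B \is unitarymx) (val A) (valP A).
Definition of_ugroup n (A : ugroup R n.+1) : unitary_group R n :=
  exist (fun B => B \is unitarymx) (val A) (valP A).

Lemma to_ugroupM n (A B : unitary_group R n) :
  to_ugroup (A * B)%g = (to_ugroup A * to_ugroup B)%g.
Proof. exact: val_inj. Qed.

Lemma of_ugroupM n (A B : ugroup R n.+1) :
  of_ugroup (A * B)%g = (of_ugroup A * of_ugroup B)%g.
Proof. exact: val_inj. Qed.

Lemma of_ugroupK n (A : ugroup R n.+1) : to_ugroup (of_ugroup A) = A.
Proof. exact: val_inj. Qed.

Lemma hs_distE n (A B : unitary_group R n) :
  hs_dist A B = Num.sqrt (udist (to_ugroup A) (to_ugroup B) / n.+1%:R).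
Proof.
rewrite /hs_dist /hs_norm /normalized_trace -sqn_trC -nrmE.
have -> : (n.+1%:R : R[i]) = (n.+1%:R : R)%:C%C by rewrite rmorph_nat.
by rewrite -fmorph_div.
Qed.

Lemma hs_dist_ge0 n (A B : unitary_group R n) : 0 <= hs_dist A B.
Proof. exact: sqrtr_ge0. Qed.

(** [udist] is a squared distance, so accuracy [eps] for one becomes [eps ^+ 2] for the other. *)
Lemma hs_dist_le n (A B : unitary_group R n) (eps : R) : 0 <= eps ->
  (hs_dist A B <= eps) = (udist (to_ugroup A) (to_ugroup B) <= eps ^+ 2 * n.+1%:R).
Proof.
move=> eps0; rewrite hs_distE -[X in _ <= X](ger0_norm eps0) -sqrtr_sqr ler_sqrt ?sqr_ge0 //.
by rewrite ler_pdivrMr ?ltr0n.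
Qed.

Lemma stable_HS_stableU : stable (HS_class R) G -> stableU M G.
Proof.
move=> stG N phi N0 phiM.
have [N' NE] : exists N', N = fun k => (N' k).+1.
  by exists (fun k => (N k).-1); apply/funext => k; rewrite prednK.
subst N; have [|psi psiP] := stG N' (fun k g => of_ugroup (phi k g)).
  move=> g h; apply/cvg0P => [k|eps eps0]; first exact: hs_dist_ge0.
  have e2 : 0 < eps ^+ 2 by rewrite exprn_gt0.
  have [K KP] := phiM g h _ e2; exists K => k /KP.
  by rewrite /mc_dist /= (hs_dist_le _ _ (ltW eps0)) to_ugroupM !of_ugroupK.
exists (fun k g => to_ugroup (psi k g)) => [k x y|g eps eps0].
  by rewrite gmulfM to_ugroupM.
have e2 : 0 < Num.sqrt eps by rewrite sqrtr_gt0.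
have [K KP] := (cvg0P (fun k => hs_dist_ge0 _ _)).1 (psiP g) _ e2; exists K => k /KP.
by rewrite (hs_dist_le _ _ (ltW e2)) of_ugroupK sqr_sqrtr // ltW.
Qed.

Lemma stableU_stable_HS : stableU M G -> stable (HS_class R) G.
Proof.
move=> stG X phi phiM.
have [//||psi psiM psiP] := stG (fun k => (X k).+1) (fun k g => to_ugroup (phi k g)).
  move=> g h eps eps0; have e2 : 0 < Num.sqrt eps by rewrite sqrtr_gt0.
  have [K KP] := (cvg0P (fun k => hs_dist_ge0 _ _)).1 (phiM g h) _ e2; exists K => k /KP.
  by rewrite (hs_dist_le _ _ (ltW e2)) to_ugroupM sqr_sqrtr // ltW.
have psi_ex k : exists psi' : {multiplicative G -> unitary_group R (X k)},
    psi' =1 fun g => of_ugroup (psi k g).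
  by apply: is_hom_multiplicative => x y; rewrite psiM of_ugroupM.
exists (fun k => projT1 (cid (psi_ex k))) => g.
apply/cvg0P => [k|eps eps0]; first exact: hs_dist_ge0.
have e2 : 0 < eps ^+ 2 by rewrite exprn_gt0.
have [K KP] := psiP g _ e2; exists K => k /KP.
by rewrite /mc_dist /= (hs_dist_le _ _ (ltW eps0)) (projT2 (cid (psi_ex k))) of_ugroupK.
Qed.

End UnitaryStable.

Theorem theorem8 (R : realType) (C : metric_class R)
    (hC : C = HS_class R \/ C = P_class R)
    (G1 G2 : groupType) (H : finGroupType)
    (i1 : {multiplicative H -> G1}) (i2 : {multiplicative H -> G2})
    (G1_fg : finitely_generated G1) (G2_fg : finitely_generated G2)
    (G1_stable : stable C G1) (G2_stable : stable C G2)
    (i1_inj : injective i1) (i2_inj : injective i2)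
    (i1_normal : is_normal_subgroup (range i1))
    (i2_normal : is_normal_subgroup (range i2)) :
  stable C (amalgam i1 i2).
Proof.
have i1N := normal_embedding_range i1_inj i1_normal.
have i2N := normal_embedding_range i2_inj i2_normal.
case: hC => CE; subst C.
  apply: (@stableU_stable_HS _ H); apply: stableU_amalgam => //; exact: stable_HS_stableU.
apply: (@stableU_stable_P _ H); apply: stableU_amalgam => //; exact: stable_P_stableU.
Qed.
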